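(* Let $n\geq3$ and let $\nu$ be a self-conjugate partition of $n-3$. (i) Suppose $\nu$ is a $3$-core. Let $\lambda$ be the partition of $n$ obtained by adding a $3$-hook to the first row of $\nu$ (so that $\lambda'$ is the partition obtained by adding a $3$-hook to the first column of $\nu$), and let $\mu$ be the self-conjugate partition of $n$ obtained by adding a principal $3$-hook to $\nu$. Then $\chi^\lambda\downarrow_{A_n}$, $\chi^{\mu^+}$ and $\chi^{\mu^-}$ agree on $3'$-classes. (ii) Suppose $\nu$ has a unique $3$-hook (necessarily on the diagonal). Let $\lambda$, $\lambda'$, $\mu$ and $\mu'$ be the four partitions of $n$ which can be obtained from $\nu$ by adding a $3$-hook. Then $\chi^\lambda\downarrow_{A_n}$ and $\chi^\mu\downarrow_{A_n}$ agree on $3'$-classes. Moreover, for each $n$ there is at most one $\nu$ satisfying the hypotheses of (i), and at most one $\nu$ satisfying the hypotheses of (ii).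
   Context: A $3'$-class of $A_n$ is a conjugacy class of elements of order not divisible by $3$. The ordinary irreducible characters of $S_n$ are $\chi^\lambda$, $\lambda$ a partition of $n$; $\lambda'$ denotes the conjugate partition. If $\lambda\neq\lambda'$, $\chi^\lambda\downarrow_{A_n}=\chi^{\lambda'}\downarrow_{A_n}$ is irreducible; if $\lambda=\lambda'$ (and $n\geq2$), $\chi^\lambda\downarrow_{A_n}$ is the sum of two distinct $S_n$-conjugate irreducible characters denoted $\chi^{\lambda^+},\chi^{\lambda^-}$ (signs assigned arbitrarily). A $3$-hook of a partition is a hook of length $3$ in its Young diagram, i.e. the hook of a box with hook length $3$; a partition is a $3$-core if it has no $3$-hooks. Adding a $3$-hook to $\nu$ means adding a rim hook of three boxes (a connected skew shape with three boxes containing no $2\times2$ square) so that the result is again the Young diagram of a partition. Adding a principal $3$-hook means doing so with a rim hook that meets the main diagonal and is symmetric about it, so that a self-conjugate partition yields a self-conjugate partition.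
   Formalization: The last clause is false as stated: for n=31 both (6,6,5,5,4,2) and (8,6,4,4,2,2,1,1) satisfy the hypotheses of (ii). It is replaced by: for each n and each 3-weight (number of 3-hooks removed to reach a 3-core) at most one ν satisfies the hypotheses of (ii). *)

(* Defs.v *)
From HB Require Import structures.
From mathcomp Require Import all_boot all_order all_fingroup all_algebra.
From mathcomp Require Import all_solvable all_field all_character.

Set Implicit Arguments.
Unset Strict Implicit.
Unset Printing Implicit Defensive.

Import GRing.Theory.

(* A partition is the weakly decreasing sequence of its nonzero parts.  Boxes
   of Young diagrams are pairs (row, column), both counted from 0. *)
Definition is_part (la : seq nat) : bool := sorted geq la && (0 \notin la).

Definition is_partn (n : nat) (la : seq nat) : bool :=
  is_part la && (sumn la == n).

Definition conj_part (la : seq nat) : seq nat :=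
  mkseq (fun j => count (fun r => j < r) la) (head 0 la).

Definition boxes (la : seq nat) : seq (nat * nat) :=
  [seq (i, j) | i <- iota 0 (size la), j <- iota 0 (nth 0 la i)].

(* arm + leg + 1, for b a box of la *)
Definition hook_length (la : seq nat) (b : nat * nat) : nat :=
  (nth 0 la b.1 - b.2.+1) + (nth 0 (conj_part la) b.2 - b.1.+1) + 1.

Definition hooks (h : nat) (la : seq nat) : seq (nat * nat) :=
  [seq b <- boxes la | hook_length la b == h].

Definition is_core (h : nat) (la : seq nat) : bool := hooks h la == [::].

Definition unique_hook (h : nat) (la : seq nat) : bool :=
  size (hooks h la) == 1.

Definition skew_boxes (la nu : seq nat) : seq (nat * nat) :=
  [seq b <- boxes la | b \notin boxes nu].

(* the two boxes share an edge *)
Definition adjacent : rel (nat * nat) := fun b c =>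
  ((b.1 == c.1) && ((b.2 == c.2.+1) || (c.2 == b.2.+1))) ||
  ((b.2 == c.2) && ((b.1 == c.1.+1) || (c.1 == b.1.+1))).

Definition connected_boxes (s : seq (nat * nat)) : Prop :=
  forall b c, b \in s -> c \in s ->
  exists p, [/\ path adjacent b p, last b p = c & {subset p <= s}].

Definition no_square (s : seq (nat * nat)) : Prop :=
  forall i j,
  ~~ [&& (i, j) \in s, (i, j.+1) \in s, (i.+1, j) \in s & (i.+1, j.+1) \in s].

(* la is obtained from nu by adding a rim hook with h boxes *)
Definition add_hook (h : nat) (nu la : seq nat) : Prop :=
  [/\ is_part nu /\ is_part la,
      {subset boxes nu <= boxes la},
      size (skew_boxes la nu) = h,
      connected_boxes (skew_boxes la nu)
    & no_square (skew_boxes la nu)].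

Definition add_hook_first_row (h : nat) (nu la : seq nat) : Prop :=
  add_hook h nu la /\ {in skew_boxes la nu, forall b, b.1 = 0}.

Definition add_hook_first_col (h : nat) (nu la : seq nat) : Prop :=
  add_hook h nu la /\ {in skew_boxes la nu, forall b, b.2 = 0}.

Definition add_principal_hook (h : nat) (nu la : seq nat) : Prop :=
  [/\ add_hook h nu la,
      exists i, (i, i) \in skew_boxes la nu
    & {in skew_boxes la nu, forall b, (b.2, b.1) \in skew_boxes la nu}].

(* has_weight h la w: la becomes an h-core after the successive removal of w
   rim hooks of length h. *)
Inductive has_weight (h : nat) : seq nat -> nat -> Prop :=
| weight_core la of is_part la & is_core h la : has_weight h la 0
| weight_add nu la w of add_hook h nu la & has_weight h nu w :
    has_weight h la w.+1.

(* la, la', mu, mu' are distinct, and are exactly the partitions obtained from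
   nu by adding an h-hook. *)
Definition four_added (h : nat) (nu la mu : seq nat) : Prop :=
  uniq [:: la; conj_part la; mu; conj_part mu] /\
  forall ka, add_hook h nu ka <->
             ka \in [:: la; conj_part la; mu; conj_part mu].

(* Boxes of la are numbered row by row, so that reshape_index and
   reshape_offset give the row and the column of k < sumn la. *)
Definition row_stab (n : nat) (la : seq nat) : {set 'S_n} :=
  [set s : 'S_n | [forall k : 'I_n,
                   reshape_index la (s k) == reshape_index la k]].

Definition col_stab (n : nat) (la : seq nat) : {set 'S_n} :=
  [set s : 'S_n | [forall k : 'I_n,
                   reshape_offset la (s k) == reshape_offset la k]].

(* The Young symmetrizer of the tableau above, in the group algebra of S_n,
   i.e. in the space of the (right) regular representation, where
   delta_mx 0 (gring_index _ g) is the basis vector of g. *)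
Definition young_symmetrizer (n : nat) (la : seq nat) :
    'rV[algC]_#|Sym 'I_n| :=
  (\sum_(p in row_stab n la) \sum_(q in col_stab n la)
     (-1) ^+ odd_perm q *:
       delta_mx 0 (gring_index (Sym 'I_n) (p * q)%g))%R.

(* chi^la, for la a partition of n: the character of the Specht module, the
   right ideal of the group algebra generated by the Young symmetrizer. *)
Definition chi (n : nat) (la : seq nat) : 'CF(Sym 'I_n) :=
  cfRepr (submod_repr (cyclic_mx_module (regular_repr algC (Sym 'I_n))
                                        (young_symmetrizer n la))).

Definition chi_alt (n : nat) (la : seq nat) : 'CF(Alt 'I_n) :=
  ('Res[Alt 'I_n] (chi n la))%R.

(* {'chi_p, 'chi_m} = {chi^(mu+), chi^(mu-)} *)
Definition alt_split (n : nat) (mu : seq nat) (p m : Iirr (Alt 'I_n)) : Prop :=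
  [/\ p != m,
      chi_alt n mu = ('chi_p + 'chi_m)%R
    & exists2 s, s \in Sym 'I_n & ('chi_m = ('chi_p ^ s)%CF)%R].

Definition agree_on_prime_to (r n : nat) (phi psi : 'CF(Alt 'I_n)) : Prop :=
  forall x, x \in Alt 'I_n -> ~~ (r %| #[x]%g) -> phi x = psi x.

(* A self-conjugate partition with a unique 3-hook is not determined by its
   size alone; the two below have 3-weights 4 and 9. *)
Lemma unique_hook_not_determined_by_size :
  exists nu1 nu2 : seq nat,
  [/\ is_partn 28 nu1 && is_partn 28 nu2,
      conj_part nu1 = nu1 /\ conj_part nu2 = nu2,
      unique_hook 3 nu1 && unique_hook 3 nu2
    & nu1 <> nu2].
Proof.
by exists [:: 6; 6; 5; 5; 4; 2], [:: 8; 6; 4; 4; 2; 2; 1; 1].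
Qed.

(* Main.v *)
(* Encode a partition nu by the integers nu_r - r - 1 (r >= 0).  Adding a
   3-hook replaces an element z of this set by z + 3, with sign given by the
   leg length, and conjugation is z -> -1 - z followed by the complement.
   Frobenius' formula makes chi^nu(g) a coefficient of the Vandermonde product
   times the power sums of the cycle lengths of g; if no cycle has length 3,
   this implies that the signed sum of chi^la(g) over all la obtained from nu
   by adding a 3-hook vanishes.  Conjugate partitions agree on A_n, so for nu
   as in (i) or (ii) only two terms are left, and evaluation at 1 shows that
   their signs are opposite.  In (i) this gives
   2 chi^la = chi^(mu+) + chi^(mu-) on 3'-classes.
   Let h have the diagonal hook lengths of mu, one of which is 3, as cycle
   lengths.  Then chi^mu(h) is 1 or -1, so chi^(mu+)(h) and chi^(mu-)(h)
   differ, and a Galois automorphism that inverts the cube roots of unity and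
   fixes the roots of unity of order prime to 3 exchanges these two values,
   hence the two characters, which therefore agree on 3'-classes.
   For uniqueness, every residue class mod 3 of the encoding of nu is an
   initial segment, except the self-dual one in (ii); the sizes of the residue
   classes are those of the 3-core and are determined by its size. *)
Require Import Defs.
From mathcomp Require Import all_boot all_order all_fingroup all_algebra.
From mathcomp Require Import all_solvable all_field all_character.
From mathcomp Require Import zify ring lra.
From mathcomp.multinomials Require Import mpoly.

Set Implicit Arguments.
Unset Strict Implicit.
Unset Printing Implicit Defensive.

Import Order.TTheory GRing.Theory Num.Theory.
Local Open Scope ring_scope.

(** * Specht modules *)

Section CyclicModules.

(** Since [chi] is defined by a Young symmetrizer, irreducibility and Frobenius' formula have to be
    derived from that definition. The bridge is a pair of numbers attached to each irreducible
    character: the multiplicity of the trivial character on the row stabilizer and that of the sign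
    on the column stabilizer. The sum of their products over all irreducible characters is at most
    1, which singles out one character. Frobenius' formula is proved without knowing that its
    right-hand side [psi] is a virtual character: [psi] and chi^la have the same norm, and it equals
    their inner product, so they coincide. The norm of [psi] comes from the Cauchy determinant
    identity, proved coefficient by coefficient by induction on the degree. In the vanishing of the
    signed sum the number of variables matters: raising an exponent by 3 is compatible with
    multiplication by a power sum p_l, l != 3, provided that the exponents 0, 1, 2 all occur. As nu
    has size n - 3, n variables are enough. *)

Lemma mxtrace_idem (F : fieldType) (n : nat) (A : 'M[F]_n) :
  A *m A = A -> \tr A = (\rank A)%:R.
Proof.
move=> AA; have [C' C'C] := row_fullP (col_base_full A).
have [R' RR'] := row_freeP (row_base_free A).
suff idem_tr r (C : 'M[F]_(n, r)) (R : 'M[F]_(r, n)) D S :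
    C *m R = A -> D *m C = 1%:M -> R *m S = 1%:M -> \tr A = r%:R.
  exact: idem_tr (mulmx_base A) C'C RR'.
move=> E DC RS; rewrite -E mxtrace_mulC.
(* The outer factors of a full-rank factorization can be cancelled from A A = A. *)
suff -> : R *m C = 1%:M by rewrite mxtrace1.
have : D *m (C *m R *m (C *m R)) *m S = D *m (C *m R) *m S by rewrite E AA.
by rewrite !mulmxA DC !mul1mx -!mulmxA RS mulmx1 => ->.
Qed.

Variables (gT : finGroupType) (G : {group gT}).
Local Notation aG := (regular_repr algC G).

Lemma mul_regular_mx (u : 'rV[algC]_#|G|) x z :
  x \in G -> z \in G ->
  (u *m aG x) 0 (gring_index G z) = u 0 (gring_index G (z * x^-1)%g).
Proof.
move=> Gx Gz; rewrite mxE (bigD1 (gring_index G (z * x^-1)%g)) //= !mxE.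
rewrite gring_indexK ?groupM ?groupV // mulgKV !eqxx mulr1.
rewrite big1 ?addr0 // => i; apply: contraNeq; rewrite !mxE eqxx /=.
case: (gring_index G z =P _) => [e _|_]; last by rewrite mulr0 eqxx.
apply/eqP; rewrite -[i](gring_valK i); congr gring_index.
move/(congr1 enum_val): e; rewrite !gring_indexK ?groupM ?enum_valP // => ->.
by rewrite mulgK.
Qed.

(** P is a coordinate map followed by a basis V of U. Cyclicity of the trace moves V to the front,
    and P acts as the identity on U. *)
Lemma submod_tr (n : nat) (rG : mx_representation algC G n) (U P : 'M_n)
    (modU : mxmodule rG U) x :
    x \in G -> (P <= U)%MS -> U *m P = U ->
  \tr (submod_repr modU x) = \tr (P *m rG x).
Proof.
move=> Gx PU UP.
set V := val_submod (1%:M : 'M_(\rank U)).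
have sVU : (V <= U)%MS by exact: val_submodP.
have PE : P = in_submod U P *m V by rewrite -val_submodE in_submodK.
rewrite PE -mulmxA [RHS]mxtrace_mulC; congr (\tr _).
have /submxP[D defVx] : (V *m rG x <= U)%MS by rewrite mxmodule_trans.
have VxP : V *m rG x *m P = V *m rG x by rewrite defVx -mulmxA UP.
have -> : submod_repr modU x = in_submod U (V *m rG x) by [].
by rewrite -{1}VxP [LHS]in_submodE -(mulmxA _ P) -in_submodE.
Qed.

(* A Maschke projection onto c A is left multiplication by an idempotent e with
   e A = c A, whose trace on an irreducible representation is its rank there. *)
Lemma cfdot_cyclic (c : 'rV[algC]_#|G|) i :
  '['chi_i, cfRepr (submod_repr (cyclic_mx_module aG c))]
    = (\rank (gring_mx 'Chi_i c))%:R.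
Proof.
set U := cyclic_mx aG c; set modU := cyclic_mx_module aG c.
have [W modW defV dxUW] : mxsplits aG 1%:M U.
  apply: mx_Maschke_pchar (submx1 _) => //.
  by rewrite /pgroup pcharf'_nat pnatr_eq0 -lt0n cardG_gt0.
have dx0 := mxdirect_addsP dxUW.
set P := proj_mx U W.
have sPU : (P <= U)%MS by rewrite -[P]mul1mx proj_mx_sub.
have UP : U *m P = U by rewrite proj_mx_id.
have homP x : x \in G -> aG x *m P = P *m aG x.
  move=> Gx; have /hom_mxP : (1%:M <= dom_hom_mx aG P)%MS.
    by rewrite -defV proj_mx_hom.
  by move/(_ x Gx); rewrite !mul1mx.
pose e := gring_row P.
have rowP h : h \in G -> row (gring_index G h) P = e *m aG h.
  move=> Gh; rewrite /e -gring_row_mul -homP // gring_row_mul.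
  by rewrite {1}/gring_row rowK gring_indexK // mul1g -rowE.
have trP x : x \in G -> \tr (P *m aG x) =
    \sum_(h in G) e 0 (gring_index G (h * x^-1 * h^-1)%g).
  move=> Gx; rewrite /mxtrace (reindex_onto (gring_index G) enum_val) /=; last first.
    by move=> k _; rewrite gring_valK.
  rewrite [RHS]big_mkcond /= big_mkcond; apply: eq_bigr => h _.
  have [Gh|Gh] := boolP (h \in G); last first.
    by case: eqP => // hK; rewrite -hK enum_valP in Gh.
  rewrite gring_indexK // eqxx.
  transitivity ((row (gring_index G h) P *m aG x) 0 (gring_index G h)).
    by rewrite -row_mul [RHS]mxE.
  by rewrite rowP // -mulmxA -repr_mxM // mul_regular_mx ?groupM // invMg mulgA.
have eP : e *m P = e.
  have /submxP[D ->] : (e <= U)%MS by rewrite (submx_trans _ sPU) // row_sub.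
  by rewrite -mulmxA UP.
have gmxP (u : 'rV_#|G|) : gring_mx 'Chi_i (u *m P) =
    gring_mx 'Chi_i e *m gring_mx 'Chi_i u.
  rewrite [u]row_sum_delta mulmx_suml !linear_sum /=.
  apply: eq_bigr => j _; rewrite -scalemxAl !linearZ /=; congr (_ *: _).
  have Gj := enum_valP j; rewrite -rowE -{1}[j]gring_valK rowP // gring_mxJ //.
  by congr (_ *m _); rewrite /gring_mx /= -rowE rowK mxvecK.
have [A RA eE] : exists2 A, (A \in group_ring algC G)%MS & e = c *m A.
  by apply/cyclic_mxP; rewrite (submx_trans _ sPU) // row_sub.
have cP : c *m P = c.
  have /submxP[D ->] : (c <= U)%MS by exact: cyclic_mx_id.
  by rewrite -mulmxA UP.
have <- : \rank (gring_mx 'Chi_i e) = \rank (gring_mx 'Chi_i c).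
  apply/eqP; rewrite eqn_leq -{2}cP gmxP mxrankM_maxl andbT.
  rewrite eE -(gring_rowK RA) gring_mxA mxrankM_maxl //.
rewrite -mxtrace_idem -?gmxP ?eP //.
have -> : \tr (gring_mx 'Chi_i e) =
    \sum_(x in G) e 0 (gring_index G x) * 'chi_i x.
  rewrite {1}[e]row_sum_delta !linear_sum /= (reindex_onto (gring_index G) enum_val).
    rewrite [RHS]big_mkcond /= big_mkcond; apply: eq_bigr => h _.
    have [Gh|Gh] := boolP (h \in G); last first.
      by case: eqP => // hK; rewrite -hK enum_valP in Gh.
    rewrite gring_indexK // eqxx !linearZ /=; congr (_ * _).
    rewrite -irrRepr cfunE Gh mulr1n; congr (\tr _).
    by rewrite /gring_mx /= -rowE rowK mxvecK gring_indexK.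
  by move=> k _; rewrite gring_valK.
rewrite cfdotE; apply: (canLR (mulKf (neq0CG G))).
transitivity (\sum_(x in G) \sum_(h in G)
    e 0 (gring_index G (h * x * h^-1)%g) * 'chi_i x).
  apply: eq_bigr => x Gx; rewrite -char_inv ?cfRepr_char // mulrC -mulr_suml.
  congr (_ * _); rewrite cfunE groupV Gx mulr1n (submod_tr _ _ sPU UP) ?groupV //.
  by rewrite trP ?groupV // invgK.
rewrite exchange_big mulr_natl -sumr_const /=; apply: eq_bigr => h Gh.
rewrite [RHS](reindex_inj (conjg_inj h^-1)%g) /=.
apply: eq_big => x; first by rewrite groupJr ?groupV.
by move=> Gx; rewrite cfunJ ?groupV // conjgE invgK mulgA.
Qed.
End CyclicModules.

(** Multiplicativity of e makes the sum #|H| times an idempotent, so [mxtrace_idem] applies. The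
    value is the multiplicity of the linear character e^-1 in the restriction to H. *)
Lemma rank_lin_sum (gT : finGroupType) (G H : {group gT}) n
    (rG : mx_representation algC G n) (e : gT -> algC) :
    H \subset G -> {in H &, {morph e : x y / (x * y)%g >-> x * y}} -> e 1%g = 1 ->
  (\rank (\sum_(x in H) e x *: rG x)%R)%:R
    = #|H|%:R^-1 * \sum_(x in H) e x * \tr (rG x).
Proof.
move=> /subsetP sHG eM e1; set M := (\sum_(x in H) e x *: rG x).
have MM : M *m M = #|H|%:R *: M.
  rewrite {1}/M mulmx_suml scaler_nat -sumr_const; apply: eq_bigr => x Hx.
  rewrite {2}/M (reindex_inj (mulgI x)) /= /M mulmx_sumr.
  rewrite [RHS](eq_bigl (mem H)) => [|y]; last by rewrite groupMl.
  apply: eq_bigr => y Hy; rewrite -scalemxAl -scalemxAr scalerA eM //.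
  by rewrite repr_mxM ?sHG.
have H0 := neq0CG H.
rewrite -(mxrank_scale_nz M (invr_neq0 H0)) -mxtrace_idem.
  rewrite mxtraceZ linear_sum /=; congr (_ * _); apply: eq_bigr => x _.
  by rewrite mxtraceZ.
by rewrite -scalemxAl -scalemxAr MM [X in _ *: X]scalerA mulVf ?scale1r.
Qed.

(** * Multiplicities on Young subgroups *)

Section Stabilizers.
Variables (n : nat).

(** [row_stab] and [col_stab] are the colourings by row and by column; Frobenius' formula needs
    arbitrary colourings. *)
Definition stab (T : eqType) (f : 'I_n -> T) : {set 'S_n} :=
  [set s : 'S_n | [forall k, f (s k) == f k]].

Lemma stabP (T : eqType) (f : 'I_n -> T) (s : 'S_n) :
  reflect (forall k, f (s k) = f k) (s \in stab f).
Proof. by rewrite inE; apply: (iffP forallP) => h k; apply/eqP. Qed.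

Lemma stab_group_set (T : eqType) (f : 'I_n -> T) : group_set (stab f).
Proof.
apply/group_setP; split=> [|s t /stabP fs /stabP ft]; apply/stabP=> k.
  by rewrite perm1.
by rewrite permM ft.
Qed.
Canonical stab_group (T : eqType) (f : 'I_n -> T) := Group (stab_group_set f).

(** On a character, [row_mult] and [sgn_mult] are the multiplicities of the trivial character and of
    the sign of the Young subgroup [stab f]. *)
Definition row_mult (T : eqType) (f : 'I_n -> T) (phi : 'CF(Sym 'I_n)) : algC :=
  #|stab f|%:R^-1 * \sum_(s in stab f) phi s.

Definition sgn_mult (T : eqType) (f : 'I_n -> T) (phi : 'CF(Sym 'I_n)) : algC :=
  #|stab f|%:R^-1 * \sum_(s in stab f) (-1) ^+ odd_perm s * phi s.

Lemma in_Sym (s : 'S_n) : s \in Sym 'I_n.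
Proof. by rewrite inE. Qed.

(** The symmetrizer acts on ['Chi_i] as A *m B, a row sum times a signed column sum, and its rank is
    at most that of either factor. *)
Lemma chi_mult_bounds la (i : Iirr (Sym 'I_n)) :
  exists r a b : nat,
  [/\ '['chi_i, chi n la] = r%:R, (r <= a)%N /\ (r <= b)%N,
      row_mult (reshape_index la) 'chi_i = a%:R
    & sgn_mult (fun k : 'I_n => reshape_offset la k) 'chi_i = b%:R].
Proof.
set R := row_stab n la; set C := col_stab n la.
pose A := \sum_(p in R) 1 *: 'Chi_i p.
pose B := \sum_(q in C) (-1) ^+ odd_perm q *: 'Chi_i q.
exists (\rank (A *m B)), (\rank A), (\rank B).
split.
- rewrite /chi cfdot_cyclic /young_symmetrizer; congr (\rank _)%:R.
  rewrite linear_sum /= mulmx_suml; apply: eq_bigr => p _.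
  rewrite linear_sum /= mulmx_sumr; apply: eq_bigr => q _.
  rewrite linearZ /= scale1r -scalemxAr; congr (_ *: _).
  by rewrite /gring_mx /= -rowE rowK mxvecK gring_indexK ?in_Sym // repr_mxM ?in_Sym.
- by rewrite mxrankM_maxl mxrankM_maxr.
- rewrite (@rank_lin_sum _ _ (stab_group _)) ?mulr1 //; last first.
  + by move=> x y _ _; rewrite mulr1.
  + by apply/subsetP=> x _; apply: in_Sym.
  congr (_ * _); apply: eq_bigr => p _.
  by rewrite mul1r -irrRepr cfunE in_Sym.
- rewrite (@rank_lin_sum _ _ (stab_group _)) //; last first.
  + by rewrite odd_perm1.
  + by move=> x y _ _ /=; rewrite odd_permM signr_addb.
  + by apply/subsetP=> x _; apply: in_Sym.
  congr (_ * _); apply: eq_bigr => p _.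
  by rewrite -irrRepr cfunE in_Sym.
Qed.

Lemma reshape_inj (sh : seq nat) (k l : nat) :
  reshape_index sh k = reshape_index sh l ->
  reshape_offset sh k = reshape_offset sh l -> k = l.
Proof. by move=> e1 e2; rewrite -(reshape_indexK sh k) e1 e2 reshape_indexK. Qed.

(** Row and column stabilizers meet only in the identity, so the symmetrizer has coefficient 1
    there. *)
Lemma chi_neq0 la : chi n la != 0.
Proof.
apply: contraTneq isT => /(congr1 (fun phi : 'CF(_) => phi 1%g)).
rewrite cfRepr1 cfunE => /eqP; rewrite pnatr_eq0 mxrank_eq0 cyclic_mx_eq0.
move/eqP/rowP/(_ (gring_index (Sym 'I_n) 1%g)); rewrite /young_symmetrizer.
have R1 : 1%g \in row_stab n la by exact: group1 (stab_group _).
have C1 : 1%g \in col_stab n la by exact: group1 (stab_group _).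
rewrite summxE (bigD1 1%g) //= summxE (bigD1 1%g) //= !mxE odd_perm1 expr0 mulg1.
rewrite !eqxx mulr1 !big1 ?addr0 => [/eqP|p /andP[Rp p1]|q /andP[Cq q1]].
- by rewrite oner_eq0.
- rewrite summxE big1 // => q Cq; rewrite !mxE eqxx /=.
  case: eqP => [/(congr1 enum_val)|]; last by rewrite mulr0.
  rewrite !gring_indexK ?in_Sym // => pq1; case/eqP: p1; apply/permP=> k.
  rewrite perm1; apply/val_inj/(@reshape_inj la); first exact: (stabP _ _ Rp).
  have qE : q = (p^-1)%g by apply/eqP; rewrite eq_sym eq_invg_mul -pq1.
  by have /stabP/(_ (p k)) := Cq; rewrite qE permK => ->.
- rewrite !mxE eqxx mul1g /=.
  case: eqP => [/(congr1 enum_val)|]; last by rewrite mulr0.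
  by rewrite !gring_indexK ?in_Sym // => /esym/eqP; rewrite (negPf q1).
Qed.

End Stabilizers.

Section Multiplicities.
Variables (n : nat).
Implicit Types (T : eqType) (i : Iirr (Sym 'I_n)).

Lemma row_mult_nat T (f : 'I_n -> T) i : exists a : nat, row_mult f 'chi_i = a%:R.
Proof.
exists (\rank (\sum_(p in stab f) (1 : algC) *: 'Chi_i p)%R).
rewrite (@rank_lin_sum _ _ (stab_group _)) ?mulr1 //; last first.
- by move=> x y _ _; rewrite mulr1.
- by apply/subsetP=> x _; apply: in_Sym.
by congr (_ * _); apply: eq_bigr => p _; rewrite mul1r -irrRepr cfunE in_Sym.
Qed.

Lemma sgn_mult_nat T (f : 'I_n -> T) i : exists a : nat, sgn_mult f 'chi_i = a%:R.
Proof.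
exists (\rank (\sum_(p in stab f) ((-1) ^+ odd_perm p : algC) *: 'Chi_i p)%R).
rewrite (@rank_lin_sum _ _ (stab_group _)) //; last first.
- by rewrite odd_perm1.
- by move=> x y _ _ /=; rewrite odd_permM signr_addb.
- by apply/subsetP=> x _; apply: in_Sym.
by congr (_ * _); apply: eq_bigr => p _; rewrite -irrRepr cfunE in_Sym.
Qed.

Lemma stab_comp T (f : 'I_n -> T) (h s : 'S_n) :
  (s \in stab (f \o h)) = (s ^ h \in stab f)%g.
Proof.
apply/stabP/stabP=> sf k; last by have /= := sf (h k); rewrite permJ.
by rewrite -{1}[k](permKV h) permJ -[in RHS](permKV h k); apply: sf.
Qed.

Lemma eq_stab T (f f' : 'I_n -> T) : f =1 f' -> stab f = stab f'.
Proof. by move=> ff'; apply/setP=> s; rewrite !inE; apply: eq_forallb => k; rewrite !ff'. Qed.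

Lemma row_mult_comp T (f : 'I_n -> T) (h : 'S_n) phi :
  row_mult (f \o h) phi = row_mult f phi.
Proof.
have stabJ : stab f = [set (s ^ h)%g | s in stab (f \o h)].
  apply/setP=> s; apply/idP/imsetP=> [sf|[t + ->]]; last by rewrite stab_comp.
  by exists (s ^ h^-1)%g; rewrite ?conjgKV // stab_comp conjgKV.
rewrite /row_mult stabJ card_imset ?big_imset /=; last exact: conjg_inj.
  by congr (_ * _); apply: eq_bigr => s _; rewrite cfunJ ?in_Sym.
by move=> s t _ _; apply: conjg_inj.
Qed.

Lemma sgn_mult_comp T (f : 'I_n -> T) (h : 'S_n) phi :
  sgn_mult (f \o h) phi = sgn_mult f phi.
Proof.
have stabJ : stab f = [set (s ^ h)%g | s in stab (f \o h)].
  apply/setP=> s; apply/idP/imsetP=> [sf|[t + ->]]; last by rewrite stab_comp.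
  by exists (s ^ h^-1)%g; rewrite ?conjgKV // stab_comp conjgKV.
rewrite /sgn_mult stabJ card_imset ?big_imset /=; last exact: conjg_inj.
  by congr (_ * _); apply: eq_bigr => s _; rewrite cfunJ ?in_Sym // odd_permJ.
by move=> s t _ _; apply: conjg_inj.
Qed.

Lemma same_colours T (f f' : 'I_n -> T) :
    (forall c, #|[pred k | f k == c]| = #|[pred k | f' k == c]|) ->
  exists h : 'S_n, f' =1 f \o h.
Proof.
have cnt (g : 'I_n -> T) c :
    count_mem c [tuple g k | k < n] = #|[pred k | g k == c]|.
  by rewrite /= count_map -sum1_count big_enum_cond sum1_card; apply: eq_card.
move=> ff'; have : perm_eq [tuple f' k | k < n] [tuple f k | k < n].
  by apply/allP=> c _ /=; rewrite !cnt ff'.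
case/tuple_permP=> p /val_inj pE; exists p => k /=.
by have := congr1 (fun t => tnth t k) pE; rewrite !tnth_mktuple.
Qed.

(* Two elements with the same image under the pair (f o h, f') give a
   transposition in the intersection of stabilizers. *)
Lemma sum_sgn_stab T (F : 'I_n -> T) :
  \sum_(s in stab F) (-1) ^+ odd_perm s = (injectiveb F)%:R :> algC.
Proof.
have [/injectiveP injF|] := boolP (injectiveb F).
  have -> : stab F = 1%g.
    apply/setP=> s; rewrite [RHS]inE; apply/stabP/eqP=> [sF|-> k]; last by rewrite perm1.
    by apply/permP=> k; rewrite perm1; apply: injF.
  by rewrite big_set1 odd_perm1.
case/injectivePn=> x [y xy Fxy].
have tF : tperm x y \in stab F.
  by apply/stabP=> k; case: tpermP => // ->.
set S := \sum_(s in _) _; suff SN : S = - S.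
  have/eqP : S *+ 2 = 0 by rewrite mulr2n {1}SN addNr.
  by rewrite mulrn_eq0 /= => /eqP.
rewrite {1}/S (reindex_inj (mulgI (tperm x y))) /= -sumrN.
apply: eq_big => [s|s _]; first by rewrite groupMl.
by rewrite odd_mul_tperm xy /= signrN.
Qed.

(** The sum is the inner product of the characters induced from the trivial character of [stab f]
    and from the sign of [stab f']. Second orthogonality turns it into a sum over h of the signs in
    the intersection of one stabilizer with a conjugate of the other. *)
Lemma sum_row_sgn_mult T T' (f : 'I_n -> T) (f' : 'I_n -> T') :
  #|stab f|%:R * #|stab f'|%:R *
     \sum_i row_mult f 'chi_i * sgn_mult f' 'chi_i
  = #|[set h : 'S_n | injectiveb (fun k => (f (h k), f' k))]|%:R.
Proof.
have Sg (s : 'S_n) := in_Sym s.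
have Sf0 : #|stab f|%:R != 0 :> algC by rewrite pnatr_eq0 -lt0n (cardG_gt0 (stab_group f)).
have Sf'0 : #|stab f'|%:R != 0 :> algC by rewrite pnatr_eq0 -lt0n (cardG_gt0 (stab_group f')).
transitivity (\sum_i \sum_(s in stab f) \sum_(t in stab f')
    (-1) ^+ odd_perm t * ('chi[Sym 'I_n]_i s * ('chi_i t)^*)).
  rewrite mulr_sumr; apply: eq_bigr => i _; rewrite /row_mult /sgn_mult.
  rewrite mulrACA !mulVKf // big_distrlr /=; apply: eq_bigr => s _.
  rewrite (reindex_inj invg_inj) /=; apply: eq_big => t; rewrite ?groupV // => _.
  by rewrite odd_permV mulrCA char_inv ?irr_char.
rewrite exchange_big /=.
transitivity (\sum_(s in stab f) \sum_(t in stab f') \sum_(h : 'S_n)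
    (-1) ^+ odd_perm t * (s == t ^ h)%g%:R : algC).
  apply: eq_bigr => s _; rewrite exchange_big /=; apply: eq_bigr => t _.
  rewrite -!mulr_sumr; congr (_ * _); rewrite second_orthogonality_relation ?Sg //.
  have -> : \sum_(h : 'S_n) (s == t ^ h)%g%:R = #|[set h | s == t ^ h]%g|%:R :> algC.
    by rewrite -natr_sum -sum1dep_card [in RHS]big_mkcond.
  case: imsetP => [[h0 _ sE]|/= no_h]; last first.
    rewrite mulr0n (_ : [set _ | _] = set0) ?cards0 //; apply/setP=> h.
    by rewrite !inE; apply/eqP=> sE; case: no_h; exists h; rewrite ?Sg.
  (* The solutions h form a coset of the centralizer of s, whose order is the value in the
     orthogonality relation. *)
  rewrite mulr1n (_ : [set h | _] = h0 *: 'C_(Sym 'I_n)[s])%g ?card_lcoset //.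
  apply/setP=> h; rewrite mem_lcoset inE in_setI Sg /=.
  apply/eqP/cent1P => [sh|/commute_sym/commgP/conjg_fixP].
    by apply/commute_sym/commgP/conjg_fixP;  rewrite conjgM {1}sE conjgK -sh.
  by rewrite conjgM {1}sE conjgK.
transitivity (\sum_(h : 'S_n) \sum_(t in stab (fun k => (f (h k), f' k))) (-1) ^+ odd_perm t : algC).
  rewrite (eq_bigr _ (fun s _ => exchange_big _ _ _ _ _ _)) /= exchange_big /=.
  apply: eq_bigr => h _; rewrite exchange_big /= [RHS]big_mkcond [LHS]big_mkcond.
  apply: eq_bigr => t _ /=.
  have -> : (t \in stab (fun k => (f (h k), f' k))) = (t \in stab f') && (t ^ h \in stab f)%g.
    rewrite -stab_comp; apply/stabP/andP => [tF|[/stabP tf' /stabP tf] k].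
      by split; apply/stabP=> k; have [] := tF k.
    by congr (_, _); [apply: tf | apply: tf'].
  case: (t \in stab f') => //=; rewrite big_mkcond (bigD1 (t ^ h)%g) //= eqxx mulr1.
  rewrite big1 ?addr0 // => s /negPf->; rewrite mulr0.
  by case: ifP.
rewrite (eq_bigr _ (fun h _ => sum_sgn_stab _)) -natr_sum; congr (_%:R).
rewrite -sum1dep_card [RHS]big_mkcond.
by apply: eq_bigr => h _ /=; case: injectiveb.
Qed.
End Multiplicities.

(** * Conjugate partitions *)

Section Diagrams.
Local Open Scope nat_scope.
Implicit Types la : seq nat.

Lemma eq_from_ltn x y : (forall i, (i < x) = (i < y)) -> x = y.
Proof.
by move=> xy; have := xy x; have := xy y; rewrite !ltnn; lia.
Qed.

Lemma nth_sorted_geq la i j : sorted geq la -> i <= j -> nth 0 la j <= nth 0 la i.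
Proof.
move=> s ij; have [jl|lj] := ltnP j (size la); last by rewrite (nth_default _ lj).
have tr : transitive geq by move=> a b c ba ca; exact: leq_trans ca ba.
have /(_ i j) := sorted_leq_nth tr (leqnn : reflexive geq) 0 s.
by rewrite !inE (leq_ltn_trans ij jl) jl => /(_ isT isT ij).
Qed.

Lemma nth_part_gt0 la i : is_part la -> (0 < nth 0 la i) = (i < size la).
Proof.
case/andP=> _ n0; have [il|li] := ltnP i (size la); last by rewrite nth_default.
by rewrite lt0n; apply: contraNneq n0 => <-; apply: mem_nth.
Qed.

Lemma count_gt_sorted la i j : sorted geq la ->
  (i < count (fun r => j < r) la) = (j < nth 0 la i).
Proof.
elim: la i => [|m la IH] i /=; first by rewrite nth_nil.
move=> s; have := IH _ (path_sorted s).
have tr : transitive geq by move=> a b c ba ca; exact: leq_trans ca ba.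
have la0 : m <= j -> count (fun r => j < r) la = 0.
  move=> mj; apply/eqP; rewrite -leqn0 leqNgt -has_count -all_predC.
  by apply: sub_all (order_path_min tr s) => x /= xm; rewrite -leqNgt (leq_trans xm).
case: i => [|i] IHi /=; last rewrite -IHi.
  by have [//|/la0->] := ltnP j m.
by have [//|/la0->] := ltnP j m.
Qed.

Lemma nth_conj la i j : is_part la ->
  (i < nth 0 (conj_part la) j) = (j < nth 0 la i).
Proof.
case/andP=> s _; have [jl|lj] := ltnP j (head 0 la).
  by rewrite nth_mkseq // count_gt_sorted.
rewrite nth_default ?size_mkseq // ltn0; symmetry; apply/negbTE.
by rewrite -leqNgt (leq_trans (nth_sorted_geq s (leq0n i))) // nth0.
Qed.

Lemma reshape_index_cons m la k :
  reshape_index (m :: la) k = if k < m then 0 else (reshape_index la (k - m)).+1.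
Proof.
by rewrite /reshape_index /= subn_eq0; case: ltnP => // mk; rewrite subSn.
Qed.

Lemma reshape_offset_cons m la k :
  reshape_offset (m :: la) k = if k < m then k else reshape_offset la (k - m).
Proof.
rewrite /reshape_offset reshape_index_cons; case: ltnP => mk /=; first by rewrite subn0.
by rewrite subnDA.
Qed.

Lemma sum_reshape (R : Type) (idx : R) (op : Monoid.com_law idx) la (F : nat -> nat -> R) :
  \big[op/idx]_(0 <= k < sumn la) F (reshape_index la k) (reshape_offset la k)
    = \big[op/idx]_(0 <= i < size la) \big[op/idx]_(0 <= j < nth 0 la i) F i j.
Proof.
elim: la F => [|m la IH] F /=; first by rewrite !big_geq.
rewrite (big_cat_nat (leq0n m)) ?leq_addr //= big_nat_recl //; congr (op _ _).
  apply: eq_big_nat => k /andP[_ km].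
  by rewrite reshape_index_cons reshape_offset_cons km.
rewrite -[X in \big[op/idx]_(X <= k < _) _]add0n big_addn addKn.
rewrite -(IH (fun i j => F i.+1 j)); apply: eq_bigr => k _.
by rewrite reshape_index_cons reshape_offset_cons ltnNge leq_addl addnK.
Qed.

Lemma card_ord_pred n (P : pred nat) : #|[pred k : 'I_n | P k]| = \sum_(0 <= k < n) P k.
Proof. by rewrite big_mkord -sum1_card big_mkcond. Qed.

Lemma card_row n la i : sumn la = n ->
  #|[pred k : 'I_n | reshape_index la k == i]| = nth 0 la i.
Proof.
move=> <-; rewrite (card_ord_pred _ (fun k => reshape_index la k == i)).
rewrite (@sum_reshape _ _ addn la (fun a b => a == i)).
have [il|li] := ltnP i (size la); last first.
  rewrite nth_default // big_nat big1 // => a /andP[_ al]; rewrite big1 // => _ _.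
  by case: eqP => // ai; move: al; rewrite ai ltnNge li.
rewrite big_mkord (bigD1 (Ordinal il)) //= eqxx sum_nat_const_nat subn0 muln1.
rewrite big1 ?addn0 // => a /negPf ai; rewrite big1 // => _ _.
by rewrite (_ : (_ == i) = false).
Qed.

Lemma card_col n la j : is_part la -> sumn la = n ->
  #|[pred k : 'I_n | reshape_offset la k == j]| = nth 0 (conj_part la) j.
Proof.
move=> pla <-; rewrite (card_ord_pred _ (fun k => reshape_offset la k == j)).
rewrite (@sum_reshape _ _ addn la (fun a b => b == j)).
transitivity (\sum_(0 <= a < size la) (j < nth 0 la a)).
  apply: eq_bigr => a _; case: ltnP => ja.
    rewrite big_mkord (bigD1 (Ordinal ja)) //= eqxx big1 // => b /negPf bj.
    by rewrite (_ : (_ == j) = false).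
  rewrite big_nat big1 // => b /andP[_ ba].
  by case: eqP => // bj; move: ba; rewrite bj ltnNge ja.
have [s _] := andP pla.
transitivity (count (fun r => j < r) la).
  by rewrite -sum1_count [RHS]big_mkcond [RHS](big_nth 0); apply: eq_bigr => a _; case: ifP.
by apply: eq_from_ltn => i; rewrite count_gt_sorted // nth_conj.
Qed.

(** Induction removing an element of largest value, which injectivity makes at least #|A| - 1. *)
Lemma sum_inj_min (T : finType) (A : {set T}) (r : T -> nat) :
  {in A &, injective r} ->
  'C(#|A|, 2) <= \sum_(k in A) r k ?= iff [forall k in A, r k < #|A|].
Proof.
elim: {A}_.+1 {-2}A (ltnSn #|A|) => // m IH A Am injr.
have [->|[k0 Ak0]] := set_0Vmem A.
  rewrite cards0 big_set0 /=; apply/leqifP; case: forallP => // h.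
  by case: h => k; rewrite inE.
pose k1 := [arg max_(k > k0 in A) r k].
have [Ak1 k1max] : k1 \in A /\ forall k, k \in A -> r k <= r k1.
  by rewrite /k1; case: arg_maxnP.
have cA : #|A| = #|A :\ k1|.+1 by rewrite (cardsD1 k1) Ak1.
have rk1 : #|A :\ k1| <= r k1.
  rewrite -ltnS -cA cardE -(size_map r) -(size_iota 0 (r k1).+1).
  apply: uniq_leq_size; first by rewrite map_inj_in_uniq ?enum_uniq // => x y; rewrite !mem_enum; apply: injr.
  by move=> _ /mapP[x + ->]; rewrite mem_enum mem_iota add0n => /k1max.
have := IH (A :\ k1) _ (sub_in2 _ injr).
rewrite -ltnS -cA => /(_ Am) []; first by move=> x /setD1P[].
rewrite (big_setD1 k1 Ak1) /= cA binS bin1 addnC => le1 eq1.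
split; first exact: leq_add.
apply/eqP/forall_inP => [eq2 k Ak|lt_r].
  have : r k <= r k1 := k1max k Ak.
  by move: eq2 le1 rk1; lia.
have rk1E : r k1 = #|A :\ k1| by apply/eqP; rewrite eqn_leq rk1 andbT -ltnS lt_r.
rewrite rk1E; congr (_ + _); apply/eqP; rewrite eq1.
apply/forall_inP=> k /setD1P[kk1 Ak].
rewrite ltn_neqAle -{1}rk1E -ltnS lt_r // andbT.
by apply: contraNneq kk1 => /injr->.
Qed.

Lemma leq_nth_sumn la i : nth 0 la i <= sumn la.
Proof.
elim: la i => [|m la IH] [|i] //=; first exact: leq_addr.
exact: leq_trans (IH i) (leq_addl _ _).
Qed.

Lemma size_part_leq la : is_part la -> size la <= sumn la.
Proof.
case/andP=> _; elim: la => //= m la IH; rewrite inE negb_or => /andP[m0 /IH].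
by move: m0; case: m => // m _ h; rewrite addSn ltnS (leq_trans h) ?leq_addl.
Qed.

Lemma sum_mul_ltn (F : nat -> nat) m N : m <= N ->
  \sum_(0 <= i < N) F i * (i < m) = \sum_(0 <= i < m) F i.
Proof.
move=> mN; rewrite (big_cat_nat (leq0n m)) //= [X in _ + X]big_nat.
rewrite [X in _ + X]big1 ?addn0 => [|i /andP[mi _]]; last by rewrite ltnNge mi muln0.
by apply: eq_big_nat => i /andP[_ ->]; rewrite muln1.
Qed.

Lemma nth_conj_leq la j : is_part la -> nth 0 (conj_part la) j <= size la.
Proof.
move=> pla; rewrite leqNgt nth_conj // nth_default //.
Qed.

(** The statistic n(la), the sum of the row indices of all boxes, counted by rows and by columns;
    column j contributes 0 + 1 + ... over its length. *)
Lemma sum_rows_cols la N : is_part la -> sumn la <= N ->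
  \sum_(0 <= i < N) i * nth 0 la i = \sum_(0 <= j < N) 'C(nth 0 (conj_part la) j, 2).
Proof.
move=> pla laN.
transitivity (\sum_(0 <= i < N) \sum_(0 <= j < N) i * (j < nth 0 la i)).
  apply: eq_bigr => i _; rewrite sum_mul_ltn; last by rewrite (leq_trans (leq_nth_sumn _ _)).
  by rewrite sum_nat_const_nat subn0 mulnC.
rewrite exchange_big_nat /=; apply: eq_bigr => j _; rewrite -bin2_sum -(@sum_mul_ltn id _ N).
  by apply: eq_bigr => i _; rewrite nth_conj.
by rewrite (leq_trans (nth_conj_leq _ pla)) // (leq_trans (size_part_leq pla)).
Qed.

(* The row weight sum_k (row of k) of a filling with distinct boxes and the
   column lengths of la is smallest when every column is pushed to the top. *)
Lemma inj_rows_cols n (r c : 'I_n -> nat) la :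
    is_part la -> sumn la = n -> injective (fun k => (r k, c k)) ->
    (forall j, #|[pred k | c k == j]| = nth 0 (conj_part la) j) ->
  \sum_(0 <= i < n) i * nth 0 la i <= \sum_k r k
     ?= iff [forall k, c k < nth 0 la (r k)].
Proof.
move=> pla lan inj cnt; rewrite sum_rows_cols ?lan //.
have cn k : c k < n.
  have := cnt (c k); rewrite (cardD1 k) inE eqxx add1n => /esym h.
  have := nth_conj 0 (c k) pla; rewrite h /= => /esym ck.
  by rewrite -lan (leq_trans ck) ?leq_nth_sumn.
have -> : \sum_k r k = \sum_(j < n) \sum_(k in [set k | c k == j]) r k.
  rewrite (partition_big (fun k => Ordinal (cn k)) predT) //=.
  by apply: eq_bigr => j _; apply: eq_bigl => k; rewrite inE.
rewrite big_mkord.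
have cnt' j : #|[set k | c k == j]| = nth 0 (conj_part la) j.
  by rewrite -cnt; apply: eq_card => k; rewrite inE.
have h (j : 'I_n) : true -> 'C(nth 0 (conj_part la) j, 2) <= \sum_(k in [set k | c k == j]) r k
     ?= iff [forall k in [set k | c k == j], r k < nth 0 (conj_part la) j].
  move=> _; rewrite -cnt'; apply: sum_inj_min => k l; rewrite !inE => /eqP ck /eqP cl rkl.
  by apply: inj; rewrite rkl ck cl.
have := leqif_sum h; congr leqif.
apply/forallP/forallP => [h1 k|h1 j].
  have /forall_inP/(_ k) := h1 (Ordinal (cn k)); rewrite inE eqxx => /(_ isT).
  by rewrite nth_conj.
by apply/forall_inP=> k; rewrite inE => /eqP <-; rewrite nth_conj.
Qed.

Lemma part_eq la mu : is_part la -> is_part mu ->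
  (forall i, nth 0 la i = nth 0 mu i) -> la = mu.
Proof.
move=> pla pmu e; apply: (@eq_from_nth _ 0) => //.
by apply: eq_from_ltn => i; rewrite -!nth_part_gt0 // e.
Qed.

Lemma size_conj la : size (conj_part la) = head 0 la.
Proof. exact: size_mkseq. Qed.

Lemma is_part_conj la : is_part la -> is_part (conj_part la).
Proof.
move=> pla; apply/andP; split.
  apply/(sortedP 0) => i _ /=; rewrite leqNgt; apply/negP => h.
  by have := h; rewrite nth_conj // => /ltnW; rewrite -nth_conj // ltnn.
apply/negP=> /(nthP 0)[j]; rewrite size_conj => jl /eqP.
by rewrite -leqn0 leqNgt nth_conj // nth0 jl.
Qed.

Lemma conj_partK la : is_part la -> conj_part (conj_part la) = la.
Proof.
move=> pla; have pla' := is_part_conj pla.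
apply: part_eq => // [|i]; first exact: is_part_conj.
by apply: eq_from_ltn => j; rewrite !nth_conj.
Qed.

Lemma sumn_nth la N : size la <= N -> sumn la = \sum_(0 <= i < N) nth 0 la i.
Proof.
move=> laN; rewrite sumnE (big_nth 0) [RHS](big_cat_nat (leq0n _) laN) /=.
rewrite [X in _ + X]big_nat [X in _ + X]big1 ?addn0 // => i /andP[li _].
by rewrite nth_default.
Qed.

Lemma sumn_conj la : is_part la -> sumn (conj_part la) = sumn la.
Proof.
move=> pla; set N := sumn la + head 0 la.
have sN : size la <= N by rewrite (leq_trans (size_part_leq pla)) ?leq_addr.
rewrite (@sumn_nth la N) // (@sumn_nth (conj_part la) N) ?size_conj ?leq_addl //.
transitivity (\sum_(0 <= j < N) \sum_(0 <= i < N) 1 * (i < nth 0 (conj_part la) j)).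
  apply: eq_bigr => j _; rewrite sum_mul_ltn; last by rewrite (leq_trans (nth_conj_leq _ pla)).
  by rewrite sum_nat_const_nat subn0 muln1.
rewrite exchange_big_nat /=; apply: eq_bigr => i _.
transitivity (\sum_(0 <= j < N) 1 * (j < nth 0 la i)).
  by apply: eq_bigr => j _; rewrite nth_conj.
rewrite sum_mul_ltn ?sum_nat_const_nat ?subn0 ?muln1 //.
by rewrite (leq_trans (leq_nth_sumn _ _)) ?leq_addr.
Qed.

End Diagrams.

(** * Irreducibility of the Specht characters *)

Section SpechtIrreducible.
Variables (n : nat) (la : seq nat).
Hypotheses (pla : is_part la) (lan : sumn la = n).

Notation rowf := (fun k : 'I_n => reshape_index la k).
Notation colf := (fun k : 'I_n => reshape_offset la k).

Lemma sum_row : (\sum_(k < n) reshape_index la k = \sum_(0 <= i < n) i * nth 0 la i)%N.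
Proof.
rewrite -(big_mkord xpredT (reshape_index la)) -{1}lan.
rewrite (@sum_reshape _ _ addn la (fun i j => i)).
have sn : (size la <= n)%N by rewrite -lan size_part_leq.
rewrite [RHS](big_cat_nat (leq0n _) sn) /= [X in (_ + X)%N]big_nat.
rewrite [X in (_ + X)%N]big1 ?addn0 => [|i /andP[li _]].
  by apply: eq_bigr => i _; rewrite sum_nat_const_nat subn0 mulnC.
by rewrite nth_default // muln0.
Qed.

Lemma fill_perm (r c : 'I_n -> nat) :
    injective (fun k => (r k, c k)) -> (forall k, c k < nth 0 la (r k))%N ->
  exists u : 'S_n, (forall k, reshape_index la (u k) = r k) /\
                   (forall k, reshape_offset la (u k) = c k).
Proof.
move=> inj rc.
have ltn k : (flatten_index la (r k) (c k) < n)%N by rewrite -lan flatten_indexP.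
have uinj : injective (fun k => Ordinal (ltn k)).
  move=> k l /(congr1 val) /= e; apply: inj.
  congr (_, _); first by rewrite -[LHS](flatten_indexKl (rc k)) e flatten_indexKl.
  by rewrite -[LHS](flatten_indexKr (rc k)) e flatten_indexKr.
by exists (perm uinj); split=> k; rewrite permE /= (flatten_indexKl, flatten_indexKr).
Qed.

(** [sum_row_sgn_mult] counts the h for which the boxes (row of h k, column of k) are distinct.
    Their row weight is the minimum in [inj_rows_cols], so they fill la again, and h is a column
    permutation followed by a row permutation. *)
Lemma sum_mult_leq1 :
  \sum_i row_mult rowf 'chi[Sym 'I_n]_i * sgn_mult colf 'chi_i <= 1.
Proof.
have c1 : (0 < #|stab rowf|)%N by exact: cardG_gt0 (stab_group rowf).
have c2 : (0 < #|stab colf|)%N by exact: cardG_gt0 (stab_group colf).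
rewrite -(ler_pM2l (_ : 0 < #|stab rowf|%:R * #|stab colf|%:R)) ?mulr_gt0 ?ltr0n //.
rewrite sum_row_sgn_mult mulr1 -natrM ler_nat mulnC.
apply: (@leq_trans #|(stab colf * stab rowf)%g|); last first.
  by rewrite (mul_cardG (stab_group colf) (stab_group rowf)) leq_pmulr // cardG_gt0.
apply/subset_leq_card/subsetP => h; rewrite inE => /injectiveP inj.
have := inj_rows_cols pla lan inj (fun j => card_col j pla lan).
have <- : (\sum_(k < n) reshape_index la k = \sum_(k < n) reshape_index la (h k))%N.
  by rewrite [LHS](reindex_inj (@perm_inj _ h)).
rewrite sum_row => -[_]; rewrite eqxx => /esym/forallP fit.
have [u [ur uc]] := fill_perm inj fit.
apply/mulsgP; exists u (u^-1 * h)%g; last by rewrite mulKVg.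
  by apply/stabP=> k; rewrite uc.
by apply/stabP=> k; rewrite permM -{2}[k](permKV u) ur.
Qed.

(** A constituent has both multiplicities positive; the bound 1 forces them to be 1 and makes the
    product vanish at every other index, which is then no constituent by [chi_mult_bounds]. *)
Lemma irr_chi :
  exists i, [/\ chi n la = 'chi_i, row_mult rowf 'chi_i = 1 & sgn_mult colf 'chi_i = 1].
Proof.
have [i] := neq0_has_constt (chi_neq0 n la).
have [r [a [b [rE [ra rb] aE bE]]]] := chi_mult_bounds la i.
rewrite irr_consttE cfdotC rE conjC_nat pnatr_eq0 -lt0n => r0.
have nonneg j : 0 <= row_mult rowf 'chi[Sym 'I_n]_j * sgn_mult colf 'chi_j.
  have [x ->] := row_mult_nat rowf j; have [y ->] := sgn_mult_nat colf j.
  by rewrite -natrM ler0n.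
have := sum_mult_leq1; rewrite (bigD1 i) //=.
rewrite aE bE => le1.
have S0 : 0 <= \sum_(j | j != i) row_mult rowf 'chi[Sym 'I_n]_j * sgn_mult colf 'chi_j.
  by apply: sumr_ge0.
have ab : (a * b <= 1)%N.
  by rewrite -(ler_nat algC) natrM (le_trans _ le1) // lerDl.
have [a1 b1 r1] : [/\ a = 1, b = 1 & r = 1]%N by split; nia.
have Sj j : j != i -> row_mult rowf 'chi[Sym 'I_n]_j * sgn_mult colf 'chi_j = 0.
  move: le1; rewrite a1 b1 mulr1 gerDl => S_le0 ji.
  have/eqP : \sum_(j | j != i) row_mult rowf 'chi[Sym 'I_n]_j * sgn_mult colf 'chi_j = 0.
    by apply/eqP; rewrite eq_le S_le0.
  by rewrite psumr_eq0 // => /allP/(_ j); rewrite mem_index_enum ji => /(_ isT)/eqP.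
exists i; split; [|by rewrite aE a1|by rewrite bE b1].
rewrite [LHS]cfun_sum_cfdot (bigD1 i) //= cfdotC rE r1 conjC1 scale1r.
rewrite big1 ?addr0 // => j /Sj.
have [r' [a' [b' [r'E [ra' rb'] -> ->]]]] := chi_mult_bounds la j.
rewrite -natrM => /eqP; rewrite pnatr_eq0 muln_eq0 => ab0.
rewrite cfdotC r'E (_ : r' = 0%N) ?conjC0 ?scale0r //; lia.
Qed.

(** The criterion by which the sign twist of a Specht character is recognized. *)
Lemma irr_chi_uniq i :
  row_mult rowf 'chi_i != 0 -> sgn_mult colf 'chi_i != 0 -> chi n la = 'chi_i.
Proof.
have [i0 [-> r1 s1]] := irr_chi; have [-> //|ii0] := eqVneq i i0.
have nonneg j : 0 <= row_mult rowf 'chi[Sym 'I_n]_j * sgn_mult colf 'chi_j.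
  have [x ->] := row_mult_nat rowf j; have [y ->] := sgn_mult_nat colf j.
  by rewrite -natrM ler0n.
have := sum_mult_leq1; rewrite (bigD1 i0) //= r1 s1 mulr1 gerDl (bigD1 i) //=.
have S0 : 0 <= \sum_(j | (j != i0) && (j != i)) row_mult rowf 'chi[Sym 'I_n]_j * sgn_mult colf 'chi_j.
  by apply: sumr_ge0.
move=> le0; have : row_mult rowf 'chi_i * sgn_mult colf 'chi_i <= 0.
  by rewrite (le_trans _ le0) // lerDl.
move=> le0'; have /eqP : row_mult rowf 'chi_i * sgn_mult colf 'chi_i = 0.
  by apply/eqP; rewrite eq_le le0' nonneg.
by rewrite mulf_eq0 => /orP[] ->.
Qed.
End SpechtIrreducible.

Section SignTwist.
Variable n : nat.

Lemma sign_mx_repr : mx_repr (Sym 'I_n) (fun g : 'S_n => ((-1) ^+ odd_perm g)%:M : 'M[algC]_1).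
Proof.
split=> [|g h _ _]; first by rewrite odd_perm1.
by rewrite odd_permM signr_addb scalar_mxM.
Qed.
Definition sign_repr := MxRepresentation sign_mx_repr.

Definition sign_char : 'CF(Sym 'I_n) := cfRepr sign_repr.

Lemma sign_charE g : sign_char g = (-1) ^+ odd_perm g.
Proof. by rewrite cfunE in_Sym mulr1n /= mxtrace_scalar. Qed.

Lemma sign_lin : sign_char \is a linear_char.
Proof. by rewrite qualifE /= cfRepr_char cfRepr1 /=. Qed.

Lemma row_mult_sign (T : eqType) (f : 'I_n -> T) phi :
  row_mult f (sign_char * phi) = sgn_mult f phi.
Proof. by congr (_ * _); apply: eq_bigr => s _; rewrite cfunE sign_charE. Qed.

Lemma sgn_mult_sign (T : eqType) (f : 'I_n -> T) phi :
  sgn_mult f (sign_char * phi) = row_mult f phi.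
Proof.
by congr (_ * _); apply: eq_bigr => s _; rewrite cfunE sign_charE signrMK.
Qed.

(** The sign twist exchanges [row_mult] and [sgn_mult], and the rows of the conjugate have the
    lengths of the columns of la, so the corresponding stabilizers are conjugate. *)
Lemma chi_conj la : is_part la -> sumn la = n ->
  chi n (conj_part la) = sign_char * chi n la.
Proof.
move=> pla lan; have [i [-> r1 s1]] := irr_chi pla lan.
have [k kE] : exists k, 'chi_k = sign_char * 'chi[Sym 'I_n]_i.
  by have /irrP[k ->] := mul_lin_irr sign_lin (mem_irr i); exists k.
have pla' := is_part_conj pla; have lan' : sumn (conj_part la) = n by rewrite sumn_conj.
have [h hE] : exists h : 'S_n, (fun k : 'I_n => reshape_index (conj_part la) k)
    =1 (fun k : 'I_n => reshape_offset la k) \o h.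
  by apply: same_colours => c; rewrite card_row // card_col.
have [h' h'E] : exists h : 'S_n, (fun k : 'I_n => reshape_offset (conj_part la) k)
    =1 (fun k : 'I_n => reshape_index la k) \o h.
  by apply: same_colours => c; rewrite card_row // card_col // conj_partK.
rewrite -kE; apply: irr_chi_uniq => //; rewrite kE.
  rewrite row_mult_sign /sgn_mult (eq_stab hE) -/(sgn_mult _ _) sgn_mult_comp s1.
  by rewrite oner_eq0.
rewrite sgn_mult_sign /row_mult (eq_stab h'E) -/(row_mult _ _) row_mult_comp r1.
by rewrite oner_eq0.
Qed.
End SignTwist.

(** * Characters as coefficients of alternants *)

Section InvariantColourings.
Variables (n L : nat).

Definition cont (f : {ffun 'I_n -> 'I_L}) : 'X_{1..L} :=
  [multinom #|[pred k | f k == i]| | i < L].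

(** Expanding the product chooses a colour for each cycle of g, that is, a colouring constant on
    cycles. [j0] is the value given to sets that are not cycles. *)
Lemma prod_porbits (j0 : 'I_L) (R : comNzRingType) (X : 'I_L -> R) (g : 'S_n) :
  \prod_(O in porbits g) \sum_i X i ^+ #|O|
    = \sum_(f : {ffun 'I_n -> 'I_L} | g \in stab f) \prod_k X (f k).
Proof.
pose h (c : {ffun {set 'I_n} -> 'I_L}) := [ffun k => c (porbit g k)].
pose h' (f : {ffun 'I_n -> 'I_L}) := [ffun O : {set 'I_n} =>
  if O \in porbits g then if [pick k in O] is Some k then f k else j0 else j0].
rewrite (big_distr_big_dep j0) /= [RHS](reindex_onto h h') /=; last first.
  move=> f gf; apply/ffunP=> k; rewrite !ffunE imset_f //=.
  case: pickP => [l|/(_ k)]; last by rewrite porbit_id.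
  move/porbitP=> [i ->]; have /stabP : (g ^+ i)%g \in stab f by rewrite (@groupX _ (stab_group f)).
  by apply.
have porbit_in O k : O \in porbits g -> k \in O -> porbit g k = O.
  by case/imsetP=> l _ -> kl; apply/eqP; rewrite eq_porbit_mem.
apply: eq_big => [c|c _]; last first.
  rewrite (partition_big (porbit g) (mem (porbits g))) => [|k _]; last exact: imset_f.
  apply: eq_bigr => O gO; rewrite -prodr_const.
  apply: eq_big => [k|k kO] /=; last by rewrite ffunE (porbit_in O).
  apply/idP/eqP=> [kO|<-]; last exact: porbit_id.
  exact: porbit_in.
apply/pfamilyP/andP => [[cs _]|[_ /eqP <-]]; last first.
  split=> [|O _ //]; apply/supportP => O /negPf gO; by rewrite ffunE gO.
split.
  apply/stabP=> k; rewrite !ffunE; congr (c _); apply/eqP.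
  by rewrite eq_porbit_mem; have := mem_porbit g 1 k; rewrite expg1.
apply/eqP/ffunP=> O; rewrite ffunE; case: ifP => [gO|gO]; last first.
  by symmetry; apply: (supportP cs); rewrite gO.
case: pickP => [k kO|O0]; first by rewrite ffunE (porbit_in O).
by case/imsetP: gO O0 => l _ -> /(_ l); rewrite porbit_id.
Qed.

Lemma prod_mono_cont (R : comNzRingType) (f : {ffun 'I_n -> 'I_L}) :
  \prod_k 'X_(f k) = 'X_[cont f] :> {mpoly R[L]}.
Proof.
rewrite mpolyXE_id (partition_big f predT) //=; apply: eq_bigr => i _.
rewrite (eq_bigr (fun _ => 'X_i)) => [|k /eqP -> //].
by rewrite prodr_const mnmE.
Qed.

End InvariantColourings.

(** * The Cauchy determinant identity, by coefficients *)

Section AlternatingSums.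
Variable L : nat.
Implicit Types (b c a : {ffun 'I_L -> nat}).

Definition addf a i l : {ffun 'I_L -> nat} := [ffun x => a x + (if x == i then l else 0)]%N.
Definition subf a i l : {ffun 'I_L -> nat} := [ffun x => a x - (if x == i then l else 0)]%N.

(** The coefficient of x^b in x^a times the alternant with exponents 0, 1, ..., L - 1. *)
Definition wt b a : int := \sum_(s : 'S_L) (-1) ^+ odd_perm s *+ [forall i, a i + s i == b i]%N.
(** The antisymmetrized Kronecker delta: the coefficient of x^b y^c in det(1 / (1 - x_i y_j)). *)
Definition eps b c : int := \sum_(s : 'S_L) (-1) ^+ odd_perm s *+ [forall i, b i == c (s i)].

Lemma wt_add b a i l : wt b (addf a i l) = wt (subf b i l) a *+ (l <= b i)%N.
Proof.
rewrite /wt -sumrMnl; apply: eq_bigr => s _; rewrite -mulrnA mulnb; congr (_ *+ nat_of_bool _).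
apply/forallP/andP=> [h|[/forallP h lb] x].
  split; last by have /eqP := h i; rewrite ffunE eqxx; lia.
  by apply/forallP=> x; have /eqP := h x; rewrite !ffunE; case: (x =P i) => _; lia.
by have /eqP := h x; rewrite !ffunE; case: (x =P i) => [->|_]; lia.
Qed.

(** The term (s, i) on the left is the term (s, s i) on the right. *)
Lemma eps_adjoint b c l :
  \sum_i eps (subf b i l) c *+ (l <= b i)%N = \sum_i eps b (addf c i l).
Proof.
rewrite (eq_bigr (fun i => \sum_(s : 'S_L) (-1) ^+ odd_perm s *+
   ([forall x, subf b i l x == c (s x)] && (l <= b i)%N) : int)); last first.
  by move=> i _; rewrite /eps -sumrMnl; apply: eq_bigr => s _; rewrite -mulrnA mulnb.
rewrite exchange_big [RHS]exchange_big /=; apply: eq_bigr => s _.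
rewrite [RHS](reindex_inj (@perm_inj _ s)) /=; apply: eq_bigr => i _.
congr (_ *+ nat_of_bool _); apply/andP/forallP=> [[h lb] x|h].
  have /eqP := forallP h x; rewrite !ffunE (inj_eq perm_inj).
  by case: (x =P i) => [->|_]; lia.
have lb : (l <= b i)%N by have /eqP := h i; rewrite ffunE eqxx; lia.
split=> //; apply/forallP=> x; have /eqP := h x; rewrite !ffunE (inj_eq perm_inj).
by case: (x =P i) => [->|_]; lia.
Qed.

Lemma eps_perm b c (t : 'S_L) : eps b [ffun i => c (t i)] = (-1) ^+ odd_perm t * eps b c.
Proof.
rewrite /eps mulr_sumr [RHS](reindex_inj (mulIg t)) /=; apply: eq_bigr => s _.
rewrite mulrnAr odd_permM signr_addb mulrCA -signr_addb addbb mulr1.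
by congr (_ *+ nat_of_bool _); apply: eq_forallb => i; rewrite ffunE permM.
Qed.

Lemma eps_repeat b c i j : i != j -> c i = c j -> eps b c = 0.
Proof.
move=> ij cij; have := eps_perm b c (tperm i j).
rewrite odd_tperm ij expr1 mulN1r (_ : finfun _ = c); first by lia.
by apply/ffunP=> k; rewrite ffunE; case: tpermP => // ->.
Qed.

Lemma wt_repeat b i j : i != j -> b i = b j -> wt b [ffun _ => 0%N] = 0.
Proof.
move=> ij bij; rewrite /wt big1 // => s _.
case: forallP => // h; case/eqP: ij; apply: (@perm_inj _ s); apply: val_inj.
by have := h i; have := h j; rewrite !ffunE bij /= => /eqP <- /eqP.
Qed.

Lemma low_sum_repeat c : (\sum_i c i < 'C(L, 2))%N -> exists i j, i != j /\ c i = c j.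
Proof.
move=> lt; have : ~~ injectiveb c.
  apply/injectiveP => injc; have := @sum_inj_min _ [set: 'I_L] c (in2W injc).
  rewrite cardsT card_ord => -[]; rewrite leqNgt (leq_ltn_trans _ lt) //.
  by apply: eq_leq; apply: eq_bigl => x; rewrite inE.
by case/injectivePn=> i [j ij cij]; exists i, j.
Qed.

(* Moving l from c j to c i, for l >= 1: over an unordered pair {i, j} all the
   redistributions of c i + c j cancel in pairs, so the nontrivial ones add up
   to minus the trivial one. *)
Lemma eps_transfer b c i j K : i != j -> (forall x, c x <= K)%N ->
  \sum_(1 <= l < K.+1) eps b (addf (subf c j l) i l) *+ (l <= c j)%N
  + \sum_(1 <= l < K.+1) eps b (addf (subf c i l) j l) *+ (l <= c i)%N = - eps b c.
Proof.
move=> ij cK; set S := (c i + c j)%N.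
pose G x : int := eps b [ffun k => if k == i then x else if k == j then (S - x)%N else c k].
have sum0 : \sum_(0 <= x < S.+1) G x = 0.
  have : \sum_(0 <= x < S.+1) G x = - \sum_(0 <= x < S.+1) G x; last by lia.
  rewrite {1}big_nat_rev /= -sumrN; apply: eq_big_nat => x /andP[_ xS].
  have := eps_perm b [ffun k => if k == i then x else if k == j then (S - x)%N else c k] (tperm i j).
  rewrite odd_tperm ij expr1 mulN1r => <-; congr eps; apply/ffunP=> k; rewrite !ffunE.
  case: tpermP => [->|->|/eqP/negPf-> /eqP/negPf->] //.
    by rewrite [j == i]eq_sym (negPf ij) !eqxx; lia.
  by rewrite [j == i]eq_sym (negPf ij) !eqxx; lia.
have Gc : G (c i) = eps b c.
  by congr eps; apply/ffunP=> k; rewrite ffunE; case: eqP => [->|_] //; case: eqP => [->|//]; rewrite /S addKn.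
have iS : (c i < S.+1)%N by rewrite ltnS leq_addr.
have cut m (F : nat -> int) : (m <= K)%N ->
    \sum_(1 <= l < K.+1) F l *+ (l <= m)%N = \sum_(1 <= l < m.+1) F l.
  move=> mK; rewrite (@big_cat_nat _ _ _ m.+1) //= [X in _ + X]big_nat [X in _ + X]big1 ?addr0.
    by apply: eq_big_nat => l /andP[_]; rewrite ltnS => ->.
  by move=> l /andP[ml _]; rewrite leqNgt ml.
rewrite !cut //; move: sum0; rewrite (@big_cat_nat _ _ _ (c i)) ?(ltnW iS) //=.
rewrite [X in _ + X]big_ltn // Gc.
have -> : \sum_(0 <= x < c i) G x = \sum_(1 <= l < (c i).+1) eps b (addf (subf c i l) j l).
  rewrite big_nat_rev /= add0n big_add1 /=; apply: eq_big_nat => l /andP[_ lc].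
  congr eps; apply/ffunP=> k; rewrite !ffunE.
  case: (k =P i) => [->|_]; first by rewrite (negPf ij) addn0.
  by case: (k =P j) => [->|_]; rewrite ?subn0 ?addn0 // /S; lia.
have -> : \sum_((c i).+1 <= x < S.+1) G x = \sum_(1 <= l < (c j).+1) eps b (addf (subf c j l) i l).
  rewrite -[(c i).+1]addn1 addnC big_addn; have -> : (S.+1 - c i = (c j).+1)%N by rewrite /S; lia.
  apply: eq_big_nat => l /andP[_ lc].
  congr eps; apply/ffunP=> k; rewrite !ffunE.
  case: (k =P i) => [->|_]; first by rewrite (negPf ij) subn0 addnC.
  by case: (k =P j) => [->|_]; rewrite ?subn0 ?addn0 // /S; lia.
set X := \sum_(1 <= l < (c i).+1) _; set Y := \sum_(1 <= l < (c j).+1) _; lia.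
Qed.

(** By [eps_adjoint] each term moves l from c j to c i. For i = j nothing changes, and there are c j
    values of l; each unordered pair i != j contributes -1 by [eps_transfer], hence the binomial
    coefficient. *)
Lemma eps_energy b c K : (forall x, c x <= K)%N ->
  \sum_(1 <= l < K.+1) \sum_j \sum_i
     eps (subf b i l) (subf c j l) *+ (l <= b i)%N *+ (l <= c j)%N
  = eps b c * ((\sum_x c x)%N%:Z - 'C(L, 2)%:Z).
Proof.
move=> cK.
pose E i j : int := \sum_(1 <= l < K.+1) eps b (addf (subf c j l) i l) *+ (l <= c j)%N.
have -> : \sum_(1 <= l < K.+1) \sum_j \sum_i
     eps (subf b i l) (subf c j l) *+ (l <= b i)%N *+ (l <= c j)%N = \sum_j \sum_i E i j.
  rewrite exchange_big /=; apply: eq_bigr => j _; rewrite [RHS]exchange_big /=.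
  by apply: eq_bigr => l _; rewrite !sumrMnl eps_adjoint.
have Ediag j : E j j = eps b c *+ c j.
  rewrite /E (@big_cat_nat _ _ _ (c j).+1) ?ltnS //= [X in _ + X]big_nat [X in _ + X]big1 ?addr0; last first.
    by move=> l /andP[ml _]; rewrite leqNgt ml.
  rewrite (eq_big_nat _ _ (F2 := fun _ => eps b c)) => [|l /andP[_ lc]].
    by rewrite sumr_const_nat subn1.
  move: lc; rewrite ltnS => lc; rewrite lc; congr eps; apply/ffunP=> x; rewrite !ffunE.
  by case: (x =P j) => [->|_]; rewrite ?subnK ?subn0 ?addn0.
have Eoff i j : i != j -> E i j + E j i = - eps b c.
  by move=> ij; apply: eps_transfer.
have split_diag : \sum_j \sum_i E i j = \sum_j E j j + \sum_j \sum_(i | i != j) E i j.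
  by rewrite -big_split; apply: eq_bigr => j _; rewrite (bigD1 j).
rewrite split_diag (eq_bigr _ (fun j _ => Ediag j)) sumrMnr.
have off2 : \sum_j \sum_(i | i != j) E i j + \sum_j \sum_(i | i != j) E i j
    = - (eps b c *+ (L * L.-1)).
  have {2}-> : \sum_j \sum_(i | i != j) E i j = \sum_j \sum_(i | i != j) E j i.
    rewrite (exchange_big_dep predT) //=; apply: eq_bigr => i _.
    by apply: eq_bigl => j; rewrite eq_sym.
  rewrite -big_split /= (eq_bigr (fun j => - eps b c *+ L.-1)) => [|j _].
    by rewrite sumr_const card_ord -mulrnA mulNrn mulnC.
  rewrite -big_split /= (eq_bigr (fun _ => - eps b c)) => [|i ij]; last exact: Eoff.
  by rewrite sumr_const cardC1 card_ord.
have := bin2 L; have := odd_double_half (L * L.-1).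
have -> : odd (L * L.-1) = false by case: (L) => //= m; rewrite oddM /= andNb.
rewrite add0n => h2 hb; move: off2; rewrite -h2 -hb -muln2 mulrnA mulr2n opprD.
set Y := (\sum_j \sum_(i | i != j) E i j); set e := eps b c; set S := (\sum_i c i)%N.
move=> YY; have -> : Y = - (e *+ 'C(L, 2)) by lia.
have mulrnZ m : e *+ m = e * m%:Z by rewrite -mulr_natr natz.
by rewrite mulrBr -!mulrnZ.
Qed.

Lemma sum_subf c j l : (l <= c j)%N -> (\sum_x subf c j l x = \sum_x c x - l)%N.
Proof.
move=> lc; rewrite (bigD1 j) //= [in RHS](bigD1 j) //= ffunE eqxx addnBAC //.
by congr (_ + _ - _)%N; apply: eq_bigr => x /negPf xj; rewrite ffunE xj subn0.
Qed.

Section Matrices.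
Variable K : nat.
Implicit Types A : {ffun 'I_L * 'I_L -> 'I_K.+1}.

Definition tot A : nat := (\sum_p A p)%N.
Definition rows A : {ffun 'I_L -> nat} := [ffun i => \sum_j A (i, j)]%N.
Definition cols A : {ffun 'I_L -> nat} := [ffun j => \sum_i A (i, j)]%N.

(** The coefficient of x^b y^c in a(x) a(y) / prod (1 - x_i y_j), in degree m of the quotient's
    expansion, with a the Vandermonde alternant. The matrices are the exponents in the geometric
    series; the bound K makes them a finite type. *)
Definition pairing m b c : int := \sum_(A | tot A == m) wt b (rows A) * wt c (cols A).

(** Subtracting l at (i, j) is a bijection onto the matrices of total m - l, and lowers one row sum
    and one column sum. *)
Lemma pairing_shift m b c (i j : 'I_L) l : (m <= K)%N -> (0 < l)%N ->
  \sum_(A | (tot A == m) && (l <= A (i, j))%N) wt b (rows A) * wt c (cols A)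
  = pairing (m - l)%N (subf b i l) (subf c j l) *+ (l <= b i)%N *+ (l <= c j)%N *+ (l <= m)%N.
Proof.
move=> mK l0.
have A_le A p : (A p <= tot A)%N by rewrite /tot (bigD1 p) //= leq_addr.
have [lm|ml] := leqP l m; last first.
  rewrite mulr0n big_pred0 // => A; apply/negP=> /andP[/eqP Am lA].
  by move: ml; rewrite ltnNge (leq_trans lA) // -Am A_le.
rewrite mulr1n.
pose h A : {ffun 'I_L * 'I_L -> 'I_K.+1} :=
  [ffun p => if p == (i, j) then inord (A p + l) else A p].
pose h' A : {ffun 'I_L * 'I_L -> 'I_K.+1} :=
  [ffun p => if p == (i, j) then inord (A p - l) else A p].
have hE A p : (A (i, j) + l <= K)%N -> h A p = (A p + if p == (i, j) then l else 0)%N :> nat.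
  by move=> AK; rewrite ffunE; case: eqP => [->|_]; rewrite ?addn0 // inordK.
have toth A : (A (i, j) + l <= K)%N -> (tot (h A) = tot A + l)%N.
  move=> AK; rewrite /tot (eq_bigr _ (fun p _ => hE A p AK)) big_split /=.
  by rewrite -big_mkcond big_pred1_eq.
have hK A : (A (i, j) + l <= K)%N -> h' (h A) = A.
  move=> AK; apply/ffunP=> p; rewrite [LHS]ffunE; case: eqP => [->|/eqP/negPf pij].
    by rewrite hE // eqxx addnK inord_val.
  by rewrite ffunE pij.
(* An overflowing entry is sent to 0 by [inord]; subtraction cannot recover it, because l <= m <=
   K. *)
have h'K A : h' (h A) = A -> (A (i, j) + l <= K)%N.
  move/ffunP/(_ (i, j)); rewrite !ffunE eqxx => /(congr1 val) /=.
  rewrite leqNgt => e; apply/negP=> Kl; move: e.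
  have -> : (inord (A (i, j) + l) : 'I_K.+1) = 0%N :> nat.
    by rewrite /inord val_insubd ltnS leqNgt Kl.
  by rewrite sub0n inordK //; lia.
rewrite /pairing -!sumrMnl (reindex_onto h h') /=; last first.
  move=> A /andP[_ lA]; apply/ffunP=> p; rewrite /h /h' !ffunE.
  case: (p =P (i, j)) => [->|//]; rewrite ?eqxx.
  have AK : (A (i, j) - l < K.+1)%N by rewrite (leq_ltn_trans (leq_subr _ _)).
  by rewrite (inordK AK) subnK // inord_val.
apply: eq_big => [A|A].
  have [AK|KA] := leqP (A (i, j) + l)%N K.
    by rewrite toth // hE // eqxx leq_addl hK // eqxx !andbT; apply/eqP/eqP; lia.
  transitivity false; last by have := A_le A (i, j); case: eqP => //; lia.
  by apply/negP=> /andP[_ /eqP/h'K]; rewrite leqNgt KA.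
case/andP=> _ /eqP/h'K AK.
have hrow : rows (h A) = addf (rows A) i l.
  apply/ffunP=> x; rewrite !ffunE (eq_bigr _ (fun y _ => hE A (x, y) AK)) big_split /=.
  congr (_ + _)%N; case: (x =P i) => [->|xi].
    under eq_bigr do rewrite xpair_eqE eqxx /=.
    by rewrite -big_mkcond big_pred1_eq.
  by rewrite big1 // => y _; rewrite xpair_eqE; case: eqP.
have hcol : cols (h A) = addf (cols A) j l.
  apply/ffunP=> x; rewrite !ffunE (eq_bigr _ (fun y _ => hE A (y, x) AK)) big_split /=.
  congr (_ + _)%N; case: (x =P j) => [->|xj].
    under eq_bigr do rewrite xpair_eqE eqxx andbT /=.
    by rewrite -big_mkcond big_pred1_eq.
  by rewrite big1 // => y _; rewrite xpair_eqE andbC; case: eqP.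
by rewrite hrow hcol !wt_add mulrnAr mulrnAl.
Qed.

(** At this degree c either has a repetition, and both sides vanish, or arranges 0, ..., L - 1, and
    [wt c] at 0 is the sign of that arrangement. *)
Lemma pairing0 b c : (\sum_x c x = 'C(L, 2))%N -> pairing 0 b c = eps b c.
Proof.
move=> cL; pose A0 : {ffun 'I_L * 'I_L -> 'I_K.+1} := [ffun _ => ord0].
pose z : {ffun 'I_L -> nat} := [ffun _ => 0%N].
have -> : pairing 0 b c = wt b z * wt c z.
  rewrite /pairing (big_pred1 A0) => [|A].
    congr (wt _ _ * wt _ _); apply/ffunP=> x; rewrite !ffunE big1 // => y _; rewrite ffunE //.
  rewrite sum_nat_eq0; apply/forallP/eqP=> [A00|-> p]; last by rewrite ffunE.
  by apply/ffunP=> p; apply/val_inj; rewrite ffunE; apply/eqP; exact: (A00 p).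
have [/injectiveP injc|/injectivePn[i [j ij cij]]] := boolP (injectiveb c); last first.
  by rewrite (eps_repeat _ ij cij) (wt_repeat ij cij) mulr0.
have c_lt x : (c x < L)%N.
  have [_] := @sum_inj_min _ [set: 'I_L] c (in2W injc).
  rewrite cardsT card_ord (eq_bigl predT) => [|y]; last by rewrite inE.
  by rewrite cL eqxx => /esym/forall_inP; apply.
have tinj : injective (fun x => Ordinal (c_lt x)) by move=> x y [] /injc.
pose t := perm tinj; have tE x : c x = t x by rewrite permE.
have -> : wt c z = (-1) ^+ odd_perm t.
  rewrite /wt (bigD1 t) //= (_ : [forall i, _]); last first.
    by apply/forallP=> x; rewrite ffunE add0n tE.
  rewrite mulr1n big1 ?addr0 // => s /negP st; case: forallP => // h; case: st.
  by apply/eqP/permP=> x; apply/val_inj; have /eqP := h x; rewrite ffunE add0n tE.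
rewrite /wt /eps mulr_suml (reindex_inj (mulIg t)) /=; apply: eq_bigr => s _.
rewrite mulrnAl odd_permM signr_addb -mulrA -signr_addb addbb mulr1.
congr (_ *+ nat_of_bool _); apply: eq_forallb => x.
by rewrite ffunE add0n permM -tE eq_sym.
Qed.

(** Multiplying by m counts the pairs (entry, l) with 1 <= l <= entry. [pairing_shift] removes l
    from the entry, and induction turns the sum into the left-hand side of [eps_energy]. *)
Lemma pairingE m b c : (\sum_x c x <= K)%N -> (\sum_x c x = m + 'C(L, 2))%N ->
  pairing m b c = eps b c.
Proof.
elim: m {-2}m (leqnn m) b c => [|k IH] m mk b c cK cm.
  by move: mk cm; rewrite leqn0 => /eqP ->; apply: pairing0.
have [m0|m0] := posnP m; first by apply: IH => //; rewrite m0.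
have mz : (m%:Z != 0) by lia.
apply: (mulfI mz).
have ck x : (c x <= K)%N by rewrite (leq_trans _ cK) // (bigD1 x) //= leq_addr.
have <- : eps b c * ((\sum_x c x)%N%:Z - 'C(L, 2)%:Z) = m%:Z * eps b c.
  rewrite cm PoszD addrK mulrC //.
rewrite -(eps_energy _ ck).
transitivity (\sum_(1 <= l < K.+1) \sum_j \sum_i
   \sum_(A | (tot A == m) && (l <= A (i, j))%N) wt b (rows A) * wt c (cols A)).
  rewrite /pairing mulr_sumr.
  have AE A i j : A (i, j) = (\sum_(1 <= l < K.+1) (l <= A (i, j))%N)%N :> nat.
    rewrite (@big_cat_nat _ _ _ (A (i, j)).+1) //=.
    rewrite [X in (_ + X)%N]big_nat [X in (_ + X)%N]big1 ?addn0 => [|l /andP[ml _]]; last by rewrite leqNgt ml.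
    rewrite (eq_big_nat _ _ (F2 := fun _ => 1%N)) => [|l /andP[_ lc]].
      by rewrite sum_nat_const_nat subn1 muln1.
    by rewrite -ltnS lc.
  transitivity (\sum_(A | tot A == m) \sum_(1 <= l < K.+1) \sum_j \sum_i
      (if (l <= A (i, j))%N then wt b (rows A) * wt c (cols A) else 0)).
    apply: eq_bigr => A /eqP <-; set W := wt b _ * _.
    transitivity (\sum_j \sum_i W *+ A (i, j)).
      rewrite exchange_big pair_big /= sumrMnr mulrC -(natz (tot A)) mulr_natr; congr (_ *+ _).
      by apply: eq_bigr => -[].
    rewrite [RHS]exchange_big /=; apply: eq_bigr => j _.
    rewrite [RHS]exchange_big /=; apply: eq_bigr => i _.
    by rewrite {1}AE -sumrMnr; apply: eq_bigr => l _; case: leqP.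
  rewrite exchange_big /=; apply: eq_bigr => l _; rewrite exchange_big /=; apply: eq_bigr => j _.
  by rewrite exchange_big /=; apply: eq_bigr => i _; rewrite [RHS]big_mkcondr.
apply: eq_big_nat => l /andP[l0 lK]; apply: eq_bigr => j _; apply: eq_bigr => i _.
rewrite pairing_shift //; last by lia.
have [lci|//] := boolP (l <= c j)%N; rewrite ?mulr0n ?mul0rn // mulr1n.
have [lm|ml] := leqP l m; rewrite ?mulr1n ?mulr0n.
  have sub : (\sum_x subf c j l x = \sum_x c x - l)%N by apply: sum_subf.
  by congr (_ *+ _); apply: IH; rewrite ?sub; lia.
(* For l > m the remaining sum is below 'C(L, 2), which forces a repeated exponent. *)
have [x [y [xy cxy]]] : exists x y, x != y /\ subf c j l x = subf c j l y.
  have lc : (l <= \sum_x c x)%N by rewrite (leq_trans lci) // (bigD1 j) //= leq_addr.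
  by apply: low_sum_repeat; rewrite sum_subf //; rewrite cm in lc *; lia.
by rewrite (eps_repeat _ xy cxy) mul0rn.
Qed.
End Matrices.
End AlternatingSums.

Section ColourCounts.
Variables (n : nat) (I : finType).
Implicit Types f : {ffun 'I_n -> I}.

Definition colours f : {ffun I -> nat} := [ffun i => #|[pred k | f k == i]|].

Lemma sum_colours f : (\sum_i colours f i = n)%N.
Proof.
rewrite -[RHS]card_ord -sum1_card (partition_big f predT) //=.
by apply: eq_bigr => i _; rewrite ffunE -sum1_card.
Qed.

Lemma colours_exist (A : {ffun I -> nat}) : (\sum_i A i = n)%N -> exists f, colours f = A.
Proof.
move=> An; pose s := flatten [seq nseq (A i) i | i <- enum I].
have sn : size s == n.
  rewrite size_flatten /shape -map_comp sumnE big_map big_enum -An.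
  by apply/eqP; apply: eq_bigr => i _; rewrite /= size_nseq.
exists [ffun k => tnth (Tuple sn) k]; apply/ffunP=> i; rewrite ffunE.
transitivity (count_mem i s).
  rewrite -[RHS]/(count_mem i (Tuple sn)) -[in RHS](map_tnth_enum (Tuple sn)).
  rewrite count_map -sum1_count big_enum_cond sum1_card.
  by apply: eq_card => k; rewrite !inE ffunE.
rewrite /s count_flatten -map_comp sumnE big_map big_enum (bigD1 i) //=.
rewrite count_nseq /= eqxx mul1n big1 ?addn0 // => j /negPf ji.
by rewrite count_nseq /= ji mul0n.
Qed.

(* The permutations carrying one filling of given content to another form a
   coset of its stabilizer. *)
Lemma sum_card_stab (A : {ffun I -> nat}) : (\sum_i A i = n)%N ->
  (\sum_(f | colours f == A) #|stab f| = n`!)%N.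
Proof.
move=> An; have [f0 f0A] := colours_exist An.
have hf f : colours f == A -> exists h : 'S_n, f =1 f0 \o h.
  move/eqP=> fA; apply: same_colours => c.
  by have := congr1 (fun B : {ffun I -> nat} => B c) f0A; rewrite -fA !ffunE => ->.
transitivity (\sum_(f | colours f == A) #|[set h : 'S_n | [forall k, f k == f0 (h k)]]|)%N.
  apply: eq_bigr => f /hf[h fh]; rewrite -[LHS](card_rcoset _ h).
  apply: eq_card => u; rewrite inE mem_rcoset.
  apply/stabP/forallP=> fu k; first by rewrite -fu permM fh /= permKV.
  by rewrite permM fh /= permKV; apply/esym/eqP.
under eq_bigr do rewrite -sum1dep_card.
rewrite (exchange_big_dep predT) //= -card_Sn -sum1_card.
apply: eq_big => [h|h _]; first by rewrite inE.
rewrite (big_pred1 [ffun k => f0 (h k)]) // => f /=.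
apply/andP/eqP=> [[_ /forallP fh]|->].
  by apply/ffunP=> k; rewrite ffunE; apply/eqP.
split; last by apply/forallP=> k; rewrite ffunE.
apply/eqP; rewrite -f0A; apply/ffunP=> i; rewrite !ffunE -!sum1_card.
rewrite [RHS](reindex_inj (@perm_inj _ h)) /=.
by apply: eq_bigl => k; rewrite !inE ffunE.
Qed.

End ColourCounts.

(** * Frobenius' formula *)

Section SchurCharacters.
Variables (n L : nat).

(** The right-hand side of Frobenius' formula: the coefficient of x^b in the alternant times the
    power sums of the cycle lengths of g, expanded over g-invariant colourings. *)
Definition psi (b : {ffun 'I_L -> nat}) (g : 'S_n) : int :=
  \sum_(f : {ffun 'I_n -> 'I_L} | g \in stab f) wt b (colours f).

(** Two invariant colourings are one invariant colouring F by pairs, and summing over g gives F the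
    weight #|stab F|. The F with a given matrix of contents weigh n! together, so n! times [pairing]
    remains. *)
Lemma sum_psi (b c : {ffun 'I_L -> nat}) : (\sum_i c i = n + 'C(L, 2))%N ->
  \sum_(g : 'S_n) psi b g * psi c g = eps b c *+ n`!.
Proof.
move=> cn; pose K := (\sum_i c i)%N.
rewrite -(pairingE (K := K) b (leqnn _) cn).
have nK : (n <= K)%N by rewrite /K cn leq_addr.
pose W (F : {ffun 'I_n -> 'I_L * 'I_L}) : int :=
  wt b (colours [ffun k => (F k).1]) * wt c (colours [ffun k => (F k).2]).
transitivity (\sum_(F : {ffun 'I_n -> 'I_L * 'I_L}) W F *+ #|stab F|).
  transitivity (\sum_(g : 'S_n) \sum_(F : {ffun 'I_n -> 'I_L * 'I_L} | g \in stab F) W F).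
    apply: eq_bigr => g _; rewrite /psi big_distrlr pair_big_dep /=.
    pose h (F : {ffun 'I_n -> 'I_L * 'I_L}) := ([ffun k => (F k).1], [ffun k => (F k).2]).
    pose h' (p : {ffun 'I_n -> 'I_L} * {ffun 'I_n -> 'I_L}) := [ffun k => (p.1 k, p.2 k)].
    rewrite (reindex_onto h h') /=; last first.
      by move=> [f f'] _; congr (_, _); apply/ffunP=> k; rewrite !ffunE.
    apply: eq_bigl => F; rewrite [h' _](_ : _ = F) ?eqxx ?andbT; last first.
      by apply/ffunP=> k; rewrite !ffunE; case: (F k).
    apply/andP/stabP=> [[/stabP s1 /stabP s2] k|sF].
      by have := s1 k; have := s2 k; rewrite !ffunE; case: (F _) (F k) => [? ?] [? ?] /= -> ->.
    by split; apply/stabP=> k; rewrite !ffunE sF.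
  rewrite (exchange_big_dep predT) //=; apply: eq_bigr => F _.
  by rewrite -sumr_const.
pose c2 (F : {ffun 'I_n -> 'I_L * 'I_L}) : {ffun 'I_L * 'I_L -> 'I_K.+1} :=
  [ffun p => inord (colours F p)].
have c2E F p : c2 F p = colours F p :> nat.
  rewrite ffunE inordK // ltnS (leq_trans _ nK) // -[X in (_ <= X)%N](sum_colours F).
  by rewrite (bigD1 p) //= leq_addr.
rewrite (partition_big c2 (fun A => tot A == n)) => [|F _]; last first.
  by rewrite /tot (eq_bigr _ (fun p _ => c2E F p)) sum_colours.
rewrite /pairing -sumrMnl; apply: eq_bigr => A /eqP An.
have <- := @sum_card_stab n _ [ffun p => A p : nat] _; last first.
  by rewrite -An; apply: eq_bigr => p _; rewrite ffunE.
rewrite -sumrMnr; apply: eq_big => [F|F /eqP FA].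
  apply/eqP/eqP=> [<-|AF]; first by apply/ffunP=> p; rewrite [RHS]ffunE c2E.
  by apply/ffunP=> p; apply/val_inj; rewrite /= c2E AF ffunE.
congr (_ *+ _); rewrite -{}FA /W.
congr (_ * _); congr wt; apply/ffunP=> x; rewrite !ffunE.
  under [RHS]eq_bigr do rewrite c2E ffunE -sum1_card.
  rewrite -sum1_card (partition_big (fun k => (F k).2) predT) //=.
  apply: eq_bigr => y _; apply: eq_bigl => k; rewrite !inE ffunE.
  by case: (F k) => u v; rewrite xpair_eqE.
under [RHS]eq_bigr do rewrite c2E ffunE -sum1_card.
rewrite -sum1_card (partition_big (fun k => (F k).1) predT) //=.
apply: eq_bigr => y _; apply: eq_bigl => k; rewrite !inE ffunE.
by case: (F k) => u v; rewrite xpair_eqE andbC.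
Qed.

(** Rows are reversed so that the sequence increases and the added staircase is the exponent vector
    0, 1, ..., L - 1 of the alternant. *)
Definition beta (la : seq nat) : {ffun 'I_L -> nat} := [ffun i => nth 0 la (rev_ord i) + i]%N.

Lemma sum_beta la : (size la <= L)%N -> (\sum_i beta la i = sumn la + 'C(L, 2))%N.
Proof.
move=> laL; rewrite (eq_bigr _ (fun i _ => ffunE _ i)) big_split /= (sumn_nth laL) big_mkord.
rewrite -bin2_sum big_mkord; congr (_ + _)%N.
by rewrite [RHS](reindex_inj rev_ord_inj).
Qed.

Lemma beta_inj la (i j : 'I_L) : is_part la -> (i < j)%N -> (beta la i < beta la j)%N.
Proof.
case/andP=> s _ ij; rewrite !ffunE /= -addnS leq_add //.
by apply: nth_sorted_geq => //=; lia.
Qed.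

Hypothesis nL : (n <= L)%N.
Variable la : seq nat.
Hypotheses (pla : is_part la) (lan : sumn la = n).

Let a0 : {ffun 'I_L -> nat} := [ffun i : 'I_L => nth 0 la (rev_ord i)].

Lemma wt_beta_a0 : wt (beta la) a0 = 1.
Proof.
rewrite /wt (bigD1 1%g) //= (_ : [forall i, _]); last first.
  by apply/forallP=> i; rewrite !ffunE perm1.
rewrite odd_perm1 big1 ?addr0 // => s /negP s1; case: forallP => // h; case: s1.
by apply/eqP/permP=> i; rewrite perm1; apply/val_inj; have := h i; rewrite !ffunE eqn_add2l => /eqP.
Qed.

(** Two opposite bounds on the row weight of f. [inj_rows_cols] bounds it below by n(la). Since the
    content is [beta la] minus a permutation s of 0, ..., L - 1, the rearrangement inequality bounds
    it above by n(la), with equality only for s = 1. *)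
Lemma colours_fit (f : {ffun 'I_n -> 'I_L}) (h : 'S_n) :
    wt (beta la) (colours f) != 0 ->
    injective (fun k => (f (h k), reshape_offset la k)) -> colours f = a0.
Proof.
move=> wt0 inj.
have [s sE] : exists s : 'S_L, forall i, (colours f i + s i = beta la i)%N.
  have [s /forallP sE|no] := pickP (fun s : 'S_L => [forall i, colours f i + s i == beta la i]%N).
    by exists s => i; apply/eqP.
  by case/eqP: wt0; rewrite /wt big1 // => s _; rewrite no.
have inj' : injective (fun k => (rev_ord (f (h k)) : nat, reshape_offset la k)).
  move=> k l kl; apply: inj; have cE := congr1 snd kl.
  have rE := congr1 fst kl; rewrite /= in cE rE.
  have fE : f (h k) = f (h l).
    by apply/val_inj; have := ltn_ord (f (h k)); have := ltn_ord (f (h l)); move: rE => /=; lia.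
  by rewrite fE cE.
have [le _] := inj_rows_cols pla lan inj' (fun j => card_col j pla lan).
pose r (i : 'I_L) : nat := rev_ord i.
have rD i : (r i + i = L.-1)%N by rewrite /r /=; have := ltn_ord i; lia.
have sumR : (\sum_k rev_ord (f (h k)) = \sum_i r i * colours f i)%N.
  transitivity (\sum_k rev_ord (f k))%N; first by rewrite [RHS](reindex_inj (@perm_inj _ h)).
  rewrite (partition_big f predT) //=; apply: eq_bigr => i _.
  by rewrite ffunE mulnC -sum_nat_const; apply: eq_big => [k|k /eqP -> //]; rewrite inE.
have sumL : (\sum_(0 <= i < n) i * nth 0 la i = \sum_i r i * nth 0 la (r i))%N.
  transitivity (\sum_(i < L) i * nth 0 la i)%N; last by rewrite [LHS](reindex_inj rev_ord_inj).
  rewrite -(big_mkord xpredT (fun i => i * nth 0 la i)%N) [RHS](big_cat_nat (leq0n _) nL) /=.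
  rewrite [X in (_ + X)%N]big_nat [X in (_ + X)%N]big1 ?addn0 // => i /andP[ni _].
  by rewrite nth_default ?muln0 // (leq_trans _ ni) // -lan size_part_leq.
have e1 : (\sum_i r i * colours f i + \sum_i r i * s i
     = \sum_i r i * nth 0 la (r i) + \sum_(i < L) r i * i)%N.
  rewrite -!big_split; apply: eq_bigr => i _ /=.
  by rewrite -!mulnDr sE ffunE.
have rest (F : 'I_L -> nat) : (\sum_i r i * F i + \sum_(i < L) i * F i = L.-1 * \sum_i F i)%N.
  by rewrite -big_split big_distrr /=; apply: eq_bigr => i _; rewrite -mulnDl rD.
have e2 := rest (fun i => s i); have e3 := rest (fun i => i).
have e4 : (\sum_i s i = \sum_(i < L) i)%N by rewrite [RHS](reindex_inj (@perm_inj _ s)).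
have e5 : (\sum_i s i * s i = \sum_(i < L) i * i)%N by rewrite [RHS](reindex_inj (@perm_inj _ s)).
have cs : (\sum_(i < L) 2 * (i * s i) <= \sum_(i < L) (i ^ 2 + s i ^ 2)
    ?= iff [forall i : 'I_L, i == s i :> nat])%N.
  by apply: leqif_sum => i _; apply: nat_Cauchy.
rewrite -big_distrr /= big_split /= in cs; have [le2] := cs.
have -> : (2 * \sum_(i < L) i * s i == \sum_(i < L) i ^ 2 + \sum_(i < L) s i ^ 2)%N.
  rewrite eqn_leq le2 /=.
  have sq (F : 'I_L -> nat) : (\sum_i F i ^ 2 = \sum_i F i * F i)%N by apply: eq_bigr => i _; rewrite expnS expn1.
  rewrite !sq e5; rewrite sumR sumL in le; rewrite e4 in e2.
  set X := (\sum_i r i * colours f i)%N in le e1.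
  set Y := (\sum_i r i * s i)%N in e1 e2.
  set Z := (\sum_i r i * nth 0 la (r i))%N in le e1.
  set U := (\sum_(i < L) r i * i)%N in e1 e3.
  set V := (\sum_(i < L) i * s i)%N in e2 *.
  set Q := (\sum_(i < L) i * i)%N in e3 *.
  set P := (L.-1 * _)%N in e2 e3. lia.
move=> /esym/forallP s_id.
have s1 : s = 1%g.
  by apply/permP=> i; apply/val_inj; rewrite perm1; have /eqP := s_id i.
by apply/ffunP=> i; have := sE i; rewrite s1 perm1 !ffunE => /addIn.
Qed.

(** The sum of |psi - chi|^2 over the group expands to n! - n! - n! + n! = 0. *)
Theorem chi_psi g : chi n la g = (psi (beta la) g)%:~R.
Proof.
have [i [chiE r1 s1]] := irr_chi pla lan.
have row1 (f : {ffun 'I_n -> 'I_L}) : colours f = a0 -> row_mult f 'chi_i = 1.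
  move=> fa0; pose rf (k : 'I_n) : nat := rev_ord (f k).
  have [h rfE] : exists h : 'S_n, rf =1 (fun k : 'I_n => reshape_index la k) \o h.
    apply: same_colours => c; rewrite card_row //.
    have [cL|Lc] := ltnP c L; last first.
      rewrite nth_default ?eq_card0 // => [k|].
        by rewrite inE; apply/negbTE; rewrite neq_ltn (leq_trans (ltn_ord _) Lc).
      by rewrite (leq_trans _ Lc) // (leq_trans _ nL) // -lan size_part_leq.
    have := congr1 (fun a : {ffun 'I_L -> nat} => a (rev_ord (Ordinal cL))) fa0.
    rewrite !ffunE rev_ordK /= => <-; apply: eq_card => k; rewrite !inE.
    by rewrite -(inj_eq rev_ord_inj) rev_ordK.
  rewrite -[RHS]r1 -[RHS](row_mult_comp _ h) /row_mult -(eq_stab rfE).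
  have -> // : stab f = stab rf.
  apply/setP=> s; rewrite !inE; apply: eq_forallb => k.
  by rewrite /rf -(inj_eq rev_ord_inj).
(* No h as in [colours_fit] exists, so the sum of nonnegative products vanishes termwise; at i the
   second factor is 1. *)
have row0 (f : {ffun 'I_n -> 'I_L}) : wt (beta la) (colours f) != 0 ->
    colours f != a0 -> row_mult f 'chi_i = 0.
  move=> wt0 fa0; have := sum_row_sgn_mult f (fun k : 'I_n => reshape_offset la k).
  rewrite (_ : [set h | _] = set0) ?cards0; last first.
    apply/setP=> h; rewrite !inE; apply/injectiveP => /(colours_fit wt0)/eqP.
    by rewrite (negPf fa0).
  move/eqP; rewrite !mulf_eq0 !pnatr_eq0 !eqn0Ngt.
  rewrite (cardG_gt0 (stab_group f)) (cardG_gt0 (stab_group (fun k : 'I_n => reshape_offset la k))) /=.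
  rewrite psumr_eq0 => [|j _]; last first.
    have [x ->] := row_mult_nat f j.
    have [y ->] := sgn_mult_nat (fun k : 'I_n => reshape_offset la k) j.
    by rewrite -natrM ler0n.
  move/allP/(_ i); rewrite mem_index_enum s1 mulr1 => /(_ isT) /=.
  by move/eqP.
have inner : \sum_(h : 'S_n) (psi (beta la) h)%:~R * 'chi_i h = n`!%:R :> algC.
  transitivity (\sum_(f : {ffun 'I_n -> 'I_L}) (wt (beta la) (colours f))%:~R *
      (#|stab f|%:R * row_mult f 'chi_i)).
    transitivity (\sum_(h : 'S_n) \sum_(f : {ffun 'I_n -> 'I_L} | h \in stab f)
       (wt (beta la) (colours f))%:~R * 'chi_i h).
      by apply: eq_bigr => h _; rewrite /psi rmorph_sum mulr_suml.
    rewrite (exchange_big_dep predT) //=; apply: eq_bigr => f _.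
    rewrite -mulr_sumr; congr (_ * _); rewrite /row_mult mulVKf //.
    by rewrite pnatr_eq0 -lt0n (cardG_gt0 (stab_group f)).
  have <- := @sum_card_stab n _ a0 _; last first.
    rewrite -[RHS]lan (@sumn_nth la L) ?(leq_trans (size_part_leq pla)) ?lan // big_mkord.
    by rewrite [RHS](reindex_inj rev_ord_inj); apply: eq_bigr => j _; rewrite ffunE.
  rewrite natr_sum [RHS]big_mkcond; apply: eq_bigr => f _.
  case: ifP => [/eqP fa0|/negbT fa0]; first by rewrite fa0 wt_beta_a0 row1 // mul1r mulr1.
  have [->|wt0] := eqVneq (wt (beta la) (colours f)) 0; first by rewrite mul0r.
  by rewrite row0 // !mulr0.
have norm_psi : \sum_(h : 'S_n) (psi (beta la) h)%:~R * (psi (beta la) h)%:~R = n`!%:R :> algC.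
  transitivity ((\sum_(h : 'S_n) psi (beta la) h * psi (beta la) h)%:~R : algC).
    by rewrite rmorph_sum; apply: eq_bigr => h _; rewrite rmorphM.
  have laL : (size la <= L)%N by rewrite (leq_trans (size_part_leq pla)) ?lan.
  rewrite sum_psi ?sum_beta ?lan //.
  have -> : eps (beta la) (beta la) = 1.
    have binj : injective (beta la).
      move=> x y xy; apply/val_inj; case: (ltngtP x y) => // lt.
        by have := beta_inj pla lt; rewrite xy ltnn.
      by have := beta_inj pla lt; rewrite xy ltnn.
    rewrite /eps (bigD1 1%g) //= (_ : [forall x, _]); last first.
      by apply/forallP=> x; rewrite perm1.
    rewrite odd_perm1 big1 ?addr0 // => s /negP s1'; case: forallP => // h; case: s1'.
    by apply/eqP/permP=> x; rewrite perm1; apply: binj; have /eqP := h x.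
  by rewrite rmorphMn.
have norm_chi : \sum_(h : 'S_n) 'chi_i h * ('chi_i h)^* = n`!%:R :> algC.
  have := cfnorm_irr i; rewrite cfdotE => /(canRL (mulVKf (neq0CG _))).
  rewrite mulr1 card_Sym card_ord => <-.
  by apply: eq_bigl => h; rewrite in_Sym.
have : \sum_(h : 'S_n) ((psi (beta la) h)%:~R - 'chi_i h) * ((psi (beta la) h)%:~R - 'chi_i h)^* = 0 :> algC.
  transitivity (\sum_(h : 'S_n) (psi (beta la) h)%:~R * (psi (beta la) h)%:~R -
    \sum_(h : 'S_n) (psi (beta la) h)%:~R * 'chi_i h -
    (\sum_(h : 'S_n) (psi (beta la) h)%:~R * 'chi_i h)^* +
    \sum_(h : 'S_n) 'chi_i h * ('chi_i h)^* : algC).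
    rewrite rmorph_sum -!sumrB -big_split; apply: eq_bigr => h _ /=.
    rewrite rmorphB rmorphM /= conj_intr ?intr_int //; ring.
  rewrite norm_psi norm_chi inner conjC_nat; ring.
move/eqP; rewrite psumr_eq0 => [|h _]; last exact: mul_conjC_ge0.
move/allP/(_ g); rewrite mem_index_enum => /(_ isT).
by rewrite mul_conjC_eq0 subr_eq0 chiE => /eqP->.
Qed.

End SchurCharacters.

(** * Power sums times the Vandermonde alternant *)

Section Alternants.
Variable L : nat.
Implicit Types (q : {mpoly int[L]}) (m : 'X_{1..L}) (i j : 'I_L) (l : nat) (t : 'S_L).

Let mE := (@mnmDE L, @mnmBE L, @mulmnE L, @mnm1E L, @mnmE L).

Definition pw l : {mpoly int[L]} := \sum_i 'X_i ^+ l.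
Definition vdm : {mpoly int[L]} :=
  \sum_(s : 'S_L) (-1) ^+ odd_perm s *: 'X_[[multinom (s i : nat) | i < L]].
Definition asym q := forall t, msym t q = (-1) ^+ odd_perm t *: q.

Lemma mcoeffXM q m k : (q * 'X_[k])@_m = q@_(m - k) *+ (k <= m)%MM.
Proof.
have [km|km] := boolP (k <= m)%MM; first by rewrite -{1}(submK km) addmC mcoeffMX.
apply/eqP; apply: contraR km => nz.
have : m \in msupp (q * 'X_[k]) by rewrite mcoeff_msupp.
rewrite (perm_mem (msuppMX _ _)) => /mapP[m' _ ->].
exact: lem_addr.
Qed.

Lemma mcoeff_pw q m l : (q * pw l)@_m = \sum_i q@_(m - U_(i) *+ l) *+ (l <= m i)%N.
Proof.
rewrite /pw mulr_sumr raddf_sum /=; apply: eq_bigr => i _.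
rewrite mpolyXn mcoeffXM; congr (_ *+ nat_of_bool _).
apply/mnm_lepP/idP => [/(_ i)|lm j]; first by rewrite mulmnE mnm1E eqxx mul1n.
by rewrite mulmnE mnm1E; case: eqP => [<-|]; rewrite ?mul1n.
Qed.

Lemma asym_vdm : asym vdm.
Proof.
move=> t; rewrite /vdm scaler_sumr raddf_sum /= (reindex_inj (mulgI t)) /=.
apply: eq_bigr => s _; rewrite linearZ /= msymX scalerA odd_permM signr_addb; congr (_ *: 'X_[_]).
by apply/mnmP=> i; rewrite !mnmE permM permKV.
Qed.

Lemma asym_mul_pw q l : asym q -> asym (q * pw l).
Proof.
move=> aq t; rewrite msymM aq scalerAl; congr (_ * _).
rewrite /pw raddf_sum /= [RHS](reindex_inj (@perm_inj _ t)); apply: eq_bigr => i _.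
rewrite !mpolyXn msymX; congr 'X_[_]; apply/mnmP=> k; rewrite mnmE !mulmnE !mnm1E.
by rewrite -(inj_eq (@perm_inj _ t)) permKV.
Qed.

Lemma asym_perm q m t : asym q -> q@_[multinom m (t i) | i < L] = (-1) ^+ odd_perm t * q@_m.
Proof. by move=> aq; rewrite -mcoeff_sym aq mcoeffZ. Qed.

Lemma asym_repeat q m i j : asym q -> i != j -> m i = m j -> q@_m = 0.
Proof.
move=> aq ij mij; have := asym_perm m (tperm i j) aq.
rewrite odd_tperm ij expr1 mulN1r (_ : [multinom _ | _ < _] = m); first by lia.
by apply/mnmP=> k; rewrite mnmE; case: tpermP => // ->.
Qed.

Lemma vdm_coeff m : vdm@_m != 0 -> exists s : 'S_L, forall i, m i = s i.
Proof.
have [s /forallP sE|no] := pickP (fun s : 'S_L => [forall i, m i == s i :> nat]).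
  by exists s => i; apply/eqP.
rewrite /vdm raddf_sum /= big1 ?eqxx // => s _; rewrite mcoeffZ mcoeffX.
case: eqP => [sm|]; rewrite ?mulr0 //; move: (no s) => /forallP[] i.
by rewrite -sm mnmE.
Qed.

Lemma vdm_perm (s : 'S_L) : vdm@_[multinom (s i : nat) | i < L] = (-1) ^+ odd_perm s.
Proof.
rewrite /vdm raddf_sum /= (bigD1 s) //= mcoeffZ mcoeffX eqxx mulr1 big1 ?addr0 // => t ts.
rewrite mcoeffZ mcoeffX; case: eqP => [/mnmP tsE|]; rewrite ?mulr0 //.
by case/eqP: ts; apply/permP=> i; apply/val_inj; have := tsE i; rewrite !mnmE.
Qed.

(** At the exponents of nu this becomes the signed sum over all added 3-hooks; a blocked exponent
    produces a repetition, hence 0. *)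
Definition add3 q m := \sum_j q@_(m + U_(j) *+ 3).

(** The terms i and j cancel by the transposition exchanging them; every other term keeps the
    repetition. *)
Lemma add3_repeat q m i j : asym q -> i != j -> m i = m j -> add3 q m = 0.
Proof.
move=> aq ij mij; rewrite /add3 (bigD1 i) //= (bigD1 j) 1?eq_sym //= big1 ?addr0; last first.
  move=> k /andP[ki kj]; apply: (asym_repeat aq ij).
  by rewrite !mE (negPf ki) (negPf kj) mij.
have := asym_perm (m + U_(i) *+ 3) (tperm i j) aq; rewrite odd_tperm ij expr1 mulN1r.
rewrite (_ : [multinom _ | _ < _] = (m + U_(j) *+ 3)%MM) => [->|]; first by rewrite addrN.
apply/mnmP=> k; rewrite !mE; case: tpermP => [->|->|/eqP ki /eqP kj].
- by rewrite [j == i]eq_sym (negPf ij) mij.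
- by rewrite !eqxx mij.
by rewrite ![_ == k]eq_sym (negPf ki) (negPf kj).
Qed.

(** A monomial of the alternant uses each of 0, ..., L - 1 once, but for distinct exponents raising
    m j by 3 leaves the value m j vacant. *)
Lemma add3_vdm m : add3 vdm m = 0.
Proof.
have [/injectiveP minj|/injectivePn[i [j ij mij]]] := boolP (injectiveb m); last first.
  exact: add3_repeat asym_vdm ij mij.
rewrite /add3 big1 // => j _; apply/eqP/negPn/negP=> /vdm_coeff[s sE].
have mjL : (m j < L)%N.
  by have := sE j; rewrite mnmDE mulmnE mnm1E eqxx => sj; have := ltn_ord (s j); lia.
pose k := (s^-1)%g (Ordinal mjL); have := sE k; rewrite /k permKV /= mnmDE mulmnE mnm1E.
rewrite -/k; case: (j =P k) => [<-|jk]; first by lia.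
by rewrite addn0 => /minj kj; case: jk.
Qed.

Definition has012 m := forall v, (v < 3)%N -> exists i, m i = v.

(* Adding 3 to an exponent commutes with removing l <> 3 from an exponent, as
   long as the exponents 0, 1, 2 are present: the terms in which the order of
   the two moves matters end in {0, 1, 2} and have a repeated exponent. *)
Lemma add3_pw q m l : asym q -> l != 3 -> has012 m ->
  add3 (q * pw l) m = \sum_i add3 q (m - U_(i) *+ l) *+ (l <= m i)%N.
Proof.
move=> aq l3 m012; rewrite /add3.
under eq_bigr do rewrite mcoeff_pw.
rewrite exchange_big /=; apply: eq_bigr => i _; rewrite -sumrMnl; apply: eq_bigr => j _.
have comm : (l <= m i)%N -> (m + U_(j) *+ 3 - U_(i) *+ l = m - U_(i) *+ l + U_(j) *+ 3)%MM.
  move=> lm; apply/mnmP=> k; rewrite !mE.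
  by case: (j =P k) => _; case: (i =P k) => [<-|_]; lia.
have [ij|ij] := eqVneq i j; last first.
  have -> : (m + U_(j) *+ 3)%MM i = m i by rewrite mnmDE mulmnE mnm1E eq_sym (negPf ij) addn0.
  by case: leqP => // /comm ->.
rewrite -{}ij in comm *.
have -> : (m + U_(i) *+ 3)%MM i = (m i + 3)%N by rewrite mnmDE mulmnE mnm1E eqxx.
case: (leqP l (m i)) => [lm|ml].
  by rewrite comm // (leq_trans lm) ?leq_addr.
rewrite mulr0n; case: leqP => // lm; rewrite mulr1n.
have [i' i'E] := m012 (m i + 3 - l)%N ltac:(lia).
have ii' : i != i' by apply/eqP=> ii'; move: i'E; rewrite -ii'; move/eqP: l3; lia.
apply: (asym_repeat aq ii'); rewrite !mE eqxx (negPf ii') i'E; lia.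
Qed.

Definition alternant (s : seq nat) := vdm * \prod_(l <- s) pw l.

Lemma alternant_cons l s : alternant (l :: s) = alternant s * pw l.
Proof. by rewrite /alternant big_cons mulrA mulrAC. Qed.

Lemma asym_alternant s : asym (alternant s).
Proof.
elim: s => [|l s IH]; last by rewrite alternant_cons; apply: asym_mul_pw.
by rewrite /alternant big_nil mulr1; apply: asym_vdm.
Qed.

(** Induction by [add3_pw]. Lowering an exponent that is at least 3 leaves 0, 1, 2 present; lowering
    a smaller one by l > 0 meets an exponent already there, and [add3_repeat] applies. *)
Lemma add3_alternant s m : 3 \notin s -> has012 m -> add3 (alternant s) m = 0.
Proof.
elim: s m => [|l s IH] m; first by rewrite /alternant big_nil mulr1 add3_vdm.
rewrite inE negb_or eq_sym => /andP[l3 s3] m012.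
rewrite alternant_cons add3_pw //; last exact: asym_alternant.
rewrite big1 // => i _; have [lm|//] := leqP l (m i); rewrite mulr1n.
have [mi|mi] := ltnP (m i) 3; last first.
  apply: IH => // v v3; have [k kE] := m012 v v3; exists k.
  rewrite !mE kE; case: eqP => [ik|]; last by rewrite subn0.
  by move: mi; rewrite ik kE; lia.
have [l0|l0] := posnP l.
  by rewrite l0 mulm0n subm0 IH.
have [k kE] := m012 (m i - l)%N ltac:(lia).
have ik : i != k by apply/eqP=> ik; move: kE; rewrite -ik; lia.
by apply: (add3_repeat (asym_alternant s) ik); rewrite !mE eqxx (negPf ik) kE; lia.
Qed.

Definition att m v := [exists i, m i == v].

Lemma attP m v : reflect (exists i, m i = v) (att m v).
Proof. by apply: (iffP existsP) => -[i /eqP]; exists i => //; apply/eqP. Qed.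

(** The exponent v stands for the encoded integer v - L, so v -> 2 L - 1 - v is z -> -1 - z, and the
    condition is invariance under conjugation. *)
Definition selfdual m := (forall i, m i < 2 * L)%N /\
  forall v, (v < 2 * L)%N -> att m v = ~~ att m (2 * L - 1 - v)%N.

Lemma asym_prod_pw (I : Type) (r : seq I) (P : pred I) (F : I -> nat) :
  asym (vdm * \prod_(i <- r | P i) pw (F i)).
Proof.
elim: r => [|i r IH]; first by rewrite big_nil mulr1; apply: asym_vdm.
rewrite big_cons; case: ifP => // _.
by rewrite mulrCA mulrC; apply: asym_mul_pw.
Qed.

(* Diagonal hook lengths: in a self-dual set of exponents the largest one,
   L + x, is the only one from which 2x+1 can be removed, and this leaves a
   self-dual set. *)
Lemma alternant_selfdual m : injective m -> selfdual m ->
  (vdm * \prod_(i | (L <= m i)%N) pw (2 * (m i - L) + 1))@_m ^+ 2 = 1.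
Proof.
elim: {m}#|[set i | (L <= m i)%N]| {-2}m (erefl #|[set i | (L <= m i)%N]|) => [|k IH] m.
  move/eqP; rewrite cards_eq0 => /eqP/setP m0 minj _.
  rewrite big_pred0 => [|i]; last by have := m0 i; rewrite !inE.
  have mL i : (m i < L)%N by have := m0 i; rewrite !inE ltnNge => ->.
  have sinj : injective (fun i => Ordinal (mL i)) by move=> x y [/minj].
  rewrite mulr1 (_ : m = [multinom (perm sinj i : nat) | i < L]).
    by rewrite vdm_perm sqrr_sign.
  by apply/mnmP=> i; rewrite mnmE permE.
move=> mk minj [m2L mdual].
have [j0 j0P] : exists j0, (L <= m j0)%N.
  have : [set i | (L <= m i)%N] != set0 by rewrite -card_gt0 mk.
  by case/set0Pn=> j0; rewrite inE; exists j0.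
pose j := [arg max_(j > j0) m j]; have jmax i : (m i <= m j)%N by rewrite /j; case: arg_maxnP => // j1 _; apply.
have Lj : (L <= m j)%N := leq_trans j0P (jmax j0).
set l := (2 * (m j - L) + 1)%N.
have ljm : (l <= m j)%N by have := m2L j; rewrite /l; lia.
pose m' := (m - U_(j) *+ l)%MM.
have m'j : m' j = (2 * L - 1 - m j)%N by rewrite !mE eqxx /l; have := m2L j; lia.
have m'i i : i != j -> m' i = m i by move=> ij; rewrite !mE eq_sym (negPf ij) subn0.
have att_j : att m (m j) by apply/attP; exists j.
have att_dj : ~~ att m (2 * L - 1 - m j)%N by rewrite -mdual.
rewrite (bigD1 j) //= -/l mulrCA mulrC mcoeff_pw (bigD1 j) //= ljm mulr1n [X in _ + X]big1 ?addr0; last first.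
  move=> i ij; have [lmi|//] := leqP l (m i); rewrite mulr1n.
  have mij : (m i < m j)%N by rewrite ltn_neqAle jmax andbT (inj_eq minj).
  have : att m (m i - l)%N.
    rewrite mdual; last by have := m2L i; lia.
    apply/attP=> -[i' i'E]; have := jmax i'; rewrite i'E /l; have := m2L j; lia.
  case/attP=> i' i'E; have ii' : i != i' by apply/eqP=> ii'; move: i'E; rewrite -ii' /l; lia.
  apply: (asym_repeat (asym_prod_pw _ _ _) ii').
  by rewrite !mE eqxx (negPf ii') i'E; lia.
have -> : \prod_(i | (L <= m i)%N && (i != j)) pw (2 * (m i - L) + 1) =
    \prod_(i | (L <= m' i)%N) pw (2 * (m' i - L) + 1).
  apply: eq_big => [i|i /andP[_ ij]]; last by rewrite m'i.
  have [->|ij] := eqVneq i j; last by rewrite m'i // andbT.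
  by rewrite m'j andbF; apply/esym/negbTE; have := m2L j; lia.
rewrite -/m'; clearbody m' l; clearbody j; apply: IH.
- apply/eqP; rewrite -eqSS -mk (cardsD1 j [set i | (L <= m i)%N]) inE Lj add1n eqSS; apply/eqP/eq_card=> i.
  rewrite !inE; have [->|ij] := eqVneq i j; last by rewrite m'i.
  by rewrite m'j; apply/negbTE; have := m2L j; lia.
- move=> x y; have [->|xj] := eqVneq x j; have [->|yj] := eqVneq y j => //.
  + by rewrite m'j m'i // => e; case/attP: att_dj; exists y.
  + by rewrite m'j m'i // => e; case/attP: att_dj; exists x.
  by rewrite !m'i //; apply: minj.
split=> [i|v v2L].
  by have [->|ij] := eqVneq i j; rewrite ?m'j ?m'i //; have := m2L j; lia.
have att'j : ~~ att m' (m j).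
  apply/attP=> -[i]; have [->|ij] := eqVneq i j; first by rewrite m'j; have := m2L j; lia.
  by rewrite m'i // => /minj/eqP; apply/negP.
have att'dj : att m' (2 * L - 1 - m j)%N by apply/attP; exists j.
have [->|vj] := eqVneq v (m j); first by rewrite att'dj (negPf att'j).
have [->|vdj] := eqVneq v (2 * L - 1 - m j)%N.
  by rewrite att'dj (_ : (_ - (_ - _))%N = m j) // ; have := m2L j; lia.
have att'E w : w != m j -> w != (2 * L - 1 - m j)%N -> att m' w = att m w.
  move=> wj wdj; apply/attP/attP=> -[i iw]; exists i.
    by rewrite -m'i //; apply: contraNneq wdj => ij; rewrite -iw ij m'j.
  by rewrite m'i //; apply: contraNneq wj => ij; rewrite -iw ij.
have mj2L := m2L j.
have v'j : (2 * L - 1 - v)%N != m j by move/eqP: vdj; lia.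
have v'dj : (2 * L - 1 - v)%N != (2 * L - 1 - m j)%N by move/eqP: vj; lia.
rewrite (att'E v vj vdj).
rewrite (att'E _ v'j v'dj).
exact: mdual.
Qed.
End Alternants.

(** * Edge sequences and added 3-hooks *)

Section MayaDiagram.
Implicit Types (nu la : seq nat) (z w : int) (r j i k : nat).

(** Membership in the encoding of nu. Past the last part the equation reads r = - z - 1, so the
    finite search range is enough. *)
Definition inB nu z : bool :=
  has (fun r => Posz (nth 0%N nu r) == z + Posz r + 1) (iota 0 (size nu + `|z|).+1).

Lemma inBP nu z : reflect (exists r, Posz (nth 0%N nu r) = z + Posz r + 1) (inB nu z).
Proof.
apply: (iffP hasP) => [[r _ /eqP]|[r rE]]; first by exists r.
exists r; last by apply/eqP.
rewrite mem_iota /= add0n; have [rs|sr] := ltnP r (size nu); first by lia.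
by move: rE; rewrite nth_default //; lia.
Qed.

Lemma nth_part_le nu r r' : is_part nu -> (r <= r')%N -> (nth 0 nu r' <= nth 0 nu r)%N.
Proof. by case/andP=> s _; apply: nth_sorted_geq. Qed.

(** If -1 - z is not encoded, the least row r whose integer does not exceed it lies strictly below
    it, and r is the length of the column that encodes z in the conjugate. *)
Lemma inB_conj nu z : is_part nu -> inB (conj_part nu) z = ~~ inB nu (- 1 - z).
Proof.
move=> pnu; apply/inBP/idP=> [[j jE]|/inBP no].
  apply/inBP=> -[r rE]; have := nth_conj r j pnu.
  by move: jE rE; case: ltnP; case: ltnP; lia.
have ex : exists r, Posz (nth 0%N nu r) <= (- 1 - z) + Posz r + 1.
  exists (size nu + `|z|)%N; rewrite nth_default; lia.
case: (ex_minnP ex) => r rP rmin.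
have rneq : Posz (nth 0%N nu r) != (- 1 - z) + Posz r + 1.
  by apply/eqP=> rE; case: no; exists r.
exists `|(- 1 - z + Posz r)%R|%N.
have jE : Posz `|(- 1 - z + Posz r)%R|%N = - 1 - z + Posz r by move: rP rneq; lia.
rewrite jE.
suff -> : nth 0%N (conj_part nu) `|(- 1 - z + Posz r)%R|%N = r by lia.
apply: eq_from_ltn => i; rewrite nth_conj //.
have [ir|ri] := ltnP i r.
  have := rmin r.-1; have ir' : (i <= r.-1)%N by lia.
  have := nth_part_le pnu ir'; case: lerP => [_ _ /(_ isT)|]; first by lia.
  by move: jE; lia.
by apply/negbTE; have := nth_part_le pnu ri; move: rP rneq jE; lia.
Qed.

(** The integers nu_r - r - 1 strictly decrease with r, so the set determines them in order. *)
Lemma inB_ext nu la : is_part nu -> is_part la -> inB nu =1 inB la -> nu = la.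
Proof.
move=> pnu pla e; apply: part_eq => // i; elim/ltn_ind: i => i IH.
have sub nu' la' : is_part nu' -> is_part la' -> inB nu' =1 inB la' ->
    (forall x, (x < i)%N -> nth 0%N nu' x = nth 0%N la' x) -> (nth 0 la' i <= nth 0 nu' i)%N.
  move=> pnu' pla' e' IH'.
  have : inB nu' (Posz (nth 0%N la' i) - Posz i - 1) by rewrite e'; apply/inBP; exists i; lia.
  case/inBP=> r rE; have [ri|ir] := ltnP r i; last by have := nth_part_le pnu' ir; lia.
  by have := nth_part_le pla' (ltnW ri); rewrite -(IH' r ri); lia.
apply/eqP; rewrite eqn_leq !sub // => x xi; last by rewrite IH.
Qed.

Lemma mem_boxes nu b : (b \in boxes nu) = (b.2 < nth 0 nu b.1)%N.
Proof.
case: b => r j; apply/allpairsPdep/idP => /=.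
  by case=> r' [j' [_ + [-> ->]]]; rewrite mem_iota.
move=> jr; exists r, j; split=> //; rewrite mem_iota //= add0n.
by rewrite ltnNge; apply: contraTN jr => sr; rewrite nth_default.
Qed.

Lemma boxes_uniq nu : uniq (boxes nu).
Proof.
by apply: allpairs_uniq_dep => [|r _|[r j] [r' j'] _ _ /= [-> ->]]; rewrite ?iota_uniq.
Qed.

Lemma size_boxes nu : size (boxes nu) = sumn nu.
Proof.
rewrite size_allpairs_dep; congr sumn; apply: (@eq_from_nth _ 0%N); rewrite size_map size_iota //.
by move=> i il; rewrite (nth_map 0%N) ?size_iota // nth_iota // size_iota.
Qed.

Lemma mem_skew la nu b :
  (b \in skew_boxes la nu) = (nth 0 nu b.1 <= b.2 < nth 0 la b.1)%N.
Proof. by rewrite mem_filter !mem_boxes -leqNgt. Qed.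

Lemma size_skew la nu : {subset boxes nu <= boxes la} ->
  (size (skew_boxes la nu) + sumn nu = sumn la)%N.
Proof.
move=> sub; rewrite -!size_boxes /skew_boxes.
rewrite -(count_predC (mem (boxes nu)) (boxes la)) size_filter addnC; congr (_ + _)%N.
rewrite -size_filter; apply/perm_size/uniq_perm; rewrite ?filter_uniq ?boxes_uniq // => b.
by rewrite mem_filter /=; case nub: (b \in boxes nu); rewrite //= sub.
Qed.

End MayaDiagram.

Section AddedHooks.
Local Open Scope nat_scope.
Implicit Types (nu la : seq nat) (r j i k x : nat).

(** The rows after adding a rim hook of three boxes with top row i and leg length k: each lower row
    of the hook ends one box beyond the old end of the row above it, and row i takes the remaining
    boxes. *)
Definition hook_shape nu i k x :=
  if x == i then nth 0 nu (i + k) + 3 - k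
  else if i < x <= i + k then (nth 0 nu x.-1).+1 else nth 0 nu x.

(** A path of adjacent boxes that passes below row x does so by a vertical step from row x to row x
    + 1. *)
Lemma path_crossing (s : seq (nat * nat)) p b x :
    path adjacent b p -> {subset b :: p <= s} -> b.1 <= x -> x < (last b p).1 ->
  exists c, (x, c) \in s /\ (x.+1, c) \in s.
Proof.
elim: p b => [|c p IH] b /=; first by move=> _ _; lia.
case/andP=> bc pcp sub bx lx; have [cx|xc] := leqP c.1 x.
  by apply: (IH c) => // d dcp; apply: sub; rewrite inE dcp orbT.
move: bc; rewrite /adjacent => /orP[/andP[/eqP e _]|/andP[/eqP e2 /orP[/eqP e|/eqP e]]]; [lia|lia|].
have bE : b = (x, b.2) by case: (b) bx e => b1 b2 /= bx e; congr (_, _); lia.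
have cE : c = (x.+1, b.2) by case: (c) e e2 xc bx => c1 c2 /= e e2 xc bx; congr (_, _); lia.
exists b.2; split; [rewrite -bE | rewrite -cE]; apply: sub; by rewrite !inE eqxx ?orbT.
Qed.

Lemma skew_telescope nu la i k :
  (forall x, i <= x < i + k -> nth 0 la x.+1 = (nth 0 nu x).+1) ->
  \sum_(i <= x < (i + k).+1) nth 0 la x + nth 0 nu (i + k)
  = \sum_(i <= x < (i + k).+1) nth 0 nu x + nth 0 la i + k.
Proof.
elim: k => [|k IH] h; first by rewrite addn0 !big_nat1 addnC addn0.
have {}IH := IH (fun x xk => h x ltac:(lia)).
have hk : nth 0 la (i + k).+1 = (nth 0 nu (i + k)).+1 by apply: h; lia.
rewrite addnS big_nat_recr /=; last lia.
rewrite [X in _ = X + _ + _]big_nat_recr /=; last lia.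
by rewrite hk; lia.
Qed.

(** Connectedness makes consecutive rows of the skew shape share a column, and the absence of
    squares allows only one, so la_(x+1) = nu_x + 1 inside the hook. The three boxes then fix the
    top row by telescoping. *)
Lemma add_hook_shape nu la : add_hook 3 nu la ->
  exists i k, k < 3 /\ forall x, nth 0 la x = hook_shape nu i k x.
Proof.
case=> -[pnu pla] sub size3 conn nosq.
have le x : nth 0 nu x <= nth 0 la x.
  rewrite leqNgt; apply/negP=> lt; have := sub (x, nth 0 la x).
  by rewrite !mem_boxes /= ltnn lt => /(_ isT).
have sum3 := size_skew sub; rewrite size3 in sum3.
have ex : exists x, nth 0 nu x < nth 0 la x.
  case: (skew_boxes la nu) size3 (fun b => mem_skew la nu b) => // b s _ /(_ b).
  by rewrite inE eqxx => /esym/andP[bn bl]; exists b.1; apply: leq_ltn_trans bl.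
have bnd x : nth 0 nu x < nth 0 la x -> x <= size la.
  by move=> lt; rewrite leqNgt; apply/negP=> sx; move: lt; rewrite (nth_default _ (ltnW sx)).
case: (ex_minnP ex) => i iP imin; case: (ex_maxnP ex bnd) => r rP rmax.
have ir : i <= r := imin r rP.
have step x : i <= x < r -> nth 0 la x.+1 = (nth 0 nu x).+1.
  case/andP=> ix xr.
  have bi : (i, nth 0 nu i) \in skew_boxes la nu by rewrite mem_skew /= leqnn.
  have br : (r, nth 0 nu r) \in skew_boxes la nu by rewrite mem_skew /= leqnn.
  have [p [pp lp ps]] := conn _ _ bi br.
  have [|||c []] := @path_crossing (skew_boxes la nu) p (i, nth 0 nu i) x pp; rewrite ?lp //.
    by move=> b; rewrite inE => /orP[/eqP->|/ps].
  rewrite !mem_skew /= => /andP[c1 c2] /andP[c3 c4].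
  apply/eqP; rewrite eqn_leq; apply/andP; split; last by lia.
  rewrite leqNgt; apply/negP=> big; have := nosq x (nth 0 nu x).
  have := nth_part_le pla (leqnSn x); have := nth_part_le pnu (leqnSn x).
  by rewrite !mem_skew /=; lia.
exists i, (r - i); have rE : i + (r - i) = r by lia.
have out x : (x < i) || (r < x) -> nth 0 la x = nth 0 nu x.
  move=> xir; apply/eqP; rewrite eqn_leq le andbT leqNgt; apply/negP=> lt.
  by have := imin x lt; have := rmax x lt; lia.
have tel := @skew_telescope nu la i (r - i); rewrite rE in tel; have {}tel := tel step.
have rl : r <= size la := bnd r rP.
pose N := (maxn (size la) (size nu)).+1.
have rN : r.+1 <= N by rewrite /N; lia.
have iN : i <= N by lia.
have s1 : sumn la = \sum_(0 <= x < i) nth 0 nu x + (\sum_(i <= x < r.+1) nth 0 la x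
     + \sum_(r.+1 <= x < N) nth 0 nu x).
  rewrite (@sumn_nth la N); last by rewrite /N; lia.
  rewrite (big_cat_nat (leq0n i) iN) (big_cat_nat (_ : i <= r.+1) rN) /=; last by lia.
  congr (_ + (_ + _)); apply: eq_big_nat => x xx; apply: out; lia.
have s2 : sumn nu = \sum_(0 <= x < i) nth 0 nu x + (\sum_(i <= x < r.+1) nth 0 nu x
     + \sum_(r.+1 <= x < N) nth 0 nu x).
  rewrite (@sumn_nth nu N); last by rewrite /N; lia.
  by rewrite (big_cat_nat (leq0n i) iN) (big_cat_nat (_ : i <= r.+1) rN) /=; last by lia.
have lai : nth 0 la i + (r - i) = nth 0 nu r + 3 by move: tel sum3; rewrite s1 s2; lia.
have nri := nth_part_le pnu ir.
split; first by lia.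
move=> x; rewrite /hook_shape rE; case: (x =P i) => [->|xi]; first by lia.
case: ifP => [/andP[ix xr]|]; last by move=> h; apply: out; lia.
by have := step x.-1; rewrite prednK; lia.
Qed.

Lemma hook_shapeE nu la i k : (forall x, nth 0 la x = hook_shape nu i k x) ->
  [/\ nth 0 la i = nth 0 nu (i + k) + 3 - k,
      0 < k -> nth 0 la i.+1 = (nth 0 nu i).+1,
      1 < k -> nth 0 la i.+2 = (nth 0 nu i.+1).+1
    & forall x, (x < i) || (i + k < x) -> nth 0 la x = nth 0 nu x].
Proof.
move=> laE; split=> [|k0|k1|x xo]; rewrite laE /hook_shape ?eqxx //.
- by rewrite (_ : (_ == i) = false) ?ifT //; lia.
- by rewrite (_ : (_ == i) = false) ?ifT //; lia.
by rewrite (_ : (_ == i) = false) ?ifF //; lia.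
Qed.

Lemma three_box_path (s : seq (nat * nat)) b1 b2 b3 :
    adjacent b1 b2 -> adjacent b2 b3 -> s =i [:: b1; b2; b3] -> connected_boxes s.
Proof.
have sym : ssrbool.symmetric adjacent.
  move=> b c; rewrite /adjacent ![c.1 == _]eq_sym ![c.2 == _]eq_sym.
  by congr (_ && _ || _ && _); rewrite orbC; congr (_ || _); rewrite eq_sym.
move=> a12 a23 sE; have a21 : adjacent b2 b1 by rewrite sym.
have a32 : adjacent b3 b2 by rewrite sym.
have m1 : b1 \in s by rewrite sE !inE eqxx.
have m2 : b2 \in s by rewrite sE !inE eqxx orbT.
have m3 : b3 \in s by rewrite sE !inE eqxx !orbT.
move=> b c; rewrite !sE !inE => /or3P[]/eqP-> /or3P[]/eqP->.
- by exists [::].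
- by exists [:: b2]; rewrite /= a12; split=> // d; rewrite inE => /eqP->.
- by exists [:: b2; b3]; rewrite /= a12 a23; split=> // d; rewrite !inE => /orP[]/eqP->.
- by exists [:: b1]; rewrite /= a21; split=> // d; rewrite inE => /eqP->.
- by exists [::].
- by exists [:: b3]; rewrite /= a23; split=> // d; rewrite inE => /eqP->.
- by exists [:: b2; b1]; rewrite /= a32 a21; split=> // d; rewrite !inE => /orP[]/eqP->.
- by exists [:: b2]; rewrite /= a32; split=> // d; rewrite inE => /eqP->.
by exists [::].
Qed.

(** The three boxes are listed for each k. For k = 1 there are two shapes, as rows i and i + 1 of nu
    are equal or differ by one. *)
Lemma shape_add_hook nu la i k : is_part nu -> is_part la -> k < 3 ->
  (forall x, nth 0 la x = hook_shape nu i k x) -> add_hook 3 nu la.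
Proof.
move=> pnu pla k3 laE.
have suff3 b1 b2 b3 : adjacent b1 b2 -> adjacent b2 b3 -> uniq [:: b1; b2; b3] ->
    {subset boxes nu <= boxes la} ->
    skew_boxes la nu =i [:: b1; b2; b3] -> add_hook 3 nu la.
  move=> a12 a23 u sub sE; have us : uniq (skew_boxes la nu) by rewrite filter_uniq ?boxes_uniq.
  have s3 : size (skew_boxes la nu) = 3 by rewrite (perm_size (uniq_perm us u sE)).
  split=> //; first exact: three_box_path a12 a23 sE.
  move=> x c; apply/negP=> /and4P[h1 h2 h3 h4].
  suff : size [:: (x, c); (x, c.+1); (x.+1, c); (x.+1, c.+1)] <= 3 by [].
  rewrite -s3; apply: uniq_leq_size.
    by rewrite /= !inE !xpair_eqE !eqxx !andbT /=; lia.
  by move=> d; rewrite !inE => /or4P[]/eqP->.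
have lei := nth_part_le pla (leqnSn i); have lei1 := nth_part_le pla (leqnSn i.+1).
have [e0 e1 e2 eo] := hook_shapeE laE.
have n0 := nth_part_le pnu (leqnSn i); have n1 := nth_part_le pnu (leqnSn i.+1).
have le x : nth 0 nu x <= nth 0 la x.
  have [->|xi] := eqVneq x i.
    by move: k3 e0 e1 e2; case: (k) => [|[|[|]]] //; rewrite ?addn0 ?addn1 ?addn2 => _ e0 e1 e2; try have := e1 isT; try have := e2 isT; lia.
  have [/andP[ix xk]|xo] := boolP (i < x <= i + k); last by rewrite eo //; lia.
  have xE : x = x.-1.+1 by lia.
  have := laE x; rewrite /hook_shape (negPf xi) ix xk /= => ->.
  by have := nth_part_le pnu (leq_pred x); lia.
have sub : {subset boxes nu <= boxes la}.
  by move=> b; rewrite !mem_boxes => /leq_trans; apply.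
have in_skew x c : ((x, c) \in skew_boxes la nu) = (nth 0 nu x <= c < nth 0 la x).
  by rewrite mem_skew.
have adjH x c : adjacent (x, c) (x, c.+1) by rewrite /adjacent /= !eqxx orbT.
have adjV x c : adjacent (x, c) (x.+1, c) by rewrite /adjacent /= !eqxx !orbT.
have adjH' x c : adjacent (x, c.+1) (x, c) by rewrite /adjacent /= !eqxx.
have adjV' x c : adjacent (x.+1, c) (x, c) by rewrite /adjacent /= !eqxx !orbT.
set c := nth 0 nu i in e0 e1 e2 n0 *.
have [k0|k_gt0] := posnP k.
  rewrite k0 addn0 subn0 -/c in e0.
  apply: (suff3 (i, c) (i, c.+1) (i, c.+2)) => // [|[x d]].
    by rewrite /= !inE !xpair_eqE !eqxx /=; lia.
  rewrite in_skew !inE !xpair_eqE; have [->|xi] := eqVneq x i; first by rewrite e0; lia.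
  by rewrite eo; lia.
have [k1|k_neq1] := eqVneq k 1.
  rewrite k1 addn1 in e0; have {}e1 := e1 k_gt0.
  have inE3 x d : ((x, d) \in skew_boxes la nu) =
     ((x == i) && (c <= d < nth 0 la i)) || ((x == i.+1) && (nth 0 nu i.+1 <= d < nth 0 la i.+1)).
    rewrite in_skew; have [->|xi] := eqVneq x i; first by rewrite (_ : (i == i.+1) = false) ?orbF //; lia.
    by have [->|xi1] := eqVneq x i.+1; rewrite //= eo; lia.
  have [cn|cn] : c = nth 0 nu i.+1 \/ c = (nth 0 nu i.+1).+1 by lia.
    apply: (suff3 (i.+1, c) (i, c) (i, c.+1)) => // [|[x d]].
      by rewrite /= !inE !xpair_eqE !eqxx /=; lia.
    by rewrite inE3 !inE !xpair_eqE e0 e1 -cn; lia.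
  apply: (suff3 (i.+1, c.-1) (i.+1, c) (i, c)) => // [||[x d]].
  - by rewrite cn; apply: adjH.
  - by rewrite /= !inE !xpair_eqE !eqxx /=; lia.
  by rewrite inE3 !inE !xpair_eqE e0 e1; lia.
have k2 : k = 2 by lia.
rewrite k2 addn2 in e0 eo; have {}e1 := e1 k_gt0; have {}e2 := e2 ltac:(by rewrite k2).
have c1 : nth 0 nu i.+1 = c by lia.
have c2 : nth 0 nu i.+2 = c by lia.
apply: (suff3 (i, c) (i.+1, c) (i.+2, c)) => // [|[x d]].
  by rewrite /= !inE !xpair_eqE !eqxx /=; lia.
rewrite in_skew !inE !xpair_eqE.
have [->|xi] := eqVneq x i; first by rewrite e0 c2 -/c; lia.
have [->|xi1] := eqVneq x i.+1; first by rewrite e1 c1; lia.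
have [->|xi2] := eqVneq x i.+2; first by rewrite e2 c1 c2; lia.
by rewrite eo; lia.
Qed.

End AddedHooks.

(** * Adding a 3-hook as a move z -> z + 3 *)

Section HookMoves.
Implicit Types (nu la : seq nat) (r i k x : nat) (z w : int).

Definition hook_move nu la z : Prop :=
  [/\ inB nu z, ~~ inB nu (z + 3) & forall w, inB la w = (inB nu w && (w != z)) || (w == z + 3)].

(** The parity of the number of encoded integers jumped over, which is that of the leg length. *)
Definition hook_parity nu z : bool := inB nu (z + 1) (+) inB nu (z + 2).

Lemma hook_shape_shift nu la i k x : (forall x, nth 0%N la x = hook_shape nu i k x) ->
  (i <= x < i + k)%N -> nth 0%N la x.+1 = (nth 0%N nu x).+1.
Proof.
move=> laE xk; rewrite laE /hook_shape (_ : (_ == i) = false) ?ifT //; lia.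
Qed.

(** Row x of nu and row x + 1 of la encode the same integer for i <= x < i + k, since both the part
    and the index grow by one. Only the integer z of row i + k disappears, and row i of la encodes z
    + 3. *)
Lemma shape_hook_move nu la i k z : is_part nu -> is_part la -> (k < 3)%N ->
    (forall x, nth 0%N la x = hook_shape nu i k x) ->
    Posz (nth 0%N nu (i + k)) = z + Posz (i + k) + 1 ->
  hook_move nu la z /\ odd k = hook_parity nu z.
Proof.
move=> pnu pla k3 laE zE.
have [e0 _ _ eo] := hook_shapeE laE; have es x := hook_shape_shift (x := x) laE.
have split_row x : (x < i)%N \/ (i <= x < i + k)%N \/ x = (i + k)%N \/ (i + k < x)%N by lia.
have lt_row x : (x < i)%N -> Posz (nth 0%N nu x) > z + 3 + Posz x + 1.
  by move=> xi; have := nth_part_le pla (ltnW xi); have := eo x ltac:(lia); lia.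
have mid_row x : (i <= x < i + k)%N ->
    (Posz (nth 0%N nu x) > z + Posz x + 1) /\ (Posz (nth 0%N nu x) < z + 3 + Posz x + 1).
  move=> xk; have := es x xk; have := nth_part_le pnu (_ : x <= i + k)%N.
  have := nth_part_le pla (_ : i <= x.+1)%N; lia.
have gt_row x : (i + k < x)%N -> Posz (nth 0%N nu x) < z + Posz x + 1.
  by move=> xk; have := nth_part_le pnu (ltnW xk); lia.
split; last first.
  have inBE w : z < w < z + 3 -> inB nu w = has (fun x => Posz (nth 0%N nu x) == w + Posz x + 1) (iota i k).
    move=> zw; apply/inBP/hasP => [[x xE]|[x _ /eqP xE]]; last by exists x.
    exists x; last by apply/eqP.
    rewrite mem_iota; case: (split_row x) => [h|[h|[h|h]]] //.
    - by have := lt_row x h; lia.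
    - by move: xE; rewrite h; lia.
    by have := gt_row x h; lia.
  rewrite /hook_parity !inBE; [|lia|lia].
  move: k3 mid_row; case: (k) => [|[|[|//]]] _ mid_row //=; rewrite !orbF.
    by have := mid_row i ltac:(lia); lia.
  have := mid_row i ltac:(lia); have := mid_row i.+1 ltac:(lia).
  by have := nth_part_le pnu (leqnSn i); lia.
split; first by apply/inBP; exists (i + k)%N.
  apply/inBP=> -[x xE]; case: (split_row x) => [h|[h|[h|h]]].
  - by have := lt_row x h; lia.
  - by have := mid_row x h; lia.
  - by move: xE; rewrite h; lia.
  by have := gt_row x h; lia.
move=> w; apply/inBP/orP => [[x xE]|[/andP[/inBP[x xE] wz]|/eqP->]].
- have [xi|xi] := eqVneq x i; first by right; apply/eqP; move: xE; rewrite xi e0; lia.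
  have [h|h] : (x < i)%N || (i + k < x)%N \/ (i <= x.-1 < i + k)%N /\ (0 < x)%N by lia.
  + left; apply/andP; split; first by apply/inBP; exists x; rewrite -eo.
    by move: h xE => /orP[] h; rewrite eo ?h ?orbT //; [have := lt_row x h|have := gt_row x h]; lia.
  + have [h1 h0] := h; left; have := es x.-1 h1; rewrite prednK // => e.
    apply/andP; split; first by apply/inBP; exists x.-1; lia.
    by have := mid_row _ h1; lia.
- case: (split_row x) => [h|[h|[h|h]]].
  + by exists x; rewrite eo ?h.
  + by exists x.+1; rewrite es //; lia.
  + by move: wz xE; rewrite h; lia.
  by exists x; rewrite eo ?h ?orbT.
by exists i; rewrite e0; lia.
Qed.

Lemma part_of_fun (f : nat -> nat) N : (forall x, f x.+1 <= f x)%N -> f N = 0%N ->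
  exists la, is_part la /\ forall x, nth 0%N la x = f x.
Proof.
move=> fdec fN; have ex : exists M, f M == 0%N by exists N; rewrite fN.
have fle x y : (x <= y)%N -> (f y <= f x)%N.
  by move/subnK<-; elim: (y - x)%N => // d IH; rewrite addSn (leq_trans (fdec _)).
case: (ex_minnP ex) => M /eqP fM Mmin; exists (mkseq f M).
have nthE x : nth 0%N (mkseq f M) x = f x.
  have [xM|Mx] := ltnP x M; first by rewrite nth_mkseq.
  by rewrite nth_default ?size_mkseq //; have := fle _ _ Mx; lia.
split=> //; apply/andP; split.
  by apply/(sortedP 0%N) => x _; rewrite !nthE /=.
apply/negP=> /(nthP 0%N)[x]; rewrite size_mkseq nthE => xM fx.
by have := Mmin x; rewrite fx; lia.
Qed.

Lemma hook_shape_dec nu i k : is_part nu -> (k < 3)%N ->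
    (0 < i -> nth 0 nu (i + k) + 3 - k <= nth 0 nu i.-1)%N ->
    (0 < k -> (nth 0 nu i).+1 <= nth 0 nu (i + k) + 3 - k)%N ->
  forall x, (hook_shape nu i k x.+1 <= hook_shape nu i k x)%N.
Proof.
move=> pnu k3 top bot x; have step y := nth_part_le pnu (leqnSn y).
have sx := step x; have sx' := nth_part_le pnu (leq_pred x).
have [xi|xi] := eqVneq x.+1 i.
  have xi' : (x == i) = false by lia.
  have h : (i < x <= i + k)%N = false by lia.
  by rewrite /hook_shape xi eqxx xi' h; have := top ltac:(lia); rewrite -xi.
rewrite /hook_shape (negPf xi); have [xi'|xi'] := eqVneq x i.
  rewrite xi' ltnSn /=; case: ltnP => ik; first by apply: bot; lia.
  have i0 : (i + k)%N = i by lia.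
  by rewrite i0; have := step i; lia.
case: ifP => h1; case: ifP => h2 /=; try lia.
Qed.

Lemma hook_move_shape nu z : is_part nu -> inB nu z -> ~~ inB nu (z + 3) ->
  exists la i k, [/\ is_part la, (k < 3)%N, forall x, nth 0%N la x = hook_shape nu i k x
     & Posz (nth 0%N nu (i + k)) = z + Posz (i + k) + 1].
Proof.
move=> pnu /inBP[r rE] nz3.
have nr x : Posz (nth 0%N nu x) != z + 3 + Posz x + 1.
  by apply: contra nz3 => /eqP xE; apply/inBP; exists x.
have build k i : (k < 3)%N -> (i + k)%N = r ->
    (0 < i -> nth 0 nu (i + k) + 3 - k <= nth 0 nu i.-1)%N ->
    (0 < k -> (nth 0 nu i).+1 <= nth 0 nu (i + k) + 3 - k)%N ->
    exists la i k, [/\ is_part la, (k < 3)%N, forall x, nth 0%N la x = hook_shape nu i k x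
     & Posz (nth 0%N nu (i + k)) = z + Posz (i + k) + 1].
  move=> k3 ik top bot; have [|la [pla laE]] := part_of_fun (N := maxn (size nu) r.+1) (hook_shape_dec pnu k3 top bot).
    by rewrite /hook_shape !ifF ?nth_default //; lia.
  by exists la, i, k; rewrite ik.
have s1 := nth_part_le pnu (leq_pred r); have s2 := nth_part_le pnu (leq_pred r.-1).
have s3 := nth_part_le pnu (leq_pred r.-2).
have nr1 := nr r.-1; have nr2 := nr r.-2; have nr3 := nr r.-2.-1.
(* The cases: none, one or two of the rows above r encode an integer strictly between z and z + 3.
   This number is the leg length. *)
have [[r0 c0]|[[r1 c1]|[r2 c2]]] :
    (r = 0%N \/ nth 0 nu r + 3 <= nth 0 nu r.-1)%N /\ (r = r) \/
    ((0 < r)%N /\ ((nth 0 nu r.-1 < nth 0 nu r + 2)%N /\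
      (r = 1%N \/ (nth 0 nu r + 2 <= nth 0 nu r.-2)%N))) \/
    ((1 < r)%N /\ ((nth 0 nu r.-2 <= nth 0 nu r)%N /\
      (r = 2 \/ (nth 0 nu r + 1 <= nth 0 nu r.-2.-1)%N))).
  by move: rE nr1 nr2 nr3; lia.
- by apply: (build 0%N r) => //; rewrite addn0 // subn0; lia.
- have rE' : (r.-1 + 1)%N = r by lia.
  by apply: (build 1%N r.-1) => //; rewrite rE'; lia.
have rE' : (r.-2 + 2)%N = r by lia.
by apply: (build 2%N r.-2) => //; rewrite rE'; lia.
Qed.

Theorem add_hookP nu la : is_part nu -> is_part la ->
  (add_hook 3 nu la <-> exists z, hook_move nu la z).
Proof.
move=> pnu pla; split=> [ah|[z [nz nz3 laz]]].
  have [i [k [k3 laE]]] := add_hook_shape ah.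
  exists (Posz (nth 0%N nu (i + k)) - Posz (i + k) - 1).
  by apply: (proj1 (shape_hook_move pnu pla k3 laE _)); lia.
have [la0 [i [k [pla0 k3 la0E zE]]]] := hook_move_shape pnu nz nz3.
have [[_ _ la0z] _] := shape_hook_move pnu pla0 k3 la0E zE.
have -> : la = la0 by apply: inB_ext => // w; rewrite laz la0z.
exact: shape_add_hook la0E.
Qed.

Lemma hook_moveP nu la z : is_part nu -> is_part la -> hook_move nu la z ->
  exists i k, [/\ (k < 3)%N, forall x, nth 0%N la x = hook_shape nu i k x,
    Posz (nth 0%N nu (i + k)) = z + Posz (i + k) + 1 & odd k = hook_parity nu z].
Proof.
move=> pnu pla [nz nz3 laz].
have [la0 [i [k [pla0 k3 la0E zE]]]] := hook_move_shape pnu nz nz3.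
have [[_ _ la0z] par] := shape_hook_move pnu pla0 k3 la0E zE.
exists i, k; split=> //; suff -> : la = la0 by [].
by apply: inB_ext => // w; rewrite laz la0z.
Qed.

Lemma hook_move_ex nu z : is_part nu -> inB nu z -> ~~ inB nu (z + 3) ->
  exists2 la, is_part la & hook_move nu la z.
Proof.
move=> pnu nz nz3; have [la [i [k [pla k3 laE zE]]]] := hook_move_shape pnu nz nz3.
by exists la => //; apply: (proj1 (shape_hook_move pnu pla k3 laE zE)).
Qed.

Lemma hook_move_inj nu la z z' : hook_move nu la z -> hook_move nu la z' -> z = z'.
Proof.
move=> [nz nz3 laz] [nz' nz3' laz']; have := laz' (z + 3); rewrite laz eqxx orbT (negPf nz3) /=.
by move/esym/eqP; lia.
Qed.

Lemma hook_move_uniq nu la la' z : is_part la -> is_part la' ->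
  hook_move nu la z -> hook_move nu la' z -> la = la'.
Proof. by move=> pla pla' [_ _ e] [_ _ e']; apply: inB_ext => // w; rewrite e e'. Qed.

(** Under z -> -1 - z and complementation, the new integer z + 3 becomes the vacated -4 - z, and the
    vacated z becomes the new -1 - z. *)
Lemma hook_move_conj nu la z : is_part nu -> is_part la -> hook_move nu la z ->
  hook_move (conj_part nu) (conj_part la) (- 4 - z).
Proof.
move=> pnu pla [nz nz3 laz]; split; rewrite ?inB_conj ?negbK //.
- by rewrite (_ : - 1 - (- 4 - z) = z + 3) //; lia.
- by rewrite (_ : - 1 - (- 4 - z + 3) = z) //; lia.
move=> w; rewrite !inB_conj // laz negb_or negb_and negbK.
have -> : (- 1 - w == z) = (w == - 4 - z + 3) by lia.
have -> : (- 1 - w == z + 3) = (w == - 4 - z) by lia.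
have [->|] := eqVneq w (- 4 - z + 3); last by rewrite !orbF.
by rewrite !orbT andTb; lia.
Qed.

Lemma hook_parity_conj nu z : is_part nu -> hook_parity (conj_part nu) (- 4 - z) = hook_parity nu z.
Proof.
move=> pnu; rewrite /hook_parity !inB_conj //.
rewrite (_ : - 1 - (- 4 - z + 1) = z + 2); last lia.
rewrite (_ : - 1 - (- 4 - z + 2) = z + 1); last lia.
by case: (inB _ _); case: (inB _ _).
Qed.

End HookMoves.

(** * Character values and signs of added hooks *)

Section CharacterValues.
Variables (n L : nat).
Implicit Types (nu la : seq nat) (z : int).

Definition ctype (g : 'S_n) : seq nat := [seq #|B| | B : {set 'I_n} <- enum (porbits g)].

Definition mb nu : 'X_{1..L} := [multinom beta L nu i | i < L].

Lemma psi_alternant (j0 : 'I_L) (b : {ffun 'I_L -> nat}) (g : 'S_n) :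
  psi b g = (alternant L (ctype g))@_[multinom b i | i < L].
Proof.
have -> : alternant L (ctype g) = vdm L * \sum_(f : {ffun 'I_n -> 'I_L} | g \in stab f) 'X_[cont f].
  rewrite /alternant big_map big_enum; congr (_ * _).
  rewrite (prod_porbits j0 (fun i => 'X_i)); apply: eq_bigr => f _.
  exact: prod_mono_cont.
rewrite mulr_sumr raddf_sum /=; apply: eq_bigr => f _.
rewrite /wt /vdm mulr_suml raddf_sum /=; apply: eq_bigr => s _.
rewrite -scalerAl mcoeffZ -mulr_natr; congr (_ * _).
rewrite -mpolyXD mcoeffX; congr ((nat_of_bool _)%:R).
apply/forallP/eqP=> [h|/mnmP h i].
  by apply/mnmP=> i; rewrite mnmDE !mnmE addnC; have /eqP := h i; rewrite ffunE.
by have := h i; rewrite mnmDE !mnmE ffunE addnC => ->.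
Qed.

Lemma chi_alternant (j0 : 'I_L) nu g : (n <= L)%N -> is_part nu -> sumn nu = n ->
  chi n nu g = ((alternant L (ctype g))@_(mb nu))%:~R.
Proof. by move=> nL pnu nun; rewrite (chi_psi nL pnu nun) psi_alternant. Qed.

Lemma mbE nu j : mb nu j = (nth 0 nu (rev_ord j) + j)%N.
Proof. by rewrite mnmE ffunE. Qed.

Lemma mb_inj nu : is_part nu -> injective (mb nu).
Proof.
move=> pnu x y; rewrite !mnmE => xy; apply/val_inj; case: (ltngtP x y) => // lt.
  by have := beta_inj pnu lt; rewrite xy ltnn.
by have := beta_inj pnu lt; rewrite xy ltnn.
Qed.

(** Raising the exponent of row i + k by 3 gives the exponents of la out of order; sorting takes it
    past the k rows above, a cycle of sign (-1)^k. *)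
Lemma hook_move_coeff q nu la z : asym q -> is_part nu -> is_part la -> (size la <= L)%N ->
    hook_move nu la z ->
  exists j : 'I_L, Posz (mb nu j) = z + Posz L /\
    q@_(mb nu + U_(j) *+ 3) = (-1) ^+ hook_parity nu z * q@_(mb la).
Proof.
move=> aq pnu pla laL /(hook_moveP pnu pla)[i [k [k3 laE zE par]]].
have [e0 e1 e2 eo] := hook_shapeE laE.
have ikL : (i + k < L)%N.
  rewrite (leq_trans _ laL) // -nth_part_gt0 //.
  case: k k3 laE e0 e1 e2 eo {zE par} => [|[|[|//]]] _ laE e0 e1 e2 eo; rewrite ?addn0 ?addn1 ?addn2.
  - by rewrite e0; lia.
  - by rewrite e1.
  by rewrite e2.
pose J x (xk : (x <= i + k)%N) : 'I_L := rev_ord (Ordinal (leq_ltn_trans xk ikL)).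
have JE x (xk : (x <= i + k)%N) : J x xk = (L - x.+1)%N :> nat by [].
have i_ik : (i <= i + k)%N by lia.
pose a := J i i_ik; pose c := J _ (leqnn (i + k)).
have aE := JE i i_ik; have cE := JE _ (leqnn (i + k)).
rewrite -/a -/c in aE cE; clearbody a c.
exists c; split.
  by rewrite mbE /= cE (_ : (L - (L - (i + k).+1).+1 = i + k)%N); lia.
rewrite -par signr_odd.
have row (j : 'I_L) : mb la j = (hook_shape nu i k (L - j.+1) + j)%N by rewrite mbE /= laE.
have rowe (j : 'I_L) x : (j = L - x.+1 :> nat)%N -> (x < L)%N ->
    mb la j = (nth 0 la x + j)%N /\ mb nu j = (nth 0 nu x + j)%N.
  by move=> jx xL; rewrite !mbE /= jx (_ : (L - (L - x.+1).+1 = x)%N) //; lia.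
have rowo (j : 'I_L) : (L - j.+1 < i)%N || (i + k < L - j.+1)%N -> mb la j = mb nu j.
  by move=> jo; rewrite !mbE /= eo.
have [k0|k_gt0] := posnP k.
  rewrite k0 expr0 mul1r; congr (q@__); apply/mnmP=> j; rewrite mnmDE mulmnE mnm1E.
  have iL : (i < L)%N by lia.
  have [<-|jc] := eqVneq c j.
    have [-> ->] := rowe c i ltac:(rewrite cE; lia) iL; rewrite e0 k0 addn0; lia.
  rewrite addn0 rowo //; move/eqP: jc => jc.
  have : nat_of_ord c <> j by move=> h; apply: jc; apply: val_inj.
  have := ltn_ord j; lia.
have i1 : (i.+1 <= i + k)%N by lia.
pose b := J _ i1; have bE := JE _ i1; rewrite -/b in bE; clearbody b.
have iL : (i < L)%N by lia.
have i1L : (i.+1 < L)%N by lia.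
have [la_a nu_a] := rowe a i aE iL; have [la_b nu_b] := rowe b i.+1 bE i1L.
have ne (x y : 'I_L) : nat_of_ord x <> y -> x != y by move=> h; apply/eqP=> e; apply: h; rewrite e.
have ab : a != b by apply: ne; rewrite aE bE; lia.
have other (j : 'I_L) : j != a -> j != b -> (k = 2 -> j != c) -> mb la j = mb nu j.
  move=> ja jb jc; apply: rowo; have := ltn_ord j.
  have n1 : nat_of_ord j <> (L - i.+1)%N by rewrite -aE => h; case/eqP: ja; apply: val_inj.
  have n2 : nat_of_ord j <> (L - i.+2)%N by rewrite -bE => h; case/eqP: jb; apply: val_inj.
  have n3 : k = 2 -> nat_of_ord j <> (L - (i + k).+1)%N.
    by rewrite -cE => k2 h; case/eqP: (jc k2); apply: val_inj.
  lia.
have {}e1 := e1 k_gt0.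
have [k1|k_neq1] := eqVneq k 1%N.
  have cb : c = b by apply: val_inj; rewrite /= ; lia.
  have := asym_perm (mb la) (tperm a b) aq; rewrite odd_tperm ab k1 => <-.
  congr (q@__); apply/mnmP=> j; rewrite mnmDE mulmnE mnm1E [RHS]mnmE cb.
  case: tpermP => [->|->|/eqP ja /eqP jb].
  - by rewrite eq_sym (negPf ab) nu_a la_b e1 aE bE; lia.
  - by rewrite eqxx la_a nu_b e0 k1 addn1 aE bE; lia.
  by rewrite eq_sym (negPf jb) addn0 other // k1.
have k2 : k = 2 by lia.
have i2L : (i.+2 < L)%N by lia.
have cE2 : c = (L - i.+3)%N :> nat by rewrite cE; lia.
have [la_c nu_c] := rowe c i.+2 cE2 i2L.
have ac : a != c by apply: ne; rewrite aE cE; lia.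
have bc : b != c by apply: ne; rewrite bE cE; lia.
have {}e2 := e2 ltac:(by rewrite k2).
have := asym_perm (mb la) (tperm a c * tperm b c)%g aq.
rewrite odd_permM !odd_tperm ac bc /= expr0 !mul1r k2 sqrrN expr1n mul1r => <-.
congr (q@__); apply/mnmP=> j; rewrite mnmDE mulmnE mnm1E [RHS]mnmE permM.
case: (tpermP a c j) => [->|->|/eqP ja /eqP jc].
- by rewrite tpermR eq_sym (negPf ac) nu_a la_b e1 aE bE; lia.
- by rewrite tpermD // 1?eq_sym // eqxx la_a nu_c e0 k2 addn2 aE cE2; lia.
have [->|jb] := eqVneq j b.
  by rewrite tpermL eq_sym (negPf bc) nu_b la_c e2 bE cE2; lia.
have bj : b != j by rewrite eq_sym.
have cj : c != j by rewrite eq_sym.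
by rewrite tpermD // (negPf cj) addn0 other.
Qed.

End CharacterValues.

Section HookSums.
Implicit Types (nu la : seq nat) (z : int).

Lemma hook_move_sumn nu la z : is_part nu -> is_part la -> hook_move nu la z ->
  sumn la = (sumn nu + 3)%N.
Proof.
move=> pnu pla h; have [_ sub size3 _ _] : add_hook 3 nu la by apply/add_hookP => //; exists z.
by rewrite -(size_skew sub) size3 addnC.
Qed.

(** An exponent whose target is occupied gives a repetition and hence 0; the others are the moves in
    zs. *)
Lemma add3_moves L (q : {mpoly int[L]}) nu (zs : seq int) (la : int -> seq nat) :
    asym q -> is_part nu -> uniq zs ->
    (forall z, z \in zs -> [/\ is_part (la z), (size (la z) <= L)%N & hook_move nu (la z) z]) ->
    (forall z, inB nu z -> ~~ inB nu (z + 3) -> z \in zs) ->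
  add3 q (mb L nu) = \sum_(z <- zs) (-1) ^+ hook_parity nu z * q@_(mb L (la z)).
Proof.
move=> aq pnu uzs lazs all_zs.
pose zj (j : 'I_L) : int := Posz (mb L nu j) - Posz L.
have zj_in (j : 'I_L) : inB nu (zj j).
  apply/inBP; exists (rev_ord j); rewrite /zj mbE /=; have := ltn_ord j; lia.
transitivity (\sum_(j < L) \sum_(z <- zs | z == zj j) q@_(mb L nu + U_(j) *+ 3)).
  apply: eq_bigr => j _; have [jz|jz] := boolP (zj j \in zs).
    by rewrite -big_filter (filter_pred1_uniq uzs jz) big_seq1.
  rewrite big1_seq => [|z /andP[/eqP -> zz]]; last by rewrite zz in jz.
  have [/inBP[r rE]|no] := boolP (inB nu (zj j + 3)); last first.
    by case/negP: jz; apply: all_zs => //; apply: zj_in.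
  have rj : (r < rev_ord j)%N.
    rewrite ltnNge; apply/negP=> jr; have := nth_part_le pnu jr.
    by move: rE; rewrite /zj mbE /=; have := ltn_ord j; move: jr => /=; lia.
  have rL : (r < L)%N by rewrite (ltn_trans rj) ?ltn_ord.
  have ij : rev_ord (Ordinal rL) != j by apply/eqP=> h; move: rj; rewrite -h rev_ordK ltnn.
  apply: (asym_repeat aq ij); rewrite mnmDE mulmnE mnm1E [RHS]mnmDE mulmnE mnm1E eqxx [j == _]eq_sym (negPf ij).
  move: rE; rewrite /zj !mbE rev_ordK /=; have := ltn_ord j; lia.
rewrite (exchange_big_dep predT) //= big_seq [RHS]big_seq; apply: eq_bigr => z zz.
have [pla laL hz] := lazs z zz.
have [j [jE <-]] := hook_move_coeff aq pnu pla laL hz.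
rewrite (big_pred1 j) // => i; apply/eqP/eqP=> [zi|->]; last by rewrite /zj jE; lia.
by apply: (mb_inj pnu); move: zi; rewrite /zj; lia.
Qed.

Lemma chi_moves n nu (zs : seq int) (la : int -> seq nat) (g : 'S_n) :
    (3 <= n)%N -> is_partn (n - 3) nu -> uniq zs ->
    (forall z, z \in zs -> is_part (la z) /\ hook_move nu (la z) z) ->
    (forall z, inB nu z -> ~~ inB nu (z + 3) -> z \in zs) ->
    3 \notin ctype g ->
  \sum_(z <- zs) (-1) ^+ hook_parity nu z * chi n (la z) g = 0.
Proof.
move=> n3 /andP[pnu /eqP nun] uzs lazs all_zs g3.
have sumla z : z \in zs -> sumn (la z) = n.
  by move=> /lazs[pla h]; rewrite (hook_move_sumn pnu pla h) nun subnK.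
have j0 : 'I_n := Ordinal (leq_trans (isT : 0 < 3)%N n3).
(* With n variables and at most n - 3 parts, the last three rows are empty and have exponents 0, 1,
   2. *)
have m012 : has012 (mb n nu).
  move=> v v3; have vn : (v < n)%N := leq_trans v3 n3.
  exists (Ordinal vn); rewrite mbE nth_default //=.
  by have := size_part_leq pnu; rewrite nun; lia.
have := add3_alternant g3 m012.
rewrite (add3_moves (la := la) (asym_alternant _) pnu uzs _ all_zs); last first.
  move=> z zz; have [pla h] := lazs z zz; split=> //.
  by rewrite (leq_trans (size_part_leq pla)) // sumla.
move/(congr1 (fun x : int => x%:~R : algC)); rewrite rmorph_sum rmorph0 /= => e; rewrite -[RHS]e.
apply: eq_big_seq => z zz; have [pla h] := lazs z zz.
by rewrite rmorphM rmorph_sign (chi_alternant j0 _ (leqnn n) pla (sumla z zz)).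
Qed.

Lemma ctype_dvd n (g : 'S_n) l : l \in ctype g -> (l %| #[g]%g)%N.
Proof.
case/mapP=> B; rewrite mem_enum => /imsetP[x _ ->] ->.
by rewrite porbitE; exact: dvdn_orbit.
Qed.

Lemma chi1_gt0 n la : is_part la -> sumn la = n -> 0 < chi n la 1%g.
Proof. by move=> pla lan; have [i [-> _ _]] := irr_chi pla lan; apply: irr1_gt0. Qed.

End HookSums.

(** * The two constituents of a self-conjugate character *)

Section GaloisConjugation.

(** x is diagonalizable with N-th roots of unity as eigenvalues, and u raises each of them to the
    power k. *)
Lemma char_expg_aut (gT : finGroupType) (G : {group gT}) (chi : 'CF(G)) x N k
    (u : {rmorphism algC -> algC}) :
    chi \is a character -> x \in G -> (x ^+ N = 1)%g ->
    (forall z : algC, z ^+ N = 1 -> u z = z ^+ k) ->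
  chi (x ^+ k)%g = u (chi x).
Proof.
case/char_reprP=> -[f rG] -> Gx xN uE; rewrite [Representation _]/=.
have [e [[B Bu rGx] [eN _] [chix _] _]] := repr_rsim_diag rG Gx.
rewrite /= chix rmorph_sum /=.
have eE i : u (e 0 i) = e 0 i ^+ k.
  apply: uE; have := order_dvdn x N; rewrite xN eqxx => /dvdnP[d ->].
  by rewrite mulnC exprM eN expr1n.
rewrite (eq_bigr _ (fun i _ => eE i)).
have rGxk : rG (x ^+ k)%g = invmx B *m diag_mx (\row_i e 0 i ^+ k) *m B.
  elim: k {uE eE} => [|k IH].
    rewrite expg0 repr_mx1 (_ : \row_i _ = const_mx 1).
      by rewrite diag_const_mx mulmx1 mulVmx.
    by apply/rowP=> i; rewrite !mxE.
  rewrite expgSr repr_mxM ?groupX // IH rGx !mulmxA; congr (_ *m _).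
  rewrite mulmxK // -!mulmxA; congr (_ *m _); rewrite mulmx_diag; congr diag_mx.
  by apply/rowP=> i; rewrite !mxE exprSr.
rewrite cfunE groupX // mulr1n rGxk mxtrace_mulC mulmxA mulmxV // mul1mx mxtrace_diag.
by apply: eq_bigr => i _; rewrite mxE.
Qed.

(* The two constituents are exchanged by a Galois automorphism that inverts
   the cube roots of unity and fixes the roots of unity of order prime to 3:
   it maps the value at h to the value at an odd conjugate of h, and these
   differ because their sum is an odd integer. *)
Lemma alt_split_agree n mu (p m : Iirr (Alt 'I_n)) (h t : 'S_n) M1 :
    alt_split mu p m -> (forall g, chi n mu g \is a Num.int) ->
    h \in Alt 'I_n -> chi n mu h ^+ 2 = 1 -> odd_perm t ->
    coprime M1 3 -> (h ^+ (M1 * 3) = 1)%g ->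
    (forall k, k = 1 %[mod M1] -> k = 2 %[mod 3] -> (h ^+ k = h ^ t)%g) ->
  agree_on_prime_to 3 'chi_p 'chi_m.
Proof.
move=> [pm sumE [s _ mE]] chi_int Ah h2 todd coM1 hM1 hk g Ag g3.
have coM : coprime (M1 * #[g]%g) 3.
  by rewrite coprimeMl coM1 /= coprime_sym prime_coprime.
(* The factor #[g] makes the automorphism fix the values at g as well. *)
set M := (M1 * #[g]%g)%N in coM.
pose k := chinese M 3 1 2.
have kM : k = 1 %[mod M] by rewrite /k chinese_modl.
have k3 : k = 2 %[mod 3] by rewrite /k chinese_modr.
have cokN : coprime k (M * 3).
  rewrite coprimeMr -(coprime_modl k M) kM coprime_modl coprime1n /=.
  by rewrite -(coprime_modl k 3) k3.
have [u uE] := Qn_aut_exists cokN.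
have kM1 : k = 1 %[mod M1].
  have := kM; rewrite /M => e; have M1M : (M1 %| M1 * #[g]%g)%N by rewrite dvdn_mulr.
  by rewrite -(modn_dvdm k M1M) e modn_dvdm.
have kg : k = 1 %[mod #[g]%g].
  have := kM; rewrite /M => e; have gM : (#[g]%g %| M1 * #[g]%g)%N by rewrite dvdn_mull.
  by rewrite -(modn_dvdm k gM) e modn_dvdm.
have hN : (h ^+ (M * 3) = 1)%g by rewrite /M mulnAC expgM hM1 expg1n.
have gN : (g ^+ (M * 3) = 1)%g by rewrite /M mulnAC mulnC expgM expg_order expg1n.
have sumh x : x \in Alt 'I_n -> 'chi_p x + 'chi_m x = chi n mu x.
  move=> Ax; have := congr1 (fun f : 'CF(_) => f x) sumE.
  rewrite /chi_alt cfResE //; last by apply/subsetP=> y _; rewrite inE.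
  by move=> ->; rewrite cfunE.
have s_odd : odd_perm s.
  apply: contraNT pm => s_even; apply/eqP/irr_inj; rewrite mE cfConjg_id //.
  by rewrite Alt_even.
have nAlt y : y \in 'N(Alt 'I_n)%g.
  by rewrite (subsetP (normal_norm (Alt_normal _))) // inE.
have ht : 'chi_p (h ^ t)%g = 'chi_m h.
  rewrite mE cfConjgE //.
  have -> : (h ^ t = (h ^ s^-1) ^ (s * t))%g by rewrite -conjgM mulKg.
  rewrite cfunJ // Alt_even odd_permM s_odd todd //.
have ph_neq : 'chi_p h != 'chi_m h.
  apply/eqP=> e; have := sumh h Ah; rewrite -e => e2.
  have intp : 'chi_p h \is a Num.int.
    apply: Cint_rat_Aint (Aint_irr _ _).
    have -> : 'chi_p h = chi n mu h / 2 by rewrite -e2 -mulr2n -[X in X / _]mulr_natr mulfK ?pnatr_eq0.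
    have /intrP[c ->] := chi_int h; by rewrite rpred_div ?rpred_int ?rpred_nat.
  have /intrP[c cE] := intp.
  have cc1 : (c + c) ^+ 2 = 1 :> int.
    by apply: (@intr_inj algC); rewrite rmorphXn rmorphD /= -cE e2 h2.
  have c4 : (c + c) ^+ 2 = 4 * (c * c) by ring.
  by move: cc1; rewrite c4; move: (c * c) => d; clear; lia.
have [i iE] : exists i, cfAut u 'chi_p = 'chi[Alt 'I_n]_i by exists (aut_Iirr u p); rewrite aut_IirrE.
(* The sum of the two constituents has integer values, so u fixes it and permutes them. *)
have i_pm : (i == p) || (i == m).
  have : '['chi_i, 'chi_p + 'chi_m] != 0.
    have [j jE] : exists j, cfAut u 'chi_m = 'chi[Alt 'I_n]_j.
      by exists (aut_Iirr u m); rewrite aut_IirrE.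
    have -> : 'chi_p + 'chi_m = 'chi_i + 'chi_j.
      rewrite -iE -jE -rmorphD -sumE; apply/cfunP=> x; rewrite [RHS]cfunE.
      have [Ax|nAx] := boolP (x \in Alt 'I_n); last by rewrite cfun0 // rmorph0.
      have /intrP[c cE] := chi_int x.
      rewrite /chi_alt cfResE ?cE ?rmorph_int //.
      by apply/subsetP=> y _; rewrite inE.
    by rewrite cfdotDr !cfdot_irr eqxx -natrD pnatr_eq0.
  by rewrite cfdotDr !cfdot_irr -natrD pnatr_eq0; case: (i == p); case: (i == m).
(* If u fixed the character p, its values at h and h ^ t would agree, contrary to [ph_neq]. *)
case/orP: i_pm => /eqP iE'; rewrite {}iE' in iE.
  case/eqP: ph_neq; rewrite -ht -(hk k kM1 k3).
  rewrite (char_expg_aut (irr_char p) Ah hN uE).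
  by have := congr1 (fun f : 'CF(_) => f h) iE; rewrite cfunE.
have := congr1 (fun f : 'CF(_) => f g) iE; rewrite cfunE => <-.
rewrite -(char_expg_aut (irr_char p) Ag gN uE).
by congr ('chi_p _); rewrite -{1}[g]expg1; apply/eqP; rewrite eq_expg_mod_order kg.
Qed.

End GaloisConjugation.

(** * A permutation with prescribed cycle lengths *)

Section CyclePermutations.
Local Open Scope nat_scope.
Variables (n : nat) (s : seq nat).
Hypothesis sn : sumn s = n.

Local Notation row := (reshape_index s).
Local Notation off := (reshape_offset s).
Local Notation len k := (nth 0 s (row k)).

Lemma off_lt (k : 'I_n) : off k < len k.
Proof. by apply: reshape_offsetP; rewrite sn. Qed.

Lemma rot_lt (k : 'I_n) : flatten_index s (row k) ((off k).+1 %% len k) < n.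
Proof.
have := @flatten_indexP s (row k) ((off k).+1 %% len k); rewrite sn; apply.
by rewrite ltn_mod (leq_ltn_trans _ (off_lt k)).
Qed.

(** Points are numbered block by block along s, and each block is rotated by one step, so that all
    powers are explicit. *)
Definition rot_ord (k : 'I_n) := Ordinal (rot_lt k).

Lemma rot_row k : row (rot_ord k) = row k.
Proof. by rewrite /= flatten_indexKl // ltn_mod (leq_ltn_trans _ (off_lt k)). Qed.

Lemma rot_off k : off (rot_ord k) = (off k).+1 %% len k.
Proof. by rewrite /= flatten_indexKr // ltn_mod (leq_ltn_trans _ (off_lt k)). Qed.

Lemma rot_inj : injective rot_ord.
Proof.
move=> k l kl; have rE : row k = row l by rewrite -rot_row kl rot_row.
apply/val_inj/(@reshape_inj s) => //; have := rot_off k; rewrite kl rot_off -rE => /eqP.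
rewrite -[(off l).+1]addn1 -[(off k).+1]addn1 eqn_modDr.
by have := off_lt k; have := off_lt l; rewrite -rE => lo ko; rewrite !modn_small // => /eqP.
Qed.

Definition rot_perm := perm rot_inj.

Lemma rot_permX e (k : 'I_n) :
  row ((rot_perm ^+ e)%g k) = row k /\ off ((rot_perm ^+ e)%g k) = (off k + e) %% len k.
Proof.
elim: e => [|e [IHr IHo]]; first by rewrite expg0 perm1 addn0 modn_small // off_lt.
rewrite expgSr permM permE rot_row rot_off IHr IHo; split=> //.
by rewrite -addn1 modnDml addn1 addnS.
Qed.

Lemma porbit_rot (k : 'I_n) : porbit rot_perm k = [set l : 'I_n | row l == row k].
Proof.
apply/setP=> l; rewrite inE; apply/porbitP/eqP=> [[e ->]|rE].
  by have [] := rot_permX e k.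
exists (off l + (len k - off k)); apply/val_inj/(@reshape_inj s).
  by have [->] := rot_permX (off l + (len k - off k)) k.
have [_ ->] := rot_permX (off l + (len k - off k)) k.
have := off_lt k; have := off_lt l; rewrite rE => lo ko.
by rewrite (_ : _ + _ = off l + len k); [rewrite modnDr modn_small | lia].
Qed.

Lemma rot_permX_id e : (forall l, l \in s -> l %| e) -> (rot_perm ^+ e = 1)%g.
Proof.
move=> se; apply/permP=> k; rewrite perm1; apply/val_inj/(@reshape_inj s).
  by have [] := rot_permX e k.
have [_ ->] := rot_permX e k.
have /dvdnP[d ->] : len k %| e by apply: se; rewrite mem_nth // reshape_indexP ?sn.
by rewrite addnC modnMDl modn_small ?off_lt.
Qed.

Hypothesis s0 : 0 \notin s.

Lemma ctype_rot : perm_eq (ctype rot_perm) s.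
Proof.
pose R (r : 'I_(size s)) : {set 'I_n} := [set l : 'I_n | row l == r].
have s_gt0 (r : 'I_(size s)) : 0 < nth 0 s r.
  by rewrite lt0n; apply: contraNneq s0 => <-; apply: mem_nth.
have fl_lt (r : 'I_(size s)) : flatten_index s r 0 < n by rewrite -sn flatten_indexP.
have row0 (r : 'I_(size s)) : row (Ordinal (fl_lt r)) = r by rewrite /= flatten_indexKl.
have Rinj : injective R.
  move=> r r' /setP/(_ (Ordinal (fl_lt r))); rewrite !inE row0 eqxx => /esym/eqP e.
  exact: val_inj.
have -> : ctype rot_perm = [seq #|B| | B : {set 'I_n} <- enum (porbits rot_perm)] by [].
have -> : s = [seq #|B| | B : {set 'I_n} <- [seq R r | r <- enum 'I_(size s)]].
  apply: (@eq_from_nth _ 0) => [|i il]; first by rewrite 2!size_map size_enum_ord.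
  rewrite (nth_map set0); last by rewrite size_map size_enum_ord.
  rewrite (nth_map (Ordinal il)); last by rewrite size_enum_ord.
  rewrite -(card_row (n := n) (la := s) i sn); apply: eq_card => l.
  by rewrite !inE nth_enum_ord.
apply/perm_map/uniq_perm; [exact: enum_uniq | by rewrite (map_inj_uniq Rinj) enum_uniq |].
move=> B; rewrite mem_enum; apply/imsetP/mapP=> [[k _ ->]|[r _ ->]].
  have rk : row k < size s by rewrite reshape_indexP ?sn.
  by exists (Ordinal rk); rewrite ?mem_enum // porbit_rot.
by exists (Ordinal (fl_lt r)); rewrite // porbit_rot row0.
Qed.

Lemma odd_rot : all odd s -> ~~ odd_perm rot_perm.
Proof.
move=> s_odd; rewrite /odd_perm card_ord.
have -> : #|porbits rot_perm| = size s by rewrite -(perm_size ctype_rot) size_map -cardE.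
rewrite negb_add -[X in odd X == _]sn; apply/eqP.
have sum_odd s' : all odd s' -> odd (sumn s') = odd (size s').
  by elim: s' => //= m s' IH /andP[m_odd /IH e]; rewrite oddD m_odd e.
exact: sum_odd.
Qed.

Hypotheses (us : uniq s) (s3 : 3 \in s) (only3 : forall l, l \in s -> 3 %| l -> l = 3).

Definition cofactor3 := \prod_(l <- s | l != 3) l.

Lemma dvd_cofactor3 l : l \in s -> l != 3 -> l %| cofactor3.
Proof. by move=> ls l3; rewrite /cofactor3 (big_rem l) //= l3 dvdn_mulr. Qed.

Lemma coprime_cofactor3 : coprime cofactor3 3.
Proof.
rewrite /cofactor3 big_seq_cond; apply: (big_ind (fun m => coprime m 3)) => //.
  by move=> x y cx cy; rewrite coprimeMl cx.
move=> l /andP[ls l3]; rewrite coprime_sym prime_coprime //.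
by apply: contra l3 => /(only3 ls)->.
Qed.

Lemma rot_cofactor3 : (rot_perm ^+ (cofactor3 * 3) = 1)%g.
Proof.
apply: rot_permX_id => l ls; have [->|l3] := eqVneq l 3; first exact: dvdn_mull.
by rewrite dvdn_mulr // dvd_cofactor3.
Qed.

(** The power k is trivial modulo every length other than 3 and inverts the single 3-cycle, as does
    conjugation by a transposition of two of its points. *)
Lemma rot_conj : exists2 t : 'S_n, odd_perm t &
  forall k, k = 1 %[mod cofactor3] -> k = 2 %[mod 3] -> (rot_perm ^+ k = rot_perm ^ t)%g.
Proof.
pose r := index 3 s; have nr : nth 0 s r = 3 by rewrite nth_index.
have lt c : c < 3 -> flatten_index s r c < n by move=> c3; rewrite -sn flatten_indexP ?nr.
pose e c (c3 : c < 3) : 'I_n := Ordinal (lt c c3).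
have rowE c (c3 : c < 3) : row (e c c3) = r by rewrite /= flatten_indexKl ?nr.
have offE c (c3 : c < 3) : off (e c c3) = c by rewrite /= flatten_indexKr ?nr.
pose z := e 0 isT; pose a := e 1 isT; pose b := e 2 isT.
have nab : a != b by apply/eqP=> ab; have := offE 1 isT; rewrite -/a ab offE.
have nza : z != a by apply/eqP=> ab; have := offE 0 isT; rewrite -/z ab offE.
have nzb : z != b by apply/eqP=> ab; have := offE 0 isT; rewrite -/z ab offE.
have eqE (x y : 'I_n) : row x = row y -> off x = off y -> x = y.
  by move=> rE oE; apply/val_inj/(@reshape_inj s).
have hE (x : 'I_n) : row (rot_perm x) = row x /\ off (rot_perm x) = (off x).+1 %% len x.
  by rewrite permE rot_row rot_off.
have hz : rot_perm z = a by have [h1 h2] := hE z; apply: eqE; rewrite ?h1 ?h2 ?rowE ?offE ?nr.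
have ha : rot_perm a = b by have [h1 h2] := hE a; apply: eqE; rewrite ?h1 ?h2 ?rowE ?offE ?nr.
have hb : rot_perm b = z by have [h1 h2] := hE b; apply: eqE; rewrite ?h1 ?h2 ?rowE ?offE ?nr.
have tz : tperm a b z = z by rewrite tpermD // eq_sym.
exists (tperm a b); first by rewrite odd_tperm.
move=> k k1 k2; apply/permP=> x.
have -> : (rot_perm ^ tperm a b)%g x = tperm a b (rot_perm (tperm a b x)).
  by rewrite conjgE tpermV !permM.
have [xr|xr] := eqVneq (row x) r.
  have ox : off x < 3 by have := off_lt x; rewrite xr nr.
  have kx : off ((rot_perm ^+ k)%g x) = (off x + 2) %% 3.
    by have [_ ->] := rot_permX k x; rewrite xr nr -modnDmr k2 modnDmr.
  have kr : row ((rot_perm ^+ k)%g x) = r by have [-> _] := rot_permX k x.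
  have xE : x = e (off x) ox by apply: eqE; rewrite ?rowE ?offE.
  have [x0|[x1|x2]] : off x = 0 \/ off x = 1 \/ off x = 2 by lia.
  - have xz : x = z by apply: eqE; rewrite ?rowE ?offE.
    rewrite [in RHS]xz tz hz tpermL.
    by apply: eqE; rewrite ?kr ?rowE ?kx ?x0 ?offE.
  - have xa : x = a by apply: eqE; rewrite ?rowE ?offE.
    rewrite [in RHS]xa tpermL hb tz.
    by apply: eqE; rewrite ?kr ?rowE ?kx ?x1 ?offE.
  have xb : x = b by apply: eqE; rewrite ?rowE ?offE.
  rewrite [in RHS]xb tpermR ha tpermR.
  by apply: eqE; rewrite ?kr ?rowE ?kx ?x2 ?offE.
have tx (y : 'I_n) : row y != r -> tperm a b y = y.
  by move=> yr; rewrite tpermD //; apply: contraNneq yr => <-; rewrite rowE.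
rewrite (tx x xr); have [h1 h2] := hE x; rewrite tx ?h1 //.
have [k3 k4] := rot_permX k x; apply: eqE; rewrite ?k3 ?k4 ?h1 // h2.
have lx : len x \in s by rewrite mem_nth // reshape_indexP ?sn.
have lx3 : len x != 3.
  by apply: contraNneq xr => e3; rewrite /r -e3 index_uniq // reshape_indexP ?sn.
have kl : k = 1 %[mod len x].
  by rewrite -(modn_dvdm k (dvd_cofactor3 lx lx3)) k1 modn_dvdm // dvd_cofactor3.
by rewrite -modnDmr kl modnDmr addn1.
Qed.
End CyclePermutations.

(** * Self-conjugate partitions and their weights *)

Section BetaSums.
Local Open Scope nat_scope.
Implicit Types (nu la : seq nat) (z : int).

Lemma inB_low nu z : (z < - Posz (size nu))%R -> inB nu z.
Proof. by move=> zlt; apply/inBP; exists (`|z| - 1); rewrite nth_default; lia. Qed.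

Lemma inB_lt nu z : inB nu z -> (z < Posz (sumn nu))%R.
Proof. by case/inBP=> r rE; have := leq_nth_sumn nu r; lia. Qed.

Lemma att_mb L nu v : size nu <= L -> att (mb L nu) v = inB nu (Posz v - Posz L).
Proof.
move=> sL; apply/attP/inBP=> [[j <-]|[r rE]].
  by exists (rev_ord j); rewrite mbE /=; have := ltn_ord j; lia.
have rL : r < L by rewrite ltnNge; apply/negP=> Lr; move: rE; rewrite nth_default; lia.
by exists (rev_ord (Ordinal rL)); rewrite mbE rev_ordK /=; lia.
Qed.

Lemma mb_lt L nu j : sumn nu <= L -> mb L nu j < 2 * L.
Proof. by rewrite mbE; have := leq_nth_sumn nu (rev_ord j); have := ltn_ord j; lia. Qed.

Lemma mb_selfdual L nu : is_part nu -> sumn nu <= L -> conj_part nu = nu -> selfdual (mb L nu).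
Proof.
move=> pnu nuL cnu; split=> [i|v vL]; first exact: mb_lt.
have sL : size nu <= L := leq_trans (size_part_leq pnu) nuL.
by rewrite !att_mb // -[in LHS]cnu inB_conj //; congr (~~ inB nu _); lia.
Qed.

Lemma sum_inB L nu : is_part nu -> sumn nu <= L ->
  \sum_(0 <= v < 2 * L) inB nu (Posz v - Posz L) * v = sumn nu + 'C(L, 2).
Proof.
move=> pnu nuL; have sL : size nu <= L := leq_trans (size_part_leq pnu) nuL.
rewrite -(sum_beta sL).
transitivity (\sum_(j < L) \sum_(0 <= v < 2 * L | v == mb L nu j) v); last first.
  apply: eq_bigr => j _; rewrite -big_filter filter_pred1_uniq ?iota_uniq //.
    by rewrite big_seq1 mnmE.
  by rewrite mem_index_iota /= mb_lt.
rewrite (exchange_big_dep predT) //=; apply: eq_bigr => v _.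
rewrite -att_mb // sum_nat_const; case: attP => [[j <-]|no].
  rewrite mul1n -[LHS]mul1n; congr (_ * _).
  by rewrite (eq_card1 (x := j)) // => i; rewrite !inE; apply/eqP/eqP=> [/esym/(mb_inj pnu)|->].
rewrite mul0n (_ : #|_| = 0) ?mul0n //; apply: eq_card0 => i; rewrite !inE.
by apply/eqP=> e; case: no; exists i.
Qed.

(** Exactly one of w and -1 - w is encoded. Compared with the empty partition, having w instead of
    -1 - w adds 2 w + 1, a diagonal hook length. *)
Lemma sumn_selfconj L nu : is_part nu -> sumn nu <= L -> conj_part nu = nu ->
  sumn nu = \sum_(0 <= w < L) inB nu (Posz w) * (2 * w + 1).
Proof.
move=> pnu nuL cnu; apply/eqP; rewrite -(eqn_add2r 'C(L, 2)) -(sum_inB pnu nuL) -bin2_sum.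
have shift (F : nat -> nat) : \sum_(L <= v < L + L) F v = \sum_(0 <= v < L) F (v + L).
  by rewrite -{1}[L]add0n big_addn addnK.
rewrite mulSn mul1n (big_cat_nat (n := L)) //= ?leq_addr // shift.
rewrite [X in (X + _ == _)%N]big_nat_rev [X in _ == _ + X]big_nat_rev /= -!big_split /=; apply/eqP.
apply: eq_big_nat => w wL; rewrite -{1}cnu inB_conj //.
rewrite (_ : -1 - _ = Posz w)%R; last lia.
rewrite (_ : Posz (w + L) - _ = Posz w)%R; last lia.
case: (inB nu w); lia.
Qed.

(** The nonnegative encoded integers determine a self-conjugate partition, and its size is a sum of
    positive weights over them, so an inclusion between equal sizes is an equality. *)
Lemma selfconj_sub_eq nu1 nu2 : is_part nu1 -> is_part nu2 ->
    conj_part nu1 = nu1 -> conj_part nu2 = nu2 -> sumn nu1 = sumn nu2 ->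
    (forall w : nat, inB nu1 w -> inB nu2 w) -> nu1 = nu2.
Proof.
move=> p1 p2 c1 c2 e12 sub; apply: inB_ext => //.
have nat_eq (w : nat) : inB nu1 w = inB nu2 w.
  have [wl|lw] := ltnP w (sumn nu1); last first.
    by apply/idP/idP=> /inB_lt; rewrite -?e12; lia.
  have e := sumn_selfconj p2 (leq_addr w.+1 (sumn nu2)) c2.
  move: (sumn_selfconj p1 (leq_addr w.+1 (sumn nu1)) c1); rewrite e12 [in LHS]e.
  rewrite !big_mkord => /eqP; rewrite eq_sym; move=> /eqP eqs.
  have le (i : 'I_(sumn nu2 + w.+1)) : true ->
      inB nu1 i * (2 * i + 1) <= inB nu2 i * (2 * i + 1) ?= iff
      (inB nu1 i * (2 * i + 1) == inB nu2 i * (2 * i + 1)).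
    by move=> _; split=> //; case b1: (inB nu1 i) => //; rewrite sub.
  have [_] := leqif_sum le; rewrite eqs eqxx => /esym/forallP.
  have wl' : w < sumn nu2 + w.+1 by lia.
  by move/(_ (Ordinal wl'))/eqP => /=; case: (inB nu1 w); case: (inB nu2 w) => //; lia.
case=> w; first exact: nat_eq.
rewrite -c1 -c2 !inB_conj // (_ : -1 - Negz w = Posz w)%R; last lia.
by rewrite nat_eq.
Qed.

End BetaSums.

(** * Residue classes modulo 3 of the encoding *)

Section Runners.
Local Open Scope nat_scope.
Implicit Types (nu la : seq nat) (z : int).

(** The number of encoded integers congruent to rho in the window from -3 M to 3 M - 1; the shift by
    3 M preserves residues. *)
Definition runner_count M nu rho :=
  \sum_(0 <= k < 2 * M) inB nu (Posz (3 * k + rho) - Posz (3 * M)).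

(** A move by 3 stays in its class, and the window contains both of its ends. *)
Lemma runner_count_move M nu la z rho : is_part nu -> is_part la -> rho < 3 ->
    sumn la <= 3 * M -> hook_move nu la z ->
  runner_count M la rho = runner_count M nu rho.
Proof.
move=> pnu pla rho3 laM h; have e := hook_move_sumn pnu pla h; case: h => nz nz3 laz.
have zlo : (- Posz (3 * M) <= z)%R.
  rewrite leNgt; apply: contra nz3 => zM; apply: inB_low; have := size_part_leq pnu; lia.
have zhi : (z + 3 < Posz (3 * M))%R.
  by have /inB_lt : inB la (z + 3) by [rewrite laz eqxx orbT]; lia.
pose x k := (Posz (3 * k + rho) - Posz (3 * M))%R.
have shift : \sum_(0 <= k < 2 * M) (x k == z) = \sum_(0 <= k < 2 * M) (x k == z + 3)%R :> nat.
  case: M @x laM zlo zhi => [|M] x laM zlo zhi; first by rewrite !big_geq.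
  rewrite mulnS add2n big_nat_recr // [RHS]big_nat_recl //= addnC.
  rewrite (_ : (x _ == z) = false) 1?(_ : (x 0 == _) = false); rewrite /x; try by apply/eqP; lia.
  by rewrite !add0n; apply: eq_bigr => k _; congr nat_of_bool; apply/eqP/eqP; lia.
apply/eqP; rewrite -(eqn_add2r (\sum_(0 <= k < 2 * M) (x k == z))) {2}shift -!big_split /=.
apply/eqP/eq_bigr => k _; rewrite -/(x k) laz.
have [->|_] := eqVneq (x k) z; last by rewrite andbT; have [->|_] := eqVneq; rewrite ?orbF // (negPf nz3).
by rewrite nz andbF (_ : (z == z + 3) = false)%R //; apply/eqP; lia.
Qed.

(** z -> -1 - z preserves the class of 1 and exchanges those of 0 and 2. *)
Lemma runner_count_conj M nu : is_part nu -> conj_part nu = nu ->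
  [/\ runner_count M nu 1 = M & runner_count M nu 0 + runner_count M nu 2 = 2 * M].
Proof.
move=> pnu cnu; have dual rho : rho < 3 -> runner_count M nu rho + runner_count M nu (2 - rho) = 2 * M.
  move=> rho3; rewrite {2}/runner_count big_nat_rev -big_split /= -[RHS]subn0 -[RHS]muln1 -sum_nat_const_nat.
  apply: eq_big_nat => k kM; rewrite -{1}cnu inB_conj //.
  rewrite (_ : -1 - _ = Posz (3 * (0 + 2 * M - k.+1) + (2 - rho)) - Posz (3 * M))%R; last lia.
  by case: inB.
by have := dual 0 isT; have := dual 1 isT; rewrite subn0 subn1 /= => d1 d0; split; lia.
Qed.

Lemma decr_threshold (P : pred nat) K : (forall k, P k.+1 -> P k) -> ~~ P K ->
  exists2 t, t <= K & forall k, P k = (k < t).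
Proof.
move=> dec PK; case: (ex_minnP (ex_intro (fun k => ~~ P k) K PK)) => t Pt tmin.
exists t; first exact: tmin.
move=> k; apply/idP/idP=> [Pk|kt]; last by apply: contraLR kt => nP; rewrite -leqNgt tmin.
rewrite ltnNge; apply: contra Pt => /subnK e; move: Pk; rewrite -e.
by elim: (k - t) => // d IH; rewrite addSn => /dec.
Qed.

Lemma sum_by_runner (F : nat -> nat) K :
  \sum_(0 <= v < 3 * K) F v =
  \sum_(0 <= k < K) F (3 * k) + \sum_(0 <= k < K) F (3 * k + 1) + \sum_(0 <= k < K) F (3 * k + 2).
Proof.
elim: K => [|K IH]; first by rewrite !big_geq.
rewrite mulnS add3n !big_nat_recr //= IH; rewrite addn1 addn2; lia.
Qed.

Lemma sum_initial (F : nat -> nat) t K : t <= K ->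
  \sum_(0 <= k < K) (if k < t then F k else 0) = \sum_(0 <= k < t) F k.
Proof.
move=> tK; rewrite (big_cat_nat (n := t)) //= [X in _ + X]big_nat_cond [X in _ + X]big1 ?addn0.
  by apply: eq_big_nat => k /= ->.
by move=> k /andP[/andP[tk _] _]; rewrite ltnNge tk.
Qed.

Definition flush nu := forall z, inB nu z -> inB nu (z - 3)%R.

Lemma bin2_double m : 'C(m, 2) * 2 + m = m * m.
Proof. by elim: m => // m IH; rewrite binS bin1; lia. Qed.

(** Each class is an initial segment, the exponents 3 k + rho with k below its count; both sides are
    the sum of all exponents. *)
Lemma core_sum M nu : is_part nu -> sumn nu <= 3 * M -> flush nu ->
  sumn nu + 'C(3 * M, 2) =
  3 * ('C(runner_count M nu 0, 2) + 'C(runner_count M nu 1, 2) + 'C(runner_count M nu 2, 2))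
  + runner_count M nu 1 + 2 * runner_count M nu 2.
Proof.
move=> pnu nuM fl; rewrite -(sum_inB pnu nuM) mulnCA sum_by_runner.
have run rho : rho < 3 ->
    \sum_(0 <= k < 2 * M) inB nu (Posz (3 * k + rho) - Posz (3 * M)) * (3 * k + rho) =
    3 * 'C(runner_count M nu rho, 2) + rho * runner_count M nu rho.
  move=> rho3; have [||t tM tE] := @decr_threshold (fun k => inB nu (Posz (3 * k + rho) - Posz (3 * M))) (2 * M).
  - by move=> k /fl; congr inB; lia.
  - by apply/negP => /inB_lt; lia.
  have cE : runner_count M nu rho = t.
    rewrite /runner_count (eq_bigr (fun k => if k < t then 1 else 0)) => [|k _]; last by rewrite tE.
    by rewrite sum_initial // sum_nat_const_nat; lia.
  rewrite cE (eq_bigr (fun k => if k < t then 3 * k + rho else 0)) => [|k _]; last first.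
    by rewrite tE; case: (k < t); lia.
  rewrite sum_initial // big_split /= -big_distrr /= bin2_sum sum_nat_const_nat; lia.
have r0 : \sum_(0 <= k < 2 * M) inB nu (Posz (3 * k) - Posz (3 * M)) * (3 * k) =
    3 * 'C(runner_count M nu 0, 2).
  rewrite -[RHS]addn0 -[X in _ = _ + X](mul0n (runner_count M nu 0)) -run //.
  by apply: eq_bigr => k _; rewrite addn0.
rewrite r0 !run //; lia.
Qed.

End Runners.

(** * Uniqueness for given size and weight *)

Section WeightUnique.
Local Open Scope nat_scope.
Implicit Types (nu la : seq nat) (z : int).

Definition flush_but1 nu := forall z, inB nu z -> inB nu (z - 3)%R \/ z = 1.

(** The difference of the two sides factors as x - y times 6 (x + y) - 12 M - 4, and the second
    factor is nonzero modulo 6. *)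
Lemma count_sum_inj M x x' y y' : x + x' = 2 * M -> y + y' = 2 * M ->
    3 * ('C(x, 2) + 'C(M, 2) + 'C(x', 2)) + M + 2 * x' =
    3 * ('C(y, 2) + 'C(M, 2) + 'C(y', 2)) + M + 2 * y' -> x = y.
Proof.
have sq a a' : a + a' = 2 * M -> a' * a' + 4 * (M * a) = 4 * (M * M) + a * a.
  move=> e; have aE : Posz a' = (2 * Posz M - Posz a)%R by lia.
  by apply/eqP; rewrite -eqz_nat !PoszD !PoszM aE; apply/eqP; ring.
move=> ex ey h; have sx := sq _ _ ex; have sy := sq _ _ ey.
have := bin2_double x; have := bin2_double x'; have := bin2_double y; have := bin2_double y'.
move: ('C(x, 2)) ('C(x', 2)) ('C(y, 2)) ('C(y', 2)) h => a a2 b b2 h g1 g2 g3 g4.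
have : ((Posz x - Posz y) * (6 * (Posz x + Posz y) - 12 * Posz M - 4) = 0)%R by lia.
by move/eqP; rewrite mulf_eq0 => /orP[]/eqP; lia.
Qed.

Lemma has_weight_core nu w : has_weight 3 nu w ->
  exists ka, [/\ is_part ka, is_core 3 ka, sumn nu = sumn ka + 3 * w &
    forall M rho, rho < 3 -> sumn nu <= 3 * M -> runner_count M ka rho = runner_count M nu rho].
Proof.
elim=> {nu w} [ka pka cka|nu la w ah _ [ka [pka cka e cnt]]].
  by exists ka; split; rewrite ?addn0.
have [[pnu pla] _ _ _ _] := ah; have [z h] := (proj1 (add_hookP pnu pla)) ah.
have e' := hook_move_sumn pnu pla h.
exists ka; split=> // [|M rho rho3 laM]; first by rewrite e' e; lia.
by rewrite cnt ?(runner_count_move pnu pla rho3 laM h) //; lia.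
Qed.

Lemma runner_comparable (P1 P2 : pred nat) K :
    (forall k, P1 k.+1 -> P1 k) -> (forall k, P2 k.+1 -> P2 k) -> ~~ P1 K -> ~~ P2 K ->
  (forall k, P1 k -> P2 k) \/ (forall k, P2 k -> P1 k).
Proof.
move=> d1 d2 n1 n2; have [t1 _ e1] := decr_threshold d1 n1; have [t2 _ e2] := decr_threshold d2 n2.
case: (leqP t1 t2) => t12; [left | right] => k; rewrite e1 e2 => kt; lia.
Qed.

Lemma runner_count_eq M nu1 nu2 : is_part nu1 -> is_part nu2 ->
    sumn nu1 <= 3 * M -> sumn nu2 <= 3 * M -> flush_but1 nu1 -> flush_but1 nu2 ->
    runner_count M nu1 0 = runner_count M nu2 0 ->
  forall k : nat, inB nu1 (Posz (3 * k) - Posz (3 * M)) = inB nu2 (Posz (3 * k) - Posz (3 * M)).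
Proof.
move=> p1 p2 s1 s2 f1 f2 e k.
have run nu : is_part nu -> sumn nu <= 3 * M -> flush_but1 nu ->
    exists2 t, t <= 2 * M & forall k, inB nu (Posz (3 * k + 0) - Posz (3 * M)) = (k < t).
  move=> pnu nuM fl; apply: decr_threshold => [j /fl[]|]; first by congr inB; lia.
    by lia.
  by apply/negP => /inB_lt; lia.
have [t1 tM1 e1] := run _ p1 s1 f1; have [t2 tM2 e2] := run _ p2 s2 f2.
have cE nu t : t <= 2 * M -> (forall k, inB nu (Posz (3 * k + 0) - Posz (3 * M)) = (k < t)) ->
    runner_count M nu 0 = t.
  move=> tM te; rewrite /runner_count (eq_bigr (fun k => if k < t then 1 else 0)) => [|j _]; last by rewrite te.
  by rewrite sum_initial // sum_nat_const_nat; lia.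
move: e; rewrite (cE _ _ tM1 e1) (cE _ _ tM2 e2) => t12.
by have := e1 k; rewrite t12 -e2 addn0.
Qed.

(** Equal weights give cores of equal size, hence equal counts, which fix class 0 and by duality
    class 2. In class 1 the only possible gap is at -2, so the nonnegative parts are initial
    segments; one contains the other, and [selfconj_sub_eq] concludes. *)
Lemma weight_unique nu1 nu2 w : is_part nu1 -> is_part nu2 -> sumn nu1 = sumn nu2 ->
    conj_part nu1 = nu1 -> conj_part nu2 = nu2 -> flush_but1 nu1 -> flush_but1 nu2 ->
    (forall ka, is_part ka -> is_core 3 ka -> flush ka) ->
    has_weight 3 nu1 w -> has_weight 3 nu2 w -> nu1 = nu2.
Proof.
move=> p1 p2 s12 c1 c2 f1 f2 core_flush.
move=> /has_weight_core[k1 [pk1 /(core_flush _ pk1) fk1 sk1 rk1]].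
move=> /has_weight_core[k2 [pk2 /(core_flush _ pk2) fk2 sk2 rk2]].
pose M := sumn nu1; have nM1 : sumn nu1 <= 3 * M by rewrite /M; lia.
have nM2 : sumn nu2 <= 3 * M by rewrite -s12.
have count0 : runner_count M nu1 0 = runner_count M nu2 0.
  have := core_sum pk1 (M := M) _ fk1; have := core_sum pk2 (M := M) _ fk2.
  rewrite !rk1 ?rk2 //; have [-> ] := runner_count_conj M p1 c1; have [-> ] := runner_count_conj M p2 c2.
  have k12 : sumn k1 = sumn k2 by lia.
  move=> e1 e2; rewrite k12 => h2; rewrite h2; last lia.
  move/(_ ltac:(lia)); move: e1 e2.
  by move=> ey ex h; apply: (count_sum_inj ex ey).
have run0 := runner_count_eq p1 p2 nM1 nM2 f1 f2 count0.
have zero k : inB nu1 (Posz (3 * k)) = inB nu2 (Posz (3 * k)).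
  by have := run0 (k + M); congr (_ = _); congr inB; lia.
have two k : inB nu1 (Posz (3 * k + 2)) = inB nu2 (Posz (3 * k + 2)).
  have [kM|Mk] := ltnP k M; last by apply/idP/idP=> /inB_lt; lia.
  rewrite -c1 -c2 !inB_conj //; have := run0 (M - k.+1).
  by rewrite (_ : Posz (3 * _) - _ = -1 - Posz (3 * k + 2))%R => [->|]; lia.
pose R nu k := inB nu (Posz (3 * k + 1)).
have dec nu : flush_but1 nu -> forall k, R nu k.+1 -> R nu k.
  by move=> fl k /fl[|]; [congr inB; lia | lia].
have hi nu : sumn nu <= 3 * M -> ~~ R nu M by move=> h; apply/negP=> /inB_lt; lia.
have res v : exists k, [\/ v = 3 * k, v = 3 * k + 1 | v = 3 * k + 2].
  exists (v %/ 3); have := ltn_mod v 3; have := divn_eq v 3.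
  by case: (v %% 3) => [|[|[|r]]] // e _; [constructor 1 | constructor 2 | constructor 3]; lia.
case: (runner_comparable (dec _ f1) (dec _ f2) (hi _ nM1) (hi _ nM2)) => sub; last apply: esym;
  apply: selfconj_sub_eq => // v; have [k [->|->|->]] := res v; rewrite ?zero ?two //; exact: sub.
Qed.
End WeightUnique.

Lemma chi_int n la (g : 'S_n) : (0 < n)%N -> is_part la -> sumn la = n -> chi n la g \is a Num.int.
Proof.
by move=> n0 pla lan; rewrite (chi_alternant (Ordinal n0) g (leqnn n) pla lan) intr_int.
Qed.

Definition diag_hooks n mu : seq nat := [seq (2 * w + 1)%N | w <- iota 0 n & inB mu (Posz w)].

Lemma chi_diag_hooks n mu (g : 'S_n) : (0 < n)%N -> is_part mu -> sumn mu = n ->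
  conj_part mu = mu -> perm_eq (ctype g) (diag_hooks n mu) -> chi n mu g ^+ 2 = 1.
Proof.
move=> n0 pmu mun cmu pg.
have mun' : (sumn mu <= n)%N by rewrite mun.
rewrite (chi_alternant (Ordinal n0) g (leqnn n) pmu mun) -rmorphXn /=.
have -> : alternant n (ctype g) = vdm n * \prod_(i | (n <= mb n mu i)%N) pw n (2 * (mb n mu i - n) + 1).
  rewrite /alternant (perm_big _ pg) /= big_map big_filter; congr (_ * _).
  transitivity (\prod_(i < n | (n <= mb n mu i)%N)
      \prod_(w <- iota 0 n | inB mu (Posz w) && (w == mb n mu i - n)%N) pw n (2 * w + 1)).
    rewrite (exchange_big_dep (fun w => inB mu (Posz w))) /= => [|i w _ /andP[] //].
    rewrite big_seq_cond [RHS]big_seq_cond; apply: eq_bigr => w /andP[wn bw].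
    move: wn; rewrite mem_iota /= add0n => wn.
    have /attP[i iE] : att (mb n mu) (w + n).
      by rewrite att_mb ?(leq_trans (size_part_leq pmu)) // (_ : _ - _ = Posz w); lia.
    rewrite (big_pred1 i) // => k; rewrite bw /=; apply/idP/eqP=> [/andP[nk /eqP wE]|->].
      by apply: (mb_inj pmu); lia.
    by rewrite iE; lia.
  apply: eq_bigr => i ni; have hi := mb_lt i mun'.
  have bi : inB mu (Posz (mb n mu i - n)).
    have /attP : exists k, mb n mu k = mb n mu i by exists i.
    by rewrite att_mb ?(leq_trans (size_part_leq pmu)) //; congr inB; lia.
  rewrite -big_filter (eq_filter (a2 := pred1 (mb n mu i - n)%N)) => [|w /=]; last first.
    by case: eqP => [->|]; rewrite ?bi ?andbF.
  by rewrite filter_pred1_uniq ?iota_uniq ?big_seq1 // mem_iota add0n; lia.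
by rewrite alternant_selfdual //; [exact: mb_inj | exact: mb_selfdual].
Qed.

(** 2 w + 1 is divisible by 3 exactly for w = 1 mod 3, so 3 is the only diagonal hook length
    divisible by 3, as [rot_conj] requires. *)
Lemma alt_split_diag3 n mu (p m : Iirr (Alt 'I_n)) : (0 < n)%N -> is_part mu -> sumn mu = n ->
    conj_part mu = mu -> inB mu 1 -> (forall z, 0 <= z -> inB mu (3 * z + 1) -> z = 0) ->
    alt_split mu p m -> agree_on_prime_to 3 'chi_p 'chi_m.
Proof.
move=> n0 pmu mun cmu b1 b4 split_mu; pose s := diag_hooks n mu.
have sn : sumn s = n.
  rewrite -[RHS]mun (sumn_selfconj pmu (L := n)) ?mun // /s /diag_hooks sumnE big_map big_filter.
  by rewrite /index_iota subn0 big_mkcond; apply: eq_bigr => w _; case: inB; rewrite ?mul1n.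
have s_odd : all odd s by apply/allP=> l /mapP[w _ ->]; lia.
have s0 : 0%N \notin s by apply/negP=> /(allP s_odd).
have us : uniq s by rewrite map_inj_uniq ?filter_uniq ?iota_uniq // => x y; lia.
have s3 : 3 \in s.
  apply/mapP; exists 1%N => //; rewrite mem_filter b1 mem_iota /= add0n.
  by have := inB_lt b1; rewrite mun.
have only3 l : l \in s -> (3 %| l)%N -> l = 3.
  case/mapP=> w; rewrite mem_filter => /andP[bw _] -> /dvdnP[k kE].
  have := b4 (Posz (w %/ 3)) isT; rewrite (_ : 3 * _ + 1 = Posz w); last lia.
  by move/(_ bw); lia.
have [t todd tk] := rot_conj sn s0 us s3.
have c3 := coprime_cofactor3 only3; have r3 := rot_cofactor3 sn.
apply: (alt_split_agree (h := rot_perm sn) split_mu _ _ _ todd c3 r3 tk).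
- by move=> g; apply: chi_int.
- by rewrite Alt_even odd_rot.
by apply: chi_diag_hooks => //; apply: ctype_rot.
Qed.

(** * 3-hooks and addable positions of self-conjugate partitions *)

Section HooksOfSelfConjugate.
Implicit Types (nu la : seq nat) (z : int).

(** Outside the diagram the left side is at most i + j, so the equation also contains the membership
    of the box. *)
Lemma mem_hooks h nu i j : is_part nu -> (0 < h)%N ->
  ((i, j) \in hooks h nu) = (nth 0 nu i + nth 0 (conj_part nu) j == i + j + h.+1)%N.
Proof.
move=> pnu h0; rewrite mem_filter mem_boxes /hook_length /=; have := nth_conj i j pnu.
case: (ltnP j (nth 0%N nu i)) => jn ijn; first by rewrite andbT; apply/eqP/eqP; lia.
by rewrite andbF; apply/esym/eqP; lia.
Qed.

Lemma hook3_ex nu z : is_part nu -> inB nu z -> ~~ inB nu (z - 3) ->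
  exists i j, (i, j) \in hooks 3 nu /\ Posz (nth 0%N nu i) = z + Posz i + 1.
Proof.
move=> pnu /inBP[i iE]; rewrite (_ : z - 3 = - 1 - (2 - z)); last lia.
by rewrite -inB_conj // => /inBP[j jE]; exists i, j; split; rewrite ?mem_hooks //; lia.
Qed.

Lemma core_flush nu : is_part nu -> is_core 3 nu -> flush nu.
Proof.
move=> pnu /eqP core z zB; apply: contraT => /(hook3_ex pnu zB)[i [j []]].
by rewrite core.
Qed.

Lemma hooks_conj nu i j : is_part nu -> conj_part nu = nu ->
  ((i, j) \in hooks 3 nu) = ((j, i) \in hooks 3 nu).
Proof. by move=> pnu cnu; rewrite !mem_hooks // cnu addnC [(i + j)%N]addnC. Qed.

(** Conjugation permutes the 3-hooks, so a single one lies at some (i, i); there nu_i = i + 2, which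
    encodes the integer 1. *)
Lemma unique_hookP nu : is_part nu -> conj_part nu = nu -> unique_hook 3 nu ->
  [/\ inB nu 1, flush_but1 nu & {in hooks 3 nu, forall b, b.1 = b.2}].
Proof.
move=> pnu cnu; rewrite /unique_hook.
have mh := mem_hooks _ _ pnu (isT : 0 < 3)%N; have hc i j := hooks_conj i j pnu cnu.
have ex z := hook3_ex (z := z) pnu.
case: (hooks 3 nu) mh hc ex => [|[i j] [|]] //= mh hc ex _.
have ij : i = j by have := hc i j; rewrite !inE eqxx => /esym/eqP[].
subst j; have := mh i i; rewrite inE eqxx cnu => /esym iE.
have one : Posz (nth 0%N nu i) = 1 + Posz i + 1 by lia.
split; first by apply/inBP; exists i.
  move=> z zB; have [z3|nz3] := boolP (inB nu (z - 3)); first by left.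
  have [i' [j' []]] := ex z zB nz3; rewrite inE => /eqP[-> _]; right; lia.
by move=> b; rewrite inE => /eqP ->.
Qed.

Definition addable nu z := inB nu z && ~~ inB nu (z + 3).

Lemma addable_dual nu z : is_part nu -> conj_part nu = nu ->
  addable nu (- 4 - z) = addable nu z.
Proof.
move=> pnu cnu; rewrite /addable andbC -{1 2}cnu !inB_conj // negbK.
by congr (inB nu _ && ~~ inB nu _); lia.
Qed.

Lemma addable_above nu z : inB nu z -> exists k : nat, addable nu (z + 3 * Posz k).
Proof.
move=> zB; have ex : exists k : nat, ~~ inB nu (z + 3 * Posz k).
  by exists (`|z| + sumn nu)%N; apply/negP=> /inB_lt; lia.
case: (ex_minnP ex) => -[|k] nk kmin; first by rewrite mulr0 addr0 zB in nk.
exists k; rewrite /addable (_ : z + 3 * Posz k + 3 = z + 3 * Posz k.+1) ?nk; last lia.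
by rewrite andbT; apply: contraT => /kmin; rewrite ltnn.
Qed.

Lemma chain_down nu z (k : nat) :
    (forall j : nat, inB nu (z + 3 * Posz j.+1) -> inB nu (z + 3 * Posz j)) ->
  inB nu (z + 3 * Posz k) -> inB nu z.
Proof.
move=> down; elim: k => [|k IH]; first by rewrite mulr0 addr0.
by move/down/IH.
Qed.

Lemma addable_uniq nu z z' : addable nu z -> inB nu z' -> z < z' -> (exists k, z' = z + 3 * k) ->
    (forall j : nat, inB nu (z + 3 + 3 * Posz j.+1) -> inB nu (z + 3 + 3 * Posz j)) -> False.
Proof.
case/andP=> zB /negP nz3 z'B zz' [k kE] down; apply: nz3.
by apply: (chain_down (k := `|k| - 1) down); rewrite (_ : _ + _ = z') //; lia.
Qed.

Lemma mod3_cases z : exists k, [\/ z = 3 * k, z = 3 * k + 1 | z = 3 * k + 2].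
Proof.
exists (z %/ 3)%Z; have := divz_eq z 3; have := modz_ge0 z (isT : (3 : int) != 0).
have := ltz_pmod z (isT : (0 : int) < 3); case: (z %% 3)%Z => [[|[|[|r]]]|r] // _ _ ->;
  [constructor 1 | constructor 2 | constructor 3]; lia.
Qed.

Section Core.
Variable nu : seq nat.
Hypotheses (pnu : is_part nu) (cnu : conj_part nu = nu) (fnu : flush nu).

Lemma flush_down z (k : nat) : inB nu (z + 3 * Posz k) -> inB nu z.
Proof. by apply: chain_down => j /fnu; congr inB; lia. Qed.

(** Exactly one of 1 and its dual -2 is encoded, and 1 would require -2. *)
Lemma flush1 : ~~ inB nu 1 /\ inB nu (- 2).
Proof.
have e : inB nu (- 2) = ~~ inB nu 1 by rewrite -[in LHS]cnu inB_conj //; congr (~~ inB nu _).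
have n1 : ~~ inB nu 1 by apply/negP=> b1; have := fnu b1; rewrite (_ : 1 - 3 = - 2 :> int) // e b1.
by split; rewrite ?e.
Qed.

Definition top : int := Posz (nth 0%N nu 0) - 1.

Lemma inB_le_top z : inB nu z -> z <= top.
Proof. by case/inBP=> r rE; have := nth_part_le pnu (leq0n r); rewrite /top; lia. Qed.

Lemma addable_top : addable nu top.
Proof.
apply/andP; split; first by apply/inBP; exists 0%N; rewrite /top; lia.
by apply/negP=> /inB_le_top; lia.
Qed.

Lemma top_mod : forall k, top != 3 * k + 1.
Proof.
move=> k; apply/eqP=> e; have [n1 _] := flush1; case/negP: n1.
have [b _] := andP addable_top; apply: (flush_down (k := `|k|)); move: b; congr inB.
by rewrite e; move: e; rewrite /top; lia.
Qed.

Lemma addable_core z : addable nu z = (z \in [:: top; - 2; - 4 - top]).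
Proof.
have [n1 b2] := flush1; have at0 := addable_top; have tm := top_mod.
have ad2 : addable nu (- 2) by rewrite /addable b2.
have ad4 : addable nu (- 4 - top) by rewrite addable_dual.
have eqz x y : addable nu x -> addable nu y -> (exists k, x = y + 3 * k) -> x = y.
  have aux x' y' : addable nu x' -> addable nu y' -> (exists k, y' = x' + 3 * k) -> x' < y' -> False.
    move=> ax ay e lt; apply: (addable_uniq ax _ lt e); first by case/andP: ay.
    by move=> j /fnu; congr inB; lia.
  move=> ax ay [k kE]; case: (ltgtP x y) => // lt; exfalso.
    by apply: (aux x y) => //; exists (- k); lia.
  by apply: (aux y x) => //; exists k.
apply/idP/idP=> [az|]; last by rewrite !inE => /or3P[]/eqP->.
have [k zk] := mod3_cases z; have [l tl] := mod3_cases top; rewrite !inE.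
have tl1 := tm l; apply/or3P.
have [e|[e|e]] : (exists k, z = top + 3 * k) \/ (exists k, z = - 2 + 3 * k) \/ (exists k, z = - 4 - top + 3 * k).
  case: zk => zE; case: tl => tE; first
    [ by rewrite tE eqxx in tl1
    | by left; exists (k - l); lia
    | by right; left; exists (k + 1); lia
    | by right; right; exists (k + l + 2); lia ].
- by constructor 1; apply/eqP/eqz.
- by constructor 2; apply/eqP/eqz.
by constructor 3; apply/eqP/eqz.
Qed.
End Core.

Section UniqueHook.
Variable nu : seq nat.
Hypotheses (pnu : is_part nu) (cnu : conj_part nu = nu) (b1 : inB nu 1) (fnu : flush_but1 nu).

(** Class 0 gives za and class 2 its dual. The self-dual class is broken at -2 and gives zb >= 1
    together with the dual of zb, below -2. *)
Lemma addable_but1 : exists za zb : int,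
  uniq [:: za; - 4 - za; zb; - 4 - zb] /\
  forall z, addable nu z = (z \in [:: za; - 4 - za; zb; - 4 - zb]).
Proof.
have nb2 : ~~ inB nu (- 2) by rewrite -cnu inB_conj // negbK (_ : - 1 - - 2 = 1).
(* The starting point is a multiple of 3 below -size nu, hence encoded. *)
have [ka] := addable_above (@inB_low nu (3 * (- Posz (size nu) - 1)) ltac:(lia)).
have [kb] := addable_above b1.
set zb := 1 + _; set za := 3 * _ + _ => atb ata.
have aux x y : addable nu x -> addable nu y -> (exists k, y = x + 3 * k) ->
    (1 <= x \/ forall k, x != 3 * k + 1) -> x < y -> False.
  move=> ax ay e x1 lt; apply: (addable_uniq ax _ lt e); first by case/andP: ay.
  move=> j /fnu[|]; first by congr inB; lia.
  by case: x1 => [|/(_ (- Posz j - 2))/eqP]; lia.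
have eqz x y : addable nu x -> addable nu y -> (exists k, x = y + 3 * k) ->
    1 <= x /\ 1 <= y \/ (forall k, x != 3 * k + 1) -> x = y.
  move=> ax ay [k kE] xy; case: (ltgtP x y) => // lt; exfalso.
    by apply: (aux x y ax ay) => //; [exists (- k); lia | case: xy; [case; left | right]].
  apply: (aux y x ay ax) => //; [by exists k | case: xy => [[]|h]; [by left | right => l]].
  by have := h (l + k); rewrite kE; apply: contraNneq => ->; apply/eqP; lia.
exists za, zb; split.
  rewrite /= !inE !negb_or !andbT; repeat (apply/andP; split);
    apply/eqP; rewrite /za /zb; lia.
move=> z; rewrite !inE; apply/idP/idP=> [az|]; last first.
  by case/or4P=> /eqP->; rewrite ?(addable_dual _ pnu cnu).
have az' : addable nu (- 4 - z) by rewrite addable_dual.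
have [k [] zk] := mod3_cases z; apply/or4P.
- constructor 1; apply/eqP/eqz => //; first by exists (k + Posz (size nu) + 1 - Posz ka); rewrite /za; lia.
  by right=> l; apply/eqP; lia.
- case: (ltP 0 z) => z0.
    constructor 3; apply/eqP/eqz => //; first by exists (k - Posz kb); rewrite /zb; lia.
    by left; rewrite /zb; lia.
  constructor 4; apply/eqP; suff : - 4 - z = zb by lia.
  have z2 : z != - 2 by apply: contraTneq az => ->; rewrite /addable (negPf nb2).
  apply: eqz => //; first by exists (- k - 2 - Posz kb); rewrite /zb; lia.
  by left; rewrite /zb; move: z2 => /eqP; lia.
constructor 2; apply/eqP; suff : - 4 - z = za by lia.
apply: eqz => //; first by exists (- k - 1 + Posz (size nu) - Posz ka); rewrite /za; lia.
by right=> l; apply/eqP; lia.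
Qed.
End UniqueHook.

Lemma mem_skew_conj nu la i j : is_part nu -> is_part la ->
  ((i, j) \in skew_boxes (conj_part la) (conj_part nu)) = ((j, i) \in skew_boxes la nu).
Proof. by move=> pnu pla; rewrite !mem_skew /= leqNgt !nth_conj // -leqNgt. Qed.

Lemma add_hook_ex nu z : is_part nu -> addable nu z ->
  exists la, [/\ is_part la, hook_move nu la z & add_hook 3 nu la].
Proof.
move=> pnu /andP[zB nz]; have [la pla h] := hook_move_ex pnu zB nz.
by exists la; split=> //; apply/add_hookP => //; exists z.
Qed.

Lemma add_hook_move nu la : add_hook 3 nu la -> [/\ is_part nu, is_part la & exists z, hook_move nu la z].
Proof. by move=> h; have [[pnu pla] _ _ _ _] := h; split=> //; apply/add_hookP. Qed.

(** Were the moved integer that of a lower row, this row would be unchanged in la and still encode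
    it. *)
Lemma first_row_top nu la : add_hook_first_row 3 nu la -> hook_move nu la (top nu).
Proof.
move=> [h r0]; have [pnu pla [z hz]] := add_hook_move h; have [_ sub _ _ _] := h.
suff -> : top nu = z by [].
have [/inBP[r rE] nz3 laz] := hz.
case: r rE => [|r] rE; first by rewrite /top rE; lia.
have lr : nth 0%N la r.+1 = nth 0%N nu r.+1.
  apply/eqP; rewrite eqn_leq; apply/andP; split.
    by rewrite leqNgt; apply/negP=> lt; have := r0 (r.+1, nth 0%N nu r.+1); rewrite mem_skew leqnn lt => /(_ isT).
  rewrite leqNgt; apply/negP=> lt; have := sub (r.+1, nth 0%N la r.+1).
  by rewrite !mem_boxes /= lt ltnn => /(_ isT).
have : inB la z by apply/inBP; exists r.+1; rewrite lr.
by rewrite laz eqxx andbF /= => /eqP; lia.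
Qed.

Lemma first_row_ex nu : is_part nu -> exists la, add_hook_first_row 3 nu la.
Proof.
move=> pnu; have [la [pla h ah]] := add_hook_ex pnu (addable_top pnu).
exists la; split=> // -[x y]; have [i [k [k3 laE zE _]]] := hook_moveP pnu pla h.
have ik : (i + k = 0)%N by have := nth_part_le pnu (leq0n (i + k)); rewrite /top in zE; lia.
have [_ _ _ out] := hook_shapeE laE.
case: x => // x; rewrite mem_skew /= out ?orbT //; last by apply/orP; right; lia.
by move=> /andP[] /leq_ltn_trans lt /lt; rewrite ltnn.
Qed.

Lemma conj_first_row nu la : conj_part nu = nu -> add_hook_first_row 3 nu la ->
  add_hook_first_col 3 nu (conj_part la).
Proof.
move=> cnu h; have hz := first_row_top h; have [ah r0] := h.
have [pnu pla _] := add_hook_move ah; split.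
  apply/add_hookP=> //; first exact: is_part_conj.
  by exists (- 4 - top nu); rewrite -{1}cnu; apply: hook_move_conj.
by move=> [i j] /=; rewrite -{1}cnu mem_skew_conj // => /r0.
Qed.

Lemma selfconj_move nu mu z : is_part nu -> is_part mu -> conj_part nu = nu -> conj_part mu = mu ->
  hook_move nu mu z -> z = - 2.
Proof.
move=> pnu pmu cnu cmu h; have := hook_move_conj pnu pmu h; rewrite cnu cmu => /(hook_move_inj h); lia.
Qed.

(** The move is -2 -> 1. Exactly one of -1 and 0 is encoded, so the leg length is 1, and the hook
    bends at (i, i) or at (i + 1, i + 1). *)
Lemma principal_ex nu : is_part nu -> conj_part nu = nu -> flush nu ->
  exists mu, add_principal_hook 3 nu mu /\ conj_part mu = mu.
Proof.
move=> pnu cnu fnu; have [n1 b2] := flush1 pnu cnu fnu.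
have ad2 : addable nu (- 2) by rewrite /addable b2.
have [mu [pmu h ah]] := add_hook_ex pnu ad2.
have cmu : conj_part mu = mu.
  apply: (hook_move_uniq (is_part_conj pmu) pmu _ h).
  by have := hook_move_conj pnu pmu h; rewrite cnu (_ : - 4 - - 2 = - 2).
exists mu; split=> //; split=> //; last first.
  by move=> [i j]; rewrite /= -{1}cnu -{1}cmu mem_skew_conj.
have [i [k [k3 muE zE]]] := hook_moveP pnu pmu h.
rewrite /hook_parity (_ : - 2 + 1 = - 1) // (_ : - 2 + 2 = 0) //.
have -> : inB nu (- 1) = ~~ inB nu 0 by rewrite -[in LHS]cnu inB_conj.
have -> : ~~ inB nu 0 (+) inB nu 0 by case: inB.
move=> ko; have k1 : k = 1%N by case: k k3 ko {muE zE} => [|[|[|]]].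
have [e0 e1 _ _] := hook_shapeE muE; subst k; have := e1 isT => {}e1.
have le := nth_part_le pnu (leqnSn i); rewrite addn1 in e0 zE.
have [ni|ni] := leqP (nth 0 nu i) i; [exists i | exists i.+1]; rewrite mem_skew /=.
  by rewrite e0 ni /=; lia.
have v : nth 0%N nu i.+1 = i by move: zE; clear; lia.
by rewrite /= e1 v leqnSn /= ltnS.
Qed.
End HooksOfSelfConjugate.

(** * Agreement on elements of order prime to 3 *)

Section Agreement.
Variables (n : nat) (nu : seq nat).
Hypotheses (n3 : (3 <= n)%N) (pnun : is_partn (n - 3) nu) (cnu : conj_part nu = nu).

Let pnu : is_part nu. Proof. by case/andP: pnun. Qed.

Lemma sumn_move la z : is_part la -> hook_move nu la z -> sumn la = n.
Proof.
by move=> pla h; rewrite (hook_move_sumn pnu pla h) (eqP (proj2 (andP pnun))) subnK.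
Qed.

Lemma chi_moves_seq (ps : seq (int * seq nat)) (g : 'S_n) :
    uniq (unzip1 ps) ->
    (forall q, q \in ps -> is_part q.2 /\ hook_move nu q.2 q.1) ->
    (forall z, addable nu z -> z \in unzip1 ps) -> ~~ (3 %| #[g]%g)%N ->
  \sum_(q <- ps) (-1) ^+ hook_parity nu q.1 * chi n q.2 g = 0.
Proof.
move=> ups ps_move all_ps g3; pose la z := nth [::] (unzip2 ps) (index z (unzip1 ps)).
have laE q : q \in ps -> la q.1 = q.2.
  move=> /(nthP (0, [::])) [i il <-].
  rewrite -(nth_map _ 0) // /la index_uniq ?size_map //.
  by rewrite (nth_map (0, [::])).
rewrite -[RHS](chi_moves (la := la) (g := g) n3 pnun ups).
- by rewrite big_map; apply: eq_big_seq => q /laE->.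
- by move=> z /mapP[q qs ->]; rewrite laE //; apply: ps_move.
- by move=> z zB nz; apply: all_ps; rewrite /addable zB.
by apply: contra g3; apply: ctype_dvd.
Qed.

Lemma chi_conj_alt la (g : 'S_n) : is_part la -> sumn la = n -> g \in Alt 'I_n ->
  chi n (conj_part la) g = chi n la g.
Proof.
move=> pla lan; rewrite Alt_even => ge.
by rewrite (chi_conj pla lan) cfunE sign_charE (negPf ge) mul1r.
Qed.

Lemma eq_of_signs (e f : bool) (a b x y : algC) : 0 < a -> 0 < b ->
  (-1) ^+ e * a + (-1) ^+ f * b = 0 -> (-1) ^+ e * x + (-1) ^+ f * y = 0 -> x = y.
Proof.
move=> a0 b0; case: e; case: f; rewrite !(expr0, expr1, mul1r, mulN1r).
- by move/eqP; rewrite -opprD oppr_eq0 gt_eqF // addr_gt0.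
- by move=> _ /eqP; rewrite addrC subr_eq0 => /eqP.
- by move=> _ /eqP; rewrite subr_eq0 => /eqP.
by move/eqP; rewrite gt_eqF // addr_gt0.
Qed.

(** la and its conjugate enter the vanishing sum with equal signs and equal values on A_n, hence the
    factor 2. *)
Lemma core_agree la mu : flush nu -> is_part la -> is_part mu ->
    hook_move nu la (top nu) -> hook_move nu mu (- 2) ->
  forall g : 'S_n, g \in Alt 'I_n -> ~~ (3 %| #[g]%g)%N -> chi n la g *+ 2 = chi n mu g.
Proof.
move=> fnu pla pmu hla hmu.
have hla' := hook_move_conj pnu pla hla; rewrite cnu in hla'.
pose ps := [:: (top nu, la); (- 2, mu); (- 4 - top nu, conj_part la)].
have E (g : 'S_n) : g \in Alt 'I_n -> ~~ (3 %| #[g]%g)%N ->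
    (-1) ^+ hook_parity nu (top nu) * (chi n la g *+ 2) + (-1) ^+ hook_parity nu (- 2) * chi n mu g = 0.
  move=> Ag g3; have cE := chi_conj_alt pla (sumn_move pla hla) Ag.
  have hE : hook_parity nu (- 4 - top nu) = hook_parity nu (top nu).
    by rewrite -{1}cnu hook_parity_conj.
  have := chi_moves_seq (ps := ps) _ _ _ g3.
  rewrite 3!big_cons big_nil addr0; cbn [fst snd]; rewrite cE hE => e.
  rewrite mulr2n mulrDr -addrA [X in _ + X]addrC; apply: e.
  - rewrite /= !inE negb_or andbT /top; repeat (apply/andP; split); apply/eqP; lia.
  - by move=> q; rewrite !inE => /or3P[]/eqP-> /=; split=> //; apply: is_part_conj.
  by move=> z; rewrite addable_core.
move=> g Ag g3; have := E 1%g (group1 _); rewrite order1 => /(_ isT) E1.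
apply: (eq_of_signs _ _ E1 (E g Ag g3)); last by rewrite chi1_gt0 // (sumn_move pmu hmu).
by rewrite pmulrn_lgt0 // chi1_gt0 // (sumn_move pla hla).
Qed.

Lemma four_agree la mu : four_added 3 nu la mu ->
  forall g : 'S_n, g \in Alt 'I_n -> ~~ (3 %| #[g]%g)%N -> chi n la g = chi n mu g.
Proof.
move=> [us all4].
have [_ pla [z hla]] : [/\ is_part nu, is_part la & exists z, hook_move nu la z].
  by apply: add_hook_move; apply/all4; rewrite inE eqxx.
have [_ pmu [y hmu]] : [/\ is_part nu, is_part mu & exists z, hook_move nu mu z].
  by apply: add_hook_move; apply/all4; rewrite !inE eqxx !orbT.
have hla' := hook_move_conj pnu pla hla; have hmu' := hook_move_conj pnu pmu hmu.
rewrite cnu in hla' hmu'.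
pose ps := [:: (z, la); (- 4 - z, conj_part la); (y, mu); (- 4 - y, conj_part mu)].
have ps_move q : q \in ps -> is_part q.2 /\ hook_move nu q.2 q.1.
  by rewrite !inE => /or4P[]/eqP-> /=; split=> //; apply: is_part_conj.
have E (g : 'S_n) : g \in Alt 'I_n -> ~~ (3 %| #[g]%g)%N ->
    (-1) ^+ hook_parity nu z * (chi n la g *+ 2) + (-1) ^+ hook_parity nu y * (chi n mu g *+ 2) = 0.
  move=> Ag g3; have cl := chi_conj_alt pla (sumn_move pla hla) Ag.
  have cm := chi_conj_alt pmu (sumn_move pmu hmu) Ag.
  have hl : hook_parity nu (- 4 - z) = hook_parity nu z.
    by rewrite -{1}cnu hook_parity_conj.
  have hm : hook_parity nu (- 4 - y) = hook_parity nu y.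
    by rewrite -{1}cnu hook_parity_conj.
  have := chi_moves_seq (ps := ps) _ ps_move _ g3.
  rewrite 4!big_cons big_nil addr0; cbn [fst snd]; rewrite cl cm hl hm => e.
  rewrite !mulr2n !mulrDr -addrA; apply: e.
  (* Distinct partitions come from distinct moves, since a move determines its result. *)
  - have ups : uniq ps by apply: (@map_uniq _ _ snd).
    rewrite map_inj_in_uniq // => -[z1 la1] [z2 la2] /ps_move[/= p1 h1] /ps_move[/= p2 h2] e.
    by subst z2; rewrite (hook_move_uniq p1 p2 h1 h2).
  move=> x ax; have [ka [pka hka ahka]] := add_hook_ex pnu ax.
  have : ka \in unzip2 ps by apply/all4.
  case/mapP=> q qs kaE; apply/mapP; exists q => //; have [_ hq] := ps_move q qs.
  by apply: (hook_move_inj hka); rewrite kaE.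
move=> g Ag g3; have := E 1%g (group1 _); rewrite order1 => /(_ isT) E1.
have pos ka x : is_part ka -> hook_move nu ka x -> 0 < chi n ka 1%g *+ 2.
  by move=> pka hka; rewrite pmulrn_lgt0 // chi1_gt0 // (sumn_move pka hka).
have := eq_of_signs (pos _ _ pla hla) (pos _ _ pmu hmu) E1 (E g Ag g3).
by rewrite !mulr2n -!mulr2n => /eqP; rewrite eqrMn2r // => /eqP.
Qed.

Lemma four_added_ex : inB nu 1 -> flush_but1 nu -> exists la mu, four_added 3 nu la mu.
Proof.
move=> b1 fnu; have [z [y [us adE]]] := addable_but1 pnu cnu b1 fnu.
have [la [pla hla ahla]] := add_hook_ex pnu (etrans (adE z) (mem_head _ _)).
have ay : addable nu y by rewrite adE !inE eqxx !orbT.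
have [mu [pmu hmu ahmu]] := add_hook_ex pnu ay.
have hla' := hook_move_conj pnu pla hla; have hmu' := hook_move_conj pnu pmu hmu.
rewrite cnu in hla' hmu'.
pose ps := [:: (z, la); (- 4 - z, conj_part la); (y, mu); (- 4 - y, conj_part mu)].
have ps_move q : q \in ps -> is_part q.2 /\ hook_move nu q.2 q.1.
  by rewrite !inE => /or4P[]/eqP-> /=; split=> //; apply: is_part_conj.
exists la, mu; split.
  have ups : uniq ps by apply: (@map_uniq _ _ fst).
  rewrite -[X in uniq X]/(unzip2 ps) map_inj_in_uniq //.
  move=> [z1 la1] [z2 la2] /ps_move[/= p1 h1] /ps_move[/= p2 h2] e.
  by subst la2; rewrite (hook_move_inj h1 h2).
move=> ka; rewrite -[X in ka \in X]/(unzip2 ps); split.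
  move=> /add_hook_move[_ pka [x hka]]; have [xB nx _] := hka.
  have : x \in unzip1 ps by rewrite -[X in x \in X]/[:: z; - 4 - z; y; - 4 - y] -adE /addable xB.
  case/mapP=> q qs xE; apply/mapP; exists q => //; have [pq hq] := ps_move q qs.
  by apply: (hook_move_uniq pka pq hka); rewrite xE.
case/mapP=> q qs ->; have [pq hq] := ps_move q qs.
by apply/add_hookP => //; exists q.1.
Qed.
End Agreement.

(** nu encodes no nonnegative integer congruent to 1, so 1 is the only such integer for mu. *)
Lemma core_split_agree n nu mu (p m : Iirr (Alt 'I_n)) : is_part nu -> conj_part nu = nu ->
    flush nu -> (0 < n)%N -> is_part mu -> sumn mu = n -> conj_part mu = mu ->
    hook_move nu mu (- 2) -> alt_split mu p m -> agree_on_prime_to 3 'chi_p 'chi_m.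
Proof.
move=> pnu cnu fnu n0 pmu mun cmu [_ _ muz] sp; have [n1 b2] := flush1 pnu cnu fnu.
apply: (alt_split_diag3 n0 pmu mun cmu _ _ sp); first by rewrite muz orbT.
move=> z z0; rewrite muz => /orP[/andP[bz _]|/eqP]; last lia.
by case/negP: n1; apply: (flush_down pnu fnu (k := `|z|)); move: bz; congr inB; lia.
Qed.

Lemma core_case n nu : (3 <= n)%N -> is_partn (n - 3) nu -> conj_part nu = nu -> is_core 3 nu ->
  forall la mu : seq nat, add_hook_first_row 3 nu la -> add_principal_hook 3 nu mu ->
    conj_part mu = mu ->
  forall p m : Iirr (Alt 'I_n), alt_split mu p m ->
    agree_on_prime_to 3 (chi_alt n la) 'chi_p /\ agree_on_prime_to 3 (chi_alt n la) 'chi_m.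
Proof.
move=> n3 pn cnu core la mu la_row [ah _ _] cmu p m sp.
have pnu : is_part nu by case/andP: pn.
have fnu := core_flush pnu core; have hla := first_row_top la_row.
have [_ pla _] := add_hook_move (proj1 la_row).
have [_ pmu [z hmu]] := add_hook_move ah.
have z2 := selfconj_move pnu pmu cnu cmu hmu; subst z.
have n0 : (0 < n)%N by rewrite (leq_trans _ n3).
have pmE := core_split_agree pnu cnu fnu n0 pmu (sumn_move n3 pn pmu hmu) cmu hmu sp.
have [_ sumE _] := sp.
have E g : g \in Alt 'I_n -> ~~ (3 %| #[g]%g)%N -> chi_alt n la g = 'chi_p g.
  move=> Ag g3; have := core_agree n3 pn cnu fnu pla pmu hla hmu Ag g3.
  have := congr1 (fun f : 'CF(Alt 'I_n) => f g) sumE.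
  rewrite /chi_alt cfunE -(pmE g Ag g3) -mulr2n !cfResE ?Alt_subset // => -> /eqP.
  by rewrite eqrMn2r // => /eqP.
by split=> g Ag g3; rewrite E // (pmE g Ag g3).
Qed.

Close Scope ring_scope.

Theorem theorem6p1 (n : nat) (hn : 3 <= n) :
  (forall nu : seq nat, is_partn (n - 3) nu -> conj_part nu = nu ->
     (is_core 3 nu ->
        [/\ exists la, add_hook_first_row 3 nu la,
            exists mu, add_principal_hook 3 nu mu /\ conj_part mu = mu
          & forall la mu : seq nat,
              add_hook_first_row 3 nu la ->
              add_principal_hook 3 nu mu -> conj_part mu = mu ->
              add_hook_first_col 3 nu (conj_part la) /\
              (forall p m : Iirr (Alt 'I_n), alt_split mu p m ->
                 agree_on_prime_to 3 (chi_alt n la) ('chi_p)%R /\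
                 agree_on_prime_to 3 (chi_alt n la) ('chi_m)%R)])
     /\
     (unique_hook 3 nu ->
        [/\ {in hooks 3 nu, forall b, b.1 = b.2},
            exists la mu, four_added 3 nu la mu
          & forall la mu : seq nat, four_added 3 nu la mu ->
              agree_on_prime_to 3 (chi_alt n la) (chi_alt n mu)]))
  /\
  (forall nu1 nu2 : seq nat,
     is_partn (n - 3) nu1 -> conj_part nu1 = nu1 -> is_core 3 nu1 ->
     is_partn (n - 3) nu2 -> conj_part nu2 = nu2 -> is_core 3 nu2 ->
     nu1 = nu2)
  /\
  (forall (w : nat) (nu1 nu2 : seq nat),
     is_partn (n - 3) nu1 -> conj_part nu1 = nu1 -> unique_hook 3 nu1 ->
     is_partn (n - 3) nu2 -> conj_part nu2 = nu2 -> unique_hook 3 nu2 ->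
     has_weight 3 nu1 w -> has_weight 3 nu2 w ->
     nu1 = nu2).
Proof.
have core_weight nu : is_part nu -> is_core 3 nu -> has_weight 3 nu 0.
  by move=> pnu core; apply: weight_core.
split=> [nu pn cnu|].
  have pnu : is_part nu by case/andP: pn.
  split=> [core|uh].
    have fnu := core_flush pnu core; split.
    - exact: first_row_ex.
    - exact: principal_ex.
    move=> la mu la_row mu_pr cmu; split; first exact: conj_first_row.
    by move=> p m sp; apply: (core_case hn pn cnu core la_row mu_pr cmu sp).
  have [b1 fnu diag] := unique_hookP pnu cnu uh; split=> //.
    exact: (four_added_ex pn cnu b1 fnu).
  move=> la mu four g Ag g3; rewrite /chi_alt !cfResE ?Alt_subset //.
  exact: (four_agree hn pn cnu four).
(* Cores are the case w = 0 of the same argument. *)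
have uniq_w w nu1 nu2 : is_partn (n - 3) nu1 -> conj_part nu1 = nu1 -> flush_but1 nu1 ->
    is_partn (n - 3) nu2 -> conj_part nu2 = nu2 -> flush_but1 nu2 ->
    has_weight 3 nu1 w -> has_weight 3 nu2 w -> nu1 = nu2.
  move=> /andP[p1 /eqP s1] c1 f1 /andP[p2 /eqP s2] c2 f2.
  by apply: weight_unique => //; [rewrite s1 s2 | exact: core_flush].
have part nu : is_partn (n - 3) nu -> is_part nu by case/andP.
split=> [nu1 nu2 p1 c1 core1 p2 c2 core2 | w nu1 nu2 p1 c1 u1 p2 c2 u2].
  apply: (uniq_w 0) => //; try (by apply: core_weight => //; apply: part).
    by move=> z; left; apply: (core_flush (part _ p1)).
  by move=> z; left; apply: (core_flush (part _ p2)).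
apply: uniq_w => //.
  by have [] := unique_hookP (part _ p1) c1 u1.
by have [] := unique_hookP (part _ p2) c2 u2.
Qed.
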